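(* For the partially observed system $x_{t+1}=Ax_t+B_ww_t$, $y_t=Cx_t+D_vv_t$ and the multi-step and rolled-out single-step least-squares predictors $\hat G^{MS}_N,\hat G^{SS}_N$ of horizon $H\ge1$ defined in the context, let $B(\hat G_N)=\lim_{N\to\infty}\mathbf{E}\,L(\hat G_N)$ denote the irreducible error. Then $$B(\hat G_N^{MS})=\min_{M\in\mathbb{R}^{Hd_y\times d_y}}\left\{\operatorname{tr}\left((\Phi+MC)\Sigma_{\hat x}(\Phi+MC)^\top\right)+\operatorname{tr}\left(MD_eD_e^\top M^\top\right)\right\}+\|\Gamma_e\|_F^2,$$ and therefore the irreducible error of the direct multi-step predictor never exceeds that of the single-step predictor: $$B(\hat G_N^{MS})\le B(\hat G_N^{SS}).$$
   Context: System: $x_{t+1}=Ax_t+B_ww_t$, $y_t=Cx_t+D_vv_t$, with $x_t\in\mathbb{R}^{d_x}$, $y_t\in\mathbb{R}^{d_y}$, $x_0=0$, and $w_t\sim\mathcal N(0,I_{d_x})$, $v_t\sim\mathcal N(0,I_{d_y})$ i.i.d. and mutually independent (there are no inputs). Standing assumptions: $\rho(A)<1$ (spectral radius), $(A,C)$ observable, $(A,B_w)$ controllable, $D_vD_v^\top\succ0$. Dataset: $y_1,\dots,y_N$ from one rollout. For a sequence $a$, $a_{s:r}$ denotes the stacked vector of $a_s,\dots,a_r$. Multi-step predictor: $\hat G^{MS}_N=\arg\min_{G\in\mathbb{R}^{Hd_y\times d_y}}\sum_{t=1}^{N-H}\|y_{t+1:t+H}-Gy_t\|^2$. Single-step predictor: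 $\hat G_y=\arg\min_{G_y\in\mathbb{R}^{d_y\times d_y}}\sum_{t=1}^{N-1}\|y_{t+1}-G_yy_t\|^2$, and $\hat G^{SS}_N\in\mathbb{R}^{Hd_y\times d_y}$ is the stack of $\hat G_y,\hat G_y^2,\dots,\hat G_y^H$. ($N$ is large enough that the minimizers are almost surely unique.) Loss: for a matrix $G\in\mathbb{R}^{Hd_y\times d_y}$, $L(G)=\lim_{T\to\infty}\mathbf{E}\frac1T\sum_{t=0}^T\|y_{t+1:t+H}-Gy_t\|^2$, the expectation being over an evaluation rollout of the system independent of the dataset; equivalently, the expectation under the stationary distribution of the system. In $\mathbf{E}\,L(\hat G_N)$ the outer expectation is over the dataset. Innovations form: let $S$ be the stabilizing solution of the Riccati equation $S=ASA^\top-ASC^\top(CSC^\top+D_vD_v^\top)^{-1}CSA^\top+B_wB_w^\top$, let $K=ASC^\top(CSC^\top+D_vD_v^\top)^{-1}$ be the Kalman gain, and $D_e=(CSC^\top+D_vD_v^\top)^{1/2}$. In stationarity, $\hat x_{t+1}=A\hat x_t+KD_ee_t$, $y_t=C\hat x_t+D_ee_t$, with $e_t$ i.i.d. standard normal. $\Sigma_{\hat x}$ is the stationary covariance of $\hat x_t$ (so $\Sigma_{\hat x}=A\Sigma_{\hat x}A^\top+KD_eD_e^\top K^\top$). $\Phi\in\mathbb{R}^{Hd_y\times d_x}$ has $i$-th block row $CA^{i-1}(A-KC)$, $1\le i\le H$. $\Gamma_e\in\mathbb{R}^{Hd_y\times Hd_y}$ is block lower triangular with diagonal blocks $D_e$ and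 $(i,j)$ block $CA^{i-j-1}KD_e$ for $i>j$. $\|\cdot\|_F$ is the Frobenius norm. *)

(* Defs.v *)
From HB Require Import structures.
From mathcomp Require Import all_boot all_order all_algebra.
From mathcomp Require Import complex.
From mathcomp Require Import all_classical all_reals all_analysis.

Set Implicit Arguments.
Unset Strict Implicit.
Unset Printing Implicit Defensive.

Import Order.TTheory GRing.Theory Num.Theory.
Import numFieldNormedType.Exports.

Local Open Scope classical_set_scope.
Local Open Scope ring_scope.

(** * Matrices *)

Section MatrixNotions.
Context {R : realType}.

(* Squared Frobenius norm; on column vectors, the squared Euclidean norm. *)
Definition sqnorm {m n : nat} (M : 'M[R]_(m, n)) : R :=
  \sum_(i < m) \sum_(j < n) M i j ^+ 2.

(* The eigenvalues are the complex ones, hence the embedding into R[i].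
   (In dimension 0 this is sup set0 = 0.) *)
Definition spectral_radius {n : nat} (A : 'M[R]_n) : R :=
  sup [set Normc.normc l | l in
        [set l : R[i] | eigenvalue (map_mx (real_complex R) A) l]].

Definition posdefmx {n : nat} (M : 'M[R]_n) : Prop :=
  M^T = M /\ forall u : 'cV[R]_n, u != 0 -> 0 < (u^T *m M *m u) ord0 ord0.

Definition possemidefmx {n : nat} (M : 'M[R]_n) : Prop :=
  M^T = M /\ forall u : 'cV[R]_n, 0 <= (u^T *m M *m u) ord0 ord0.

(* D is the principal square root of M. *)
Definition is_sqrtmx {n : nat} (M D : 'M[R]_n) : Prop :=
  possemidefmx D /\ D *m D = M.

(* Kalman rank conditions. *)
Definition observable {n p : nat} (A : 'M[R]_n) (C : 'M[R]_(p, n)) : Prop :=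
  \rank (\mxcol_(i < n) (C *m A ^+ i)) = n.

Definition controllable {n m : nat} (A : 'M[R]_n) (B : 'M[R]_(n, m)) : Prop :=
  \rank (\mxrow_(i < n) (A ^+ i *m B)) = n.

End MatrixNotions.

(** * Gaussian white noise *)

Section Noise.
Context {d : measure_display} {T : measurableType d} {R : realType}.
Variable P : probability T R.

Definition mutually_independent {I : eqType} (X : I -> {RV P >-> R}) : Prop :=
  forall (s : seq I) (U : I -> set R),
    uniq s -> (forall i, measurable (U i)) ->
    P (\bigcap_(i in [set` s]) (X i @^-1` U i)) =
    (\prod_(i <- s) P (X i @^-1` U i))%E.

(* Independence of the sigma-algebras generated by the two families, tested on
   the pi-systems of finite-dimensional rectangles. *)
Definition independent_families {I J : eqType}
    (X : I -> {RV P >-> R}) (Y : J -> {RV P >-> R}) : Prop :=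
  forall (s : seq I) (r : seq J) (U : I -> set R) (V : J -> set R),
    (forall i, measurable (U i)) -> (forall j, measurable (V j)) ->
    P ((\bigcap_(i in [set` s]) (X i @^-1` U i)) `&`
       (\bigcap_(j in [set` r]) (Y j @^-1` V j))) =
    (P (\bigcap_(i in [set` s]) (X i @^-1` U i)) *
     P (\bigcap_(j in [set` r]) (Y j @^-1` V j)))%E.

Definition iid_std_normal {I : eqType} (X : I -> {RV P >-> R}) : Prop :=
  (forall i (U : set R), measurable U ->
     distribution P (X i) U = normal_prob 0 1 U) /\
  mutually_independent X.

(* Random vectors are given by their coordinates: [w t i] is the i-th
   coordinate of w_t.  A vector has law N(0, I) iff its coordinates are i.i.d.
   N(0, 1), so the next two predicates say that the vectors w_t ~ N(0, I_n)
   (resp. w_t ~ N(0, I_n) and v_t ~ N(0, I_p)), t = 0, 1, ..., are mutually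
   independent. *)
Definition white_noise {n : nat} (w : nat -> 'I_n -> {RV P >-> R}) : Prop :=
  iid_std_normal (fun k : nat * 'I_n => w k.1 k.2).

Definition white_noise2 {n p : nat}
    (w : nat -> 'I_n -> {RV P >-> R}) (v : nat -> 'I_p -> {RV P >-> R}) : Prop :=
  iid_std_normal (fun k : nat * ('I_n + 'I_p) =>
    match k.2 with inl i => w k.1 i | inr j => v k.1 j end).

Definition sample_path {n : nat} (w : nat -> 'I_n -> {RV P >-> R})
    (o : T) (t : nat) : 'cV[R]_n :=
  \col_i w t i o.

End Noise.

(** * The system, its rollouts and the predictors *)

Section System.
Context {R : realType} {dx dy : nat}.
Implicit Types (A Bw S : 'M[R]_dx) (C : 'M[R]_(dy, dx)) (Dv De : 'M[R]_dy).

Fixpoint state A Bw (w : nat -> 'cV[R]_dx) (t : nat) : 'cV[R]_dx :=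
  if t is t'.+1 then A *m state A Bw w t' + Bw *m w t' else 0.

Definition output A Bw C Dv (w : nat -> 'cV[R]_dx) (v : nat -> 'cV[R]_dy)
    (t : nat) : 'cV[R]_dy :=
  C *m state A Bw w t + Dv *m v t.

(* Stacked objects have (\sum_(i < H) dy) = H * dy rows; block i : 'I_H is the
   block of index i + 1 in 1-based notation. *)

(* y_{t+1:t+H} *)
Definition future (H : nat) (y : nat -> 'cV[R]_dy) (t : nat) :
    'cV[R]_(\sum_(i < H) dy) :=
  \mxcol_(i < H) y (t + i.+1)%N.

Definition multi_step_cost (H N : nat) (y : nat -> 'cV[R]_dy)
    (G : 'M[R]_(\sum_(i < H) dy, dy)) : R :=
  \sum_(1 <= t < (N - H).+1) sqnorm (future H y t - G *m y t).

Definition single_step_cost (N : nat) (y : nat -> 'cV[R]_dy) (G : 'M[R]_dy) : R :=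
  \sum_(1 <= t < N) sqnorm (y t.+1 - G *m y t).

Definition is_argmin {X : Type} (f : X -> R) (x : X) : Prop :=
  forall x' : X, f x <= f x'.

(* The stack of Gy, Gy^2, ..., Gy^H. *)
Definition rollout (H : nat) (Gy : 'M[R]_dy) : 'M[R]_(\sum_(i < H) dy, dy) :=
  \mxcol_(i < H) (Gy ^+ i.+1).

(** Innovations form *)

Definition innovation_cov C Dv S : 'M[R]_dy := C *m S *m C^T + Dv *m Dv^T.

Definition kalman_gain A C Dv S : 'M[R]_(dx, dy) :=
  A *m S *m C^T *m invmx (innovation_cov C Dv S).

Definition is_stabilizing_riccati A Bw C Dv S : Prop :=
  [/\ possemidefmx S,
      S = A *m S *m A^T
          - A *m S *m C^T *m invmx (innovation_cov C Dv S) *m C *m S *m A^T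
          + Bw *m Bw^T
    & spectral_radius (A - kalman_gain A C Dv S *m C) < 1].

Definition Phi_mx (H : nat) A C (K : 'M[R]_(dx, dy)) :
    'M[R]_(\sum_(i < H) dy, dx) :=
  \mxcol_(i < H) (C *m A ^+ i *m (A - K *m C)).

Definition Gamma_e (H : nat) A C (K : 'M[R]_(dx, dy)) De :
    'M[R]_(\sum_(i < H) dy, \sum_(j < H) dy) :=
  \mxblock_(i < H, j < H)
    (if (i == j)%N then De
     else if (j < i)%N then C *m A ^+ (i - j - 1)%N *m K *m De
     else 0).

Definition predictor_objective (H : nat) C De (Sxhat : 'M[R]_dx)
    (Phi : 'M[R]_(\sum_(i < H) dy, dx)) (M : 'M[R]_(\sum_(i < H) dy, dy)) : R :=
  \tr ((Phi + M *m C) *m Sxhat *m (Phi + M *m C)^T) +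
  \tr (M *m De *m De^T *m M^T).

(* The output trajectory y_0, y_1, ... driven by random noises. *)
Definition random_output {d : measure_display} {T : measurableType d}
    {P : probability T R} A Bw C Dv
    (w : nat -> 'I_dx -> {RV P >-> R}) (v : nat -> 'I_dy -> {RV P >-> R})
    (o : T) : nat -> 'cV[R]_dy :=
  output A Bw C Dv (sample_path w o) (sample_path v o).

End System.

Arguments multi_step_cost {R dy} H N y G.
Arguments single_step_cost {R dy} N y G.

(* Sigma is the covariance of z_t, at every t, for a (wide-sense) stationary
   square-integrable solution of z_{t+1} = A z_t + B e_t with e_t i.i.d.
   N(0, I_m), the initial state being independent of e_0, e_1, ... *)
Definition is_stationary_covariance {R : realType} {n m : nat}
    (A : 'M[R]_n) (B : 'M[R]_(n, m)) (Sigma : 'M[R]_n) : Prop :=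
  exists (d : measure_display) (T : measurableType d) (P : probability T R)
         (z : nat -> 'I_n -> {RV P >-> R}) (e : nat -> 'I_m -> {RV P >-> R}),
    [/\ white_noise e,
        independent_families (z 0%N) (fun k : nat * 'I_m => e k.1 k.2),
        (forall t o, sample_path z o t.+1 =
           A *m sample_path z o t + B *m sample_path e o t),
        (forall t i, (z t i : T -> R) \in Lfun P 2%:E)
      & forall t i j, covariance P (z t i) (z t j) = (Sigma i j)%:E].

(** * Loss and irreducible error *)

Section Loss.
Context {R : realType} {dy : nat}.

(* Here [y o] is the output trajectory of the evaluation rollout; its
   probability space is not the one of the dataset, so that [loss P y G] is a
   deterministic function of G and evaluating it at a data-dependent G amounts
   to an evaluation rollout independent of the dataset. *)
Definition mean_loss {d : measure_display} {T : measurableType d}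
    (P : probability T R) (y : T -> nat -> 'cV[R]_dy) (H : nat)
    (G : 'M[R]_(\sum_(i < H) dy, dy)) (n : nat) : \bar R :=
  expectation P (fun o => n%:R^-1 *
     \sum_(0 <= t < n.+1) sqnorm (future H (y o) t - G *m y o t)).

Definition loss {d : measure_display} {T : measurableType d}
    (P : probability T R) (y : T -> nat -> 'cV[R]_dy) (H : nat)
    (G : 'M[R]_(\sum_(i < H) dy, dy)) : \bar R :=
  limn (mean_loss P y G).

Definition random_matrix {d : measure_display} {T : measurableType d}
    {m n : nat} (G : T -> 'M[R]_(m, n)) : Prop :=
  forall i j, measurable_fun [set: T] (fun o => G o i j).

(* N |-> E L(G_N), the expectation being over the dataset. *)
Definition expected_loss {d : measure_display} {T : measurableType d}
    (P : probability T R) (H : nat)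
    (L : 'M[R]_(\sum_(i < H) dy, dy) -> \bar R)
    (G : nat -> T -> 'M[R]_(\sum_(i < H) dy, dy)) (N : nat) : \bar R :=
  (\int[P]_o L (G N o))%E.

Definition irreducible_error {d : measure_display} {T : measurableType d}
    (P : probability T R) (H : nat)
    (L : 'M[R]_(\sum_(i < H) dy, dy) -> \bar R)
    (G : nat -> T -> 'M[R]_(\sum_(i < H) dy, dy)) : \bar R :=
  limn (expected_loss P L G).

End Loss.

Arguments mean_loss {R dy d T} P y H G n.
Arguments loss {R dy d T} P y H G.

(* Main.v *)
Require Import Defs.
From HB Require Import structures.
From mathcomp Require Import all_boot all_order all_algebra.
From mathcomp Require Import complex ring lra.
From mathcomp Require Import all_classical all_reals all_analysis.
From mathcomp Require Import measurable_realfun.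

Set Implicit Arguments.
Unset Strict Implicit.
Unset Printing Implicit Defensive.

Import Order.TTheory GRing.Theory Num.Theory.
Import numFieldNormedType.Exports.

Local Open Scope classical_set_scope.
Local Open Scope ring_scope.

(** Write [Gam m] for the stationary covariance of y_(t+m) and y_t, [Psi] for the
    stack of [Gam 1, ..., Gam H].  Sample averages of y_(t+m) y_t^T converge to
    [Gam m] in every L^k, so the loss is the quadratic form
    [ell G = H tr Gam0 - 2 tr (Psi G^T) + tr (G Gam0 G^T)], minimal at
    [G* = Psi Gam0^-1].  A least-squares estimator satisfies
    |G_N - G*|^2 <= 4 F_N^2 |E_N|^2, with E_N the averaged normal-equation
    residual at G*, which tends to 0, and F_N the inverse of the empirical
    covariance.  The point is to control E F_N^k: the output noise is Gaussian
    with invertible [Dv], so determinants of blocks of consecutive outputs have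
    a bounded moment of order -1/2, and a long window, containing many such
    blocks, has bounded inverse moments of any prescribed order; convexity then
    averages over windows.  Hence G_N -> G* in every L^k and E L(G_N) -> ell G*,
    while the rolled-out single-step predictor tends to some G1 with
    ell G1 >= ell G*.  Finally, with Sigma = S + Sigma_xhat, completing the
    square in [M = K^ - G], where K^ stacks the blocks C A^i K, turns [ell G]
    into the objective in M plus |Gamma_e|^2. *)

(** * Gaussian integrals *)

(** The loss is quadratic in the predictor, so almost sure convergence of the estimator would not
    give convergence of [E L]: its moments must be controlled, and a nearly singular empirical
    covariance may make them infinite. The order -1/2 comes from dimension one: the Gaussian density
    is bounded, |x|^(-1/2) is integrable against it uniformly in shifts, and |x|^(-1) is not.
    Expanded along the diagonal of a block, each determinant is affine in a fresh measurement noise,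
    so the bound holds with the past frozen and multiplies over successive blocks, although these
    share the state. The window needed grows with the moment order; this is why [null] asks for
    smallness one order at a time, each from its own sample size on. The proof never relates the
    innovations process to the outputs: the Riccati and Lyapunov equations show that S + Sigma_xhat
    solves the Lyapunov equation of the state, and the rest is matrix algebra. *)

Section NormalDensity.
Context {R : realType} (m s : R).
Local Notation mu := (@lebesgue_measure R).
Local Open Scope ereal_scope.

Lemma integral_normal_prob (f : measurableTypeR R -> \bar R) :
  measurable_fun setT f -> (forall x, 0 <= f x) ->
  \int[normal_prob m s]_x f x = \int[mu]_x (f x * (normal_pdf m s x)%:E).
Proof.
move=> mf f0; have dom := normal_prob_dominates m s.
rewrite -(Radon_Nikodym_SigmaFinite.change_of_variables dom f0 measurableT mf).
have ig := Radon_Nikodym_SigmaFinite.f_integrable dom.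
have mpdf : measurable_fun setT (fun x => (normal_pdf m s x)%:E).
  by apply/measurable_EFinP; exact: measurable_normal_pdf.
apply: ae_eq_integral => //.
- by apply: emeasurable_funM => //; exact: measurable_int ig.
- exact: emeasurable_funM.
(* The Radon-Nikodym derivative and the density have the same integral over every measurable set,
   hence agree almost everywhere. *)
apply: ae_eqe_mul2l; apply: integral_ae_eq => // E _ mE.
by rewrite -Radon_Nikodym_SigmaFinite.f_integral.
Qed.

End NormalDensity.

Section StandardNormal.
Context {R : realType}.
Local Open Scope ereal_scope.

(* [normal_prob] lives on [measurableTypeR R], whose display differs from the
   one of the canonical measurable structure of R. *)
Let midR : measurable_fun [set: measurableTypeR R] (id : measurableTypeR R -> R).
Proof. by move=> _ A mA; rewrite setTI preimage_id. Qed.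

Let idR_mixin := isMeasurableFun.Build _ _ _ _ _ midR.
Let idR : {mfun measurableTypeR R >-> R} := HB.pack (id : measurableTypeR R -> R) idR_mixin.

(** Existential packaging: after [Qed] only the two properties are visible, so the transport between
    the two measurable structures of R happens here once. *)
Lemma std_normal_sig : {N : probability R R |
  (forall U, N U = normal_prob 0%R 1%R U) /\
  (forall f : R -> \bar R, measurable_fun setT f -> (forall x, 0 <= f x) ->
    \int[N]_x f x = \int[lebesgue_measure]_x (f x * (normal_pdf 0%R 1%R x)%:E))}.
Proof.
exists (distribution (normal_prob 0%R 1%R) idR); split=> // f mf f0.
by rewrite -integral_normal_prob// (ge0_integral_distribution idR).
Qed.

Definition std_normal : probability R R := sval std_normal_sig.

Lemma std_normalE U : std_normal U = normal_prob 0%R 1%R U.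
Proof. exact: (svalP std_normal_sig).1. Qed.

Lemma integral_std_normal (f : R -> \bar R) :
  measurable_fun setT f -> (forall x, 0 <= f x) ->
  \int[std_normal]_x f x =
  \int[lebesgue_measure]_x (f x * (normal_pdf 0%R 1%R x)%:E).
Proof. exact: (svalP std_normal_sig).2. Qed.

End StandardNormal.

Section NormalMoments.
Context {R : realType}.
Local Notation mu := (@lebesgue_measure R).
Local Notation N := (@std_normal R).

(** The exponential factor turns the N(0,1) density into s times the N(0,s^2) density. With
    elementary lower bounds on [expR] this gives both the finiteness of all moments and the value of
    the second one. *)
Lemma normal_exp_square (s : R) : 0 < s ->
  (\int[N]_x (expR ((1 - s ^- 2) / 2 * x ^+ 2))%:E = s%:E)%E.
Proof.
move=> s0; rewrite integral_std_normal; last 2 first.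
- by apply/measurable_EFinP; apply: measurableT_comp => //;
    apply: measurable_funM => //; exact: measurable_funX.
- by move=> x; rewrite lee_fin expR_ge0.
have sn0 : s != 0 by rewrite gt_eqF.
transitivity (\int[mu]_x (s%:E * (normal_pdf 0 s x)%:E))%E; last first.
  rewrite ge0_integralZl//; last 3 first.
  - by apply/measurable_EFinP; exact: measurable_normal_pdf.
  - by move=> x _; rewrite lee_fin normal_pdf_ge0.
  - by rewrite lee_fin ltW.
  by rewrite integral_normal_pdf mule1.
apply: eq_integral => x _; rewrite -!EFinM !normal_pdfE// ?oner_neq0// /normal_peak /normal_fun.
congr (_%:E); rewrite mulrCA [in RHS]mulrA -expRD.
have -> : (1 - s ^- 2) / 2 * x ^+ 2 + - (x - 0) ^+ 2 / (1 ^+ 2 *+ 2) =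
  - (x - 0) ^+ 2 / (s ^+ 2 *+ 2) by field.
congr (_ * _); rewrite expr1n mul1r -mulrnAr sqrtrM ?sqr_ge0// sqrtr_sqr gtr0_norm//.
by rewrite invfM mulrA divff// mul1r.
Qed.

Lemma normal_moment_bounded k : exists C : R,
  (\int[N]_x (`|x| ^+ k)%:E <= C%:E)%E.
Proof.
(* Any s > 1 makes [th] positive; here [th] is 3/8. *)
pose s : R := 2; pose th : R := (1 - s ^- 2) / 2.
have th0 : 0 < th by rewrite /th /s; lra.
(* For |x| > 1, |x|^k <= x^(2k), and th^k x^(2k) / k! is one term of an exponential series; the
   summand 1 covers |x| <= 1, and s is the integral of the exponential. *)
exists ((k`!%:R / th ^+ k + 1) * s).
apply: (@le_trans _ _ (\int[N]_x ((k`!%:R / th ^+ k + 1)%:E *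
   (expR (th * x ^+ 2))%:E)))%E.
  apply: ge0_le_integral => //.
  - by apply/measurable_EFinP; apply: measurable_funX; exact: normr_measurable.
  - apply/measurable_EFinP; apply: measurable_funM => //; apply: measurableT_comp => //.
    by apply: measurable_funM => //; exact: measurable_funX.
  move=> x _; rewrite -EFinM lee_fin.
  have E1 : 1 <= expR (th * x ^+ 2).
    by rewrite -expR0 ler_expR mulr_ge0 ?sqr_ge0// ltW.
  have F0 : 0 <= k`!%:R / th ^+ k :> R by rewrite divr_ge0// exprn_ge0// ltW.
  case: (lerP `|x| 1) => [x1|x1].
    apply: (@le_trans _ _ 1); first by rewrite exprn_ile1.
    by rewrite (le_trans E1)// ler_peMl ?expR_ge0// lerDr.
  apply: (@le_trans _ _ (k`!%:R / th ^+ k * expR (th * x ^+ 2))); last first.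
    by rewrite ler_wpM2r ?expR_ge0// lerDl.
  apply: (@le_trans _ _ (k`!%:R / th ^+ k * ((th * x ^+ 2) ^+ k / k`!%:R))); last first.
    rewrite ler_wpM2l//; case: (k) => [|k']; first by rewrite expr0 fact0 divr1.
    apply: le_trans (expR_ge1Dxn k' _); last by rewrite mulr_ge0 ?sqr_ge0// ltW.
    by rewrite lerDr.
  rewrite [(th * x ^+ 2) ^+ k]exprMn.
  have -> : k`!%:R / th ^+ k * (th ^+ k * (x ^+ 2) ^+ k / k`!%:R) = (x ^+ 2) ^+ k.
    have f0 : k`!%:R != 0 :> R by rewrite pnatr_eq0 -lt0n fact_gt0.
    have t0 : th ^+ k != 0 by rewrite expf_neq0// gt_eqF.
    by field; rewrite t0 f0.
  rewrite -normrX -[x ^+ 2]ger0_norm ?sqr_ge0// -!normrX !normrX -exprM.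
  by apply: ler_weXn2l; [exact: ltW|rewrite leq_pmull].
rewrite ge0_integralZl//.
- by rewrite (@normal_exp_square s).
- apply/measurable_EFinP; apply: measurableT_comp => //.
  by apply: measurable_funM => //; exact: measurable_funX.
- by rewrite lee_fin addr_ge0// divr_ge0// exprn_ge0// ltW.
Qed.

Lemma normal_integrable_polynomial (p : {poly R}) :
  N.-integrable [set: R] (fun x => (p.[x])%:E).
Proof.
have mX k : N.-integrable [set: R] (fun x => (x ^+ k)%:E).
  apply/integrableP; split; first by apply/measurable_EFinP; exact: measurable_funX.
  have [C HC] := normal_moment_bounded k.
  by under eq_integral do rewrite /= normrX; rewrite (le_lt_trans HC)// ltry.
rewrite (_ : (fun x : R => (p.[x])%:E) =
  (fun x => \sum_(i < size p) ((p`_i)%:E * (x ^+ i)%:E))%E); last first.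
  by apply/funext => x; rewrite horner_coef -sumEFin.
apply: integrable_sum => // i _.
by apply: integrableZl.
Qed.

Lemma lebesgue_symmetric (g : measurableTypeR R -> \bar R) :
  measurable_fun setT g -> (forall x, 0 <= g x)%E ->
  (\int[mu]_x g (- x)%R = \int[mu]_x g x)%E.
Proof.
move=> mg g0.
have mN : measurable_fun [set: measurableTypeR R] (-%R : _ -> measurableTypeR R).
  exact: oppr_measurable.
have := @ge0_integral_pushforward _ _ _ _ R _ mN mu setT g measurableT mg (fun x _ => g0 x).
rewrite preimage_setT => <-.
by apply: eq_measure_integral => A mA _; exact: lebesgue_measureN.
Qed.

Lemma normal_symmetric (f : R -> \bar R) :
  measurable_fun setT f -> (forall x, 0 <= f x)%E ->
  (\int[N]_x f (- x)%R = \int[N]_x f x)%E.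
Proof.
move=> mf f0.
have mg : measurable_fun [set: measurableTypeR R]
    (fun x => f x * (normal_pdf 0 1 x)%:E)%E.
  by apply: emeasurable_funM => //; apply/measurable_EFinP; exact: measurable_normal_pdf.
rewrite !integral_std_normal//; last first.
  by apply: measurableT_comp => //; exact: oppr_measurable.
rewrite -(lebesgue_symmetric mg); last first.
  by move=> x; rewrite mule_ge0// lee_fin normal_pdf_ge0.
apply: eq_integral => x _ /=; congr (_ * _%:E)%E.
by rewrite !normal_pdfE ?oner_neq0// /normal_fun !subr0 sqrrN.
Qed.

Lemma normal_mean : (\int[N]_x x%:E = 0)%E.
Proof.
have iX : N.-integrable [set: R] (fun x => x%:E).
  have := normal_integrable_polynomial 'X.
  by under eq_fun do rewrite hornerX.
have mX : measurable_fun [set: R] (fun x : R => x%:E) by exact: measurable_int iX.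
have E0 : (\int[N]_x (fun x => x%:E)^\- x = \int[N]_x (fun x => x%:E)^\+ x)%E.
  rewrite -(@normal_symmetric (fun x => x%:E)^\-%E).
  - by apply: eq_integral => x _; rewrite funeposE funenegE EFinN oppeK.
  - exact: measurable_funeneg.
  - exact: funeneg_ge0.
rewrite integralE E0 subee//; apply: integrable_fin_num => //; exact: integrable_funepos.
Qed.

Lemma normal_integral_cst (c : R) : (\int[N]_x c%:E = c%:E)%E.
Proof.
rewrite (integral_cst N measurableT c%:E).
by rewrite [X in (_ * X)%E](_ : _ = 1%E) ?mule1//; exact: probability_setT.
Qed.

(** No integration by parts: e^u >= 1 + u in [normal_exp_square] gives [key] for all s > 0. Both
    sides of [key] are equal at s = 1, so their derivatives there must agree, which says m = 1. *)
Lemma normal_second_moment : (\int[N]_x (x ^+ 2)%:E = 1)%E.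
Proof.
have iX : N.-integrable [set: R] (fun x => (x ^+ 2)%:E).
  have := normal_integrable_polynomial 'X^2.
  by under eq_fun do rewrite hornerXn.
have [m Em] : exists m : R, (\int[N]_x (x ^+ 2)%:E = m%:E)%E.
  by exists (fine (\int[N]_x (x ^+ 2)%:E)%E); rewrite fineK// integrable_fin_num.
have m0 : 0 <= m.
  by rewrite -lee_fin -Em; apply: integral_ge0 => x _; rewrite lee_fin sqr_ge0.
have key (s : R) : 0 < s -> 1 + (1 - s ^- 2) / 2 * m <= s.
  move=> s0; rewrite -lee_fin -(normal_exp_square s0) EFinD EFinM -Em.
  have -> : (1%:E + ((1 - s ^- 2) / 2)%:E * \int[N]_x (x ^+ 2)%:E =
    \int[N]_x (1%:E + ((1 - s ^- 2) / 2)%:E * (x ^+ 2)%:E))%E.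
    rewrite integralD//=; last 2 first.
    - exact: finite_measure_integrable_cst.
    - exact: integrableZl.
    by rewrite normal_integral_cst integralZl.
  have mE : measurable_fun [set: R] (fun x : R => (expR ((1 - s ^- 2) / 2 * x ^+ 2))%:E).
    by apply/measurable_EFinP; apply: measurableT_comp => //;
      apply: measurable_funM => //; exact: measurable_funX.
  apply: le_integral => //=.
  - apply: integrableD => //; first exact: finite_measure_integrable_cst.
    exact: integrableZl.
  - apply/integrableP; split => //.
    under eq_integral do rewrite gee0_abs ?lee_fin ?expR_ge0//.
    by rewrite normal_exp_square// ltry.
  - by move=> x _; rewrite -EFinM -EFinD lee_fin expR_ge1Dx.
rewrite Em; congr (_%:E); apply/eqP; rewrite eq_le; apply/andP; split; rewrite leNgt;
  apply/negP => m1.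
(* Any small t > 0 would contradict [key] at s = 1 + t (below, at s = 1 - t); the explicit choice
   leaves a polynomial inequality. *)
- pose t := (m - 1) / (m + 2).
  have t0 : 0 < t by rewrite divr_gt0//; lra.
  have t1 : t < 1 by rewrite ltr_pdivrMr; lra.
  have tE : t * (m + 2) = m - 1 by rewrite divfK// gt_eqF//; lra.
  have s0 : 0 < 1 + t by lra.
  have := key _ s0.
  have -> : 1 + (1 - (1 + t) ^- 2) / 2 * m = 1 + (2 + t) * t * m / (2 * (1 + t) ^+ 2).
    by field; rewrite gt_eqF.
  rewrite lerD2l ler_pdivrMr; last by rewrite mulr_gt0// exprn_gt0.
  have -> : (2 + t) * t * m = t * ((2 + t) * m) by ring.
  by rewrite ler_pM2l//; nra.
- pose t := (1 - m) / 3.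
  have t0 : 0 < t by rewrite divr_gt0//; lra.
  have t1 : t < 1 by rewrite ltr_pdivrMr; lra.
  have tE : t * 3 = 1 - m by rewrite divfK// gt_eqF//; lra.
  have s0 : 0 < 1 - t by lra.
  have := key _ s0.
  have -> : 1 + (1 - (1 - t) ^- 2) / 2 * m = 1 - (2 - t) * t * m / (2 * (1 - t) ^+ 2).
    by field; rewrite gt_eqF.
  rewrite lerD2l lerN2 ler_pdivlMr; last by rewrite mulr_gt0// exprn_gt0.
  have -> : (2 - t) * t * m = t * ((2 - t) * m) by ring.
  by rewrite ler_pM2l//; nra.
Qed.

(** The cross term vanishes because p has mean zero; c is the variance of p. The cases needed are p
    = X and p = X^2 - 1. *)
Lemma normal_centered_square (p : {poly R}) : (\int[N]_x (p.[x])%:E = 0)%E ->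
  exists2 c : R, 0 <= c & forall S F : R,
    (\int[N]_x ((S + F * p.[x]) ^+ 2)%:E = (S ^+ 2 + F ^+ 2 * c)%:E)%E.
Proof.
move=> p0; have ip := normal_integrable_polynomial p.
have ip2 : N.-integrable [set: R] (fun x => (p.[x] ^+ 2)%:E).
  by have := normal_integrable_polynomial (p ^+ 2); under eq_fun do rewrite horner_exp.
have [c Ec] : exists c : R, (\int[N]_x (p.[x] ^+ 2)%:E = c%:E)%E.
  by exists (fine (\int[N]_x (p.[x] ^+ 2)%:E)%E); rewrite fineK// integrable_fin_num.
exists c.
  by rewrite -lee_fin -Ec; apply: integral_ge0 => x _; rewrite lee_fin sqr_ge0.
move=> S F.
transitivity (\int[N]_x (((S ^+ 2)%:E + (2 * S * F)%:E * (p.[x])%:E) +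
   (F ^+ 2)%:E * (p.[x] ^+ 2)%:E))%E.
  apply: eq_integral => x _; rewrite -!EFinM -!EFinD; congr (_%:E); ring.
rewrite integralD//=; last 2 first.
- by apply: integrableD => //; [exact: finite_measure_integrable_cst|exact: integrableZl].
- exact: integrableZl.
rewrite integralD//=; last 2 first.
- exact: finite_measure_integrable_cst.
- exact: integrableZl.
by rewrite normal_integral_cst !integralZl// p0 Ec mule0 adde0.
Qed.

(** Extended-real valued, with +oo at 0 in place of the default 0^-1 = 0: a finite integral of it
    then certifies that y is almost surely nonzero. *)
Definition inv_sqrt_abs (y : R) : \bar R :=
  if y == 0 then +oo%E else ((Num.sqrt `|y|)^-1)%:E.

Lemma measurable_inv_sqrt_abs : measurable_fun [set: R] inv_sqrt_abs.
Proof.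
rewrite (_ : inv_sqrt_abs =
  (fun y => if y == 0 then +oo%E else (`|y| `^ (- 2^-1))%:E)).
  apply: measurable_fun_ifT => //; first exact: measurable_fun_eqr.
  apply/measurable_EFinP.
  have mp : measurable_fun [set: R] (fun x : R => x `^ (- 2^-1)) by exact: measurable_powR.
  have mn : measurable_fun [set: R] (fun x : R => `|x|) by exact: normr_measurable.
  exact: (measurableT_comp mp mn).
by apply/funext => y; rewrite /inv_sqrt_abs powRN powR12_sqrt.
Qed.

Lemma inv_sqrt_abs_ge0 y : (0 <= inv_sqrt_abs y)%E.
Proof.
by rewrite /inv_sqrt_abs; case: ifP => // _; rewrite lee_fin invr_ge0 sqrtr_ge0.
Qed.

Lemma inv_sqrt_absM a y : a != 0 ->
  inv_sqrt_abs (a * y) = (inv_sqrt_abs a * inv_sqrt_abs y)%E.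
Proof.
move=> a0; rewrite /inv_sqrt_abs mulf_eq0 (negbTE a0) /=; case: eqVneq => [_|y0].
  by rewrite gt0_muley// lte_fin invr_gt0 sqrtr_gt0 normr_gt0.
by rewrite -EFinM normrM sqrtrM// invfM.
Qed.

Definition dyadic_ball k (y : R) : R := \1_[set x : R | `|x| <= 4^-1 ^+ k] y.

(** On the shell 4^-(K+1) < |y| <= 4^-K the left side is below 2^(K+1), the K-th term of the series.
    The summand 1 covers |y| >= 1, and at 0 the series diverges. *)
Lemma inv_sqrt_abs_dyadic y : (inv_sqrt_abs y <=
  1 + \sum_(0 <= k <oo) ((2 ^+ k.+1)%:E * (dyadic_ball k y)%:E))%E.
Proof.
have F0 k z : (0 <= (2 ^+ k.+1)%:E * (dyadic_ball k z)%:E :> \bar R)%E.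
  by rewrite mule_ge0// lee_fin ?exprn_ge0// /dyadic_ball.
rewrite /inv_sqrt_abs; case: eqVneq => [->|y0].
  rewrite [X in (_ <= 1 + X)%E](_ : _ = +oo%E) ?addey//.
  apply: eq_infty => r.
  have [n Hn] : exists n : nat, r <= n%:R by exists (Num.bound `|r|); rewrite (le_trans (ler_norm r))// ltW// archi_boundP.
  apply: (@le_trans _ _ (\sum_(0 <= k < n) ((2 ^+ k.+1)%:E * (dyadic_ball k 0%R)%:E))%E).
    apply: (@le_trans _ _ (\sum_(0 <= k < n) (1%R)%:E)%E).
      by rewrite sumEFin lee_fin sumr_const_nat subn0.
    apply: lee_sum => k _; rewrite /dyadic_ball indicE mem_set/= ?normr0 ?exprn_ge0// mule1 lee_fin.
    by rewrite exprn_ege1// ler1n.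
  by apply: nneseries_lim_ge => k _ _.
case: (lerP 1 `|y|) => y1.
  apply: (@le_trans _ _ 1%E); last by rewrite leeDl// nneseries_ge0.
  by rewrite lee_fin invf_le1 ?sqrtr_gt0 ?normr_gt0// -sqrtr1 ler_sqrt.
have [K HK] : exists K : nat, 4^-1 ^+ K.+1 < `|y| <= 4^-1 ^+ K.
  have ex : exists n, 4^-1 ^+ n < `|y|.
    have : (4^-1 : R) ^+ n @[n --> \oo] --> 0 by apply: cvg_expr; rewrite ger0_norm; lra.
    move/cvgr0Pnorm_lt => /(_ `|y|); rewrite normr_gt0 => /(_ y0) [n _ Hn].
    exists n; have := Hn n (leqnn n); rewrite /= ger0_norm// exprn_ge0//; lra.
  case: (ex_minnP ex) => [[|n]] Hn mn; first by move: Hn; rewrite expr0; lra.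
  exists n; rewrite Hn/= leNgt; apply/negP => /mn; by rewrite ltnn.
apply: (@le_trans _ _ ((2 ^+ K.+1)%:E * (dyadic_ball K y)%:E)%E).
  rewrite /dyadic_ball indicE mem_set/=; last by case/andP: HK.
  rewrite mule1 lee_fin -[leRHS]invrK lef_pV2 ?posrE ?sqrtr_gt0 ?normr_gt0 ?invr_gt0 ?exprn_gt0//.
  rewrite -(@ger0_norm _ ((2 ^+ K.+1)^-1)) ?invr_ge0 ?exprn_ge0// -sqrtr_sqr ler_sqrt ?normr_ge0//.
  case/andP: HK => /ltW + _; apply: le_trans; rewrite -exprVn -exprM mulnC exprM.
  by rewrite (_ : (2^-1 : R) ^+ 2 = 4^-1)//; field.
apply: (@le_trans _ _ (\sum_(0 <= k < K.+1) ((2 ^+ k.+1)%:E * (dyadic_ball k y)%:E))%E).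
  by rewrite big_nat_recr//= leeDr// sume_ge0.
apply: le_trans (leeDr _ _) => //.
exact: nneseries_lim_ge.
Qed.

Lemma normal_small_ball (c r : R) : 0 <= r ->
  (N [set x : R | (`|x + c| <= r)%R] <= (2 * r)%:E)%E.
Proof.
move=> r0; rewrite std_normalE /normal_prob.
have -> : [set x | `|x + c| <= r] = `[- c - r, - c + r]%classic.
  by apply/seteqP; split => x /=; rewrite in_itv/= ler_norml; lra.
apply: (@le_trans _ _ (\int[mu]_(x in `[(- c - r)%R, (- c + r)%R]) (1%R)%:E)%E).
  apply: ge0_le_integral => //.
  - by move=> x _; rewrite lee_fin normal_pdf_ge0.
  - apply/measurable_EFinP; apply: measurable_funTS; exact: measurable_normal_pdf.
  move=> x _; rewrite lee_fin (le_trans (normal_pdf_ub _ _ _))//.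
  rewrite /normal_peak invf_le1; last first.
    by rewrite sqrtr_gt0 expr1n mul1r mulrn_wgt0// pi_gt0.
  have := pi_ge2 R; move: (pi : R) => q q2.
  by rewrite -[leLHS]sqrtr1 ler_sqrt ?expr1n ?mul1r ?mulr2n; lra.
rewrite integral_cst//= mul1e lebesgue_measure_itv/= lte_fin.
by case: ifP => _; rewrite ?lee_fin; lra.
Qed.

(** The ball of radius 4^-k has mass at most 2 * 4^-k whatever its centre, so the k-th dyadic term
    contributes at most 4 * 2^-k; hence 9 = 1 + 8. *)
Lemma normal_inv_sqrt_shift (c : R) : (\int[N]_x inv_sqrt_abs (x + c)%R <= 9%:E)%E.
Proof.
have mind k : measurable [set x : R | `|x + c| <= 4^-1 ^+ k].
  rewrite -[X in measurable X]setTI; apply: (@measurable_fun_ler _ R R setT (fun x => `|x + c|) (fun=> 4^-1 ^+ k)) => //.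
  by apply: measurableT_comp => //; exact: measurable_funD.
have E k x : dyadic_ball k (x + c) = \1_[set x | `|x + c| <= 4^-1 ^+ k] x :> R.
  by rewrite /dyadic_ball !indicE; congr (_%:R); apply/idP/idP; rewrite !inE.
have mt k : measurable_fun [set: R] (fun x : R => ((2 ^+ k.+1)%:E * (dyadic_ball k (x + c)%R)%:E)%E).
  under eq_fun do rewrite E; apply/measurable_EFinP; apply: measurable_funM => //.
have t0 k x : (0 <= (2 ^+ k.+1)%:E * (dyadic_ball k (x + c)%R)%:E :> \bar R)%E.
  by rewrite mule_ge0// lee_fin ?exprn_ge0// /dyadic_ball.
apply: (@le_trans _ _ (\int[N]_x (1 + \sum_(0 <= k <oo) ((2 ^+ k.+1)%:E * (dyadic_ball k (x + c)%R)%:E)))%E).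
  apply: ge0_le_integral => //.
  - by move=> x _; exact: inv_sqrt_abs_ge0.
  - by apply: (measurableT_comp measurable_inv_sqrt_abs); exact: measurable_funD.
  - apply: emeasurable_funD => //; exact: ge0_emeasurable_sum.
  - by move=> x _; exact: inv_sqrt_abs_dyadic.
rewrite ge0_integralD//; last 2 first.
- by move=> x _; exact: nneseries_ge0.
- exact: ge0_emeasurable_sum.
rewrite integral_nneseries// normal_integral_cst.
have step k : (\int[N]_x ((2 ^+ k.+1)%:E * (dyadic_ball k (x + c)%R)%:E) <= (4 * 2^-1 ^+ k)%:E)%E.
  under eq_integral do rewrite E.
  rewrite ge0_integralZl//; last first.
    exact/measurable_EFinP/measurable_indic.
  rewrite integral_indic// setIT.
  apply: (@le_trans _ _ ((2 ^+ k.+1)%:E * (2 * 4^-1 ^+ k)%:E)%E).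
    by rewrite lee_wpmul2l ?lee_fin ?exprn_ge0// normal_small_ball// exprn_ge0.
  rewrite -EFinM lee_fin exprS (_ : 4^-1 = 2^-1 ^+ 2); last by field.
  rewrite -exprM mulnC exprM exprVn (_ : 2 * 2 ^+ k * (2 * (2 ^- k) ^+ 2) = 4 * 2 ^- k)//.
  by field; rewrite expf_neq0.
have sums n : (\sum_(0 <= k < n) (4 * 2^-1 ^+ k)%:E <= 8%:E :> \bar R)%E.
  rewrite sumEFin lee_fin -mulr_sumr.
  have -> : \sum_(0 <= k < n) 2^-1 ^+ k = 2 - 2 * 2^-1 ^+ n :> R.
    elim: n => [|n IH]; first by rewrite big_geq// expr0; lra.
    by rewrite big_nat_recr//= IH exprS; field.
  have : 0 <= 2^-1 ^+ n :> R by rewrite exprn_ge0.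
  lra.
rewrite (_ : 9 = 1 + 8 :> R) ?EFinD; last by lra.
rewrite leeD2l//; apply: lime_le.
  by apply: is_cvg_nneseries => n _ _; apply: integral_ge0.
apply: nearW => n; apply: le_trans (sums n).
exact: lee_sum.
Qed.

Lemma normal_inv_sqrt_affine (a b : R) :
  (\int[N]_x inv_sqrt_abs (a * x + b)%R <= 9%:E * inv_sqrt_abs a)%E.
Proof.
(* For a = 0 the right-hand side is +oo. *)
have [->|a0] := eqVneq a 0.
  by rewrite {2}/inv_sqrt_abs eqxx gt0_muley ?leey// lte_fin.
under eq_integral => x _.
  rewrite (_ : a * x + b = a * (x + a^-1 * b)); last by field.
  rewrite inv_sqrt_absM//; over.
rewrite ge0_integralZl//; last 3 first.
- by apply: (measurableT_comp measurable_inv_sqrt_abs); exact: measurable_funD.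
- by move=> x _; exact: inv_sqrt_abs_ge0.
- exact: inv_sqrt_abs_ge0.
by rewrite muleC lee_wpmul2r ?inv_sqrt_abs_ge0// normal_inv_sqrt_shift.
Qed.

End NormalMoments.

(** * Independence *)

Section IndependentPair.
Local Open Scope ereal_scope.
Context {d d1 d2 : measure_display} {T : measurableType d}
  {T1 : measurableType d1} {T2 : measurableType d2} {R : realType}.
Variables (P : probability T R) (mu : probability T1 R).
Variables (X : {mfun T >-> T1}) (Y : {mfun T >-> T2}).
Hypothesis XY : forall U B, measurable U -> measurable B ->
  P (X @^-1` U `&` Y @^-1` B) = mu U * P (Y @^-1` B).

Lemma independent_fubini (f : T1 * T2 -> \bar R) :
  measurable_fun setT f -> (forall z, 0 <= f z) ->
  \int[P]_o f (X o, Y o) = \int[P]_o \int[mu]_x f (x, Y o).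
Proof.
move=> mf f0.
have mZ : measurable_fun [set: T] (fun o => (X o, Y o)).
  by apply: measurable_fun_pair.
pose Zm := isMeasurableFun.Build _ _ _ _ _ mZ.
pose Z : {mfun T >-> (T1 * T2)%type} := HB.pack (fun o => (X o, Y o)) Zm.
have -> : \int[P]_o f (X o, Y o) = \int[distribution P Z]_z f z.
  by rewrite (ge0_integral_distribution Z).
have E : forall A, measurable A -> A `<=` setT ->
    distribution P Z A = (mu \x distribution P Y) A.
  move=> A mA _; apply/esym/product_measure_unique => //.
transitivity (\int[mu \x distribution P Y]_z f z).
  exact: eq_measure_integral.
rewrite fubini_tonelli2 //.
rewrite (ge0_integral_distribution Y) //.
  exact: measurable_fun_fubini_tonelli_G.
by move=> y; apply: integral_ge0.
Qed.

End IndependentPair.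

Section Noise.
Local Open Scope ereal_scope.
Context {d : measure_display} {T : measurableType d} {R : realType}.
Variable P : probability T R.
Context {I : eqType}.
Variable X : I -> {RV P >-> R}.

Definition cylinder (Q : pred I) : set_system T :=
  [set A | exists s (U : I -> set R), [/\ uniq s, all Q s,
    forall i, measurable (U i) &
    A = \bigcap_(i in [set` s]) (X i @^-1` U i)]].

Definition noise_algebra (Q : pred I) := g_sigma_algebraType (cylinder Q).

Lemma cylinderT Q : cylinder Q setT.
Proof.
exists [::], (fun=> setT); split => //.
by apply/esym; rewrite -subTset => x _ i /=.
Qed.

Lemma cylinderI Q : setI_closed (cylinder Q).
Proof.
move=> _ _ [s [U [us sQ mU ->]]] [s' [U' [us' sQ' mU' ->]]].
exists (undup (s ++ s')), (fun i => (if i \in s then U i else setT) `&`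
  (if i \in s' then U' i else setT)); split.
- exact: undup_uniq.
- by rewrite all_undup all_cat sQ.
- by move=> i; apply: measurableI; case: ifP.
- apply/seteqP; split=> [x [xs xs'] i /=|x xss'].
    rewrite mem_undup mem_cat => _; split; case: ifP => // j; [exact: xs|exact: xs'].
  split => i /= is_; move: (xss' i); rewrite /= mem_undup mem_cat is_ ?orbT => /(_ isT) [].
    by [].
  by [].
Qed.

Lemma cylinder_measurable Q : cylinder Q `<=` measurable.
Proof.
move=> _ [s [U [_ _ mU ->]]]; apply: fin_bigcap_measurable => // i _.
by rewrite -[X in measurable X]setTI; exact: measurable_funPT.
Qed.

Lemma sub_noise_algebra Q (A : set T) :
  (<<s cylinder Q >>) A -> measurable A.
Proof.
exact: (smallest_sub (@sigma_algebra_measurable _ T) (@cylinder_measurable Q)).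
Qed.

(** Says that f is a function of the noises X i with Q i. Measurability for the generated
    sigma-algebra avoids factoring f through a product space. *)
Definition dep {d'} {T' : measurableType d'} (Q : pred I) (f : T -> T') :=
  measurable_fun [set: noise_algebra Q] f.

Lemma dep_measurable {d'} {T' : measurableType d'} Q (f : T -> T') :
  dep Q f -> measurable_fun setT f.
Proof. by move=> mf _ A mA; apply: (@sub_noise_algebra Q); exact: mf. Qed.

Lemma sub_dep {d'} {T' : measurableType d'} (Q Q' : pred I) (f : T -> T') :
  {subset Q <= Q'} -> dep Q f -> dep Q' f.
Proof.
move=> QQ' mf _ A mA; apply: (@sub_smallest2r _ _ (cylinder Q)).
- exact: smallest_sigma_algebra.
- move=> _ [s [U [us sQ mU ->]]]; exists s, U; split => //.
  by apply/allP => i /(allP sQ) /QQ'.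
- exact: mf.
Qed.

Lemma dep_noise (Q : pred I) i : Q i -> dep Q (X i).
Proof.
move=> Qi _ A mA; rewrite setTI; apply: sub_sigma_algebra.
exists [:: i], (fun=> A); split => //=; first by rewrite Qi.
apply/seteqP; split => [x xA j /=|x /(_ i)]; last by apply; rewrite /= mem_head.
by rewrite inE => /eqP ->.
Qed.

Hypothesis Xn : iid_std_normal X.
Let N : probability R R := std_normal.

(** Both sides are finite measures in B. They agree on the cylinders over Q, a pi-system, by adding
    k to the list of indices; uniqueness of measures does the rest. *)
Lemma noise_independent (Q : pred I) k (U : set R) (B : set T) :
  ~~ Q k -> measurable U -> (<<s cylinder Q >>) B ->
  P (X k @^-1` U `&` B) = N U * P B.
Proof.
move=> Qk mU; have [Xlaw Xind] := Xn.
have mXU : measurable (X k @^-1` U).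
  by rewrite -[X in measurable X]setTI; exact: measurable_funPT.
have PXU : P (X k @^-1` U) = N U by rewrite std_normalE; exact: Xlaw.
have NU : N U \is a fin_num by exact: fin_num_measure.
have NU0 : (0 <= fine (N U))%R by exact: fine_ge0.
pose m1 : {measure set T -> \bar R} := mrestr P mXU.
pose m2 : {measure set T -> \bar R} := mscale (NngNum NU0) P.
have m1E A : m1 A = P (X k @^-1` U `&` A) by rewrite setIC.
have m2E A : m2 A = N U * P A by rewrite -[N U in RHS]fineK.
move=> BQ; rewrite -m1E -m2E.
apply: (@g_sigma_algebra_measure_unique _ R T (cylinder Q)
  (@cylinder_measurable Q) (fun=> setT)) BQ => //.
- by move=> _; exact: cylinderT.
- by rewrite bigcup_const //; exists 0%N.
- exact: cylinderI.
- move=> _ [s [V [us sQ mV ->]]].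
  have ks : k \notin s by apply/negP => /(allP sQ); rewrite (negbTE Qk).
  pose V' i := if i == k then U else V i.
  have VV' i : i \in s -> V' i = V i.
    by rewrite /V'; case: eqP => // -> ; rewrite (negbTE ks).
  rewrite m1E m2E; transitivity (P (\bigcap_(i in [set` k :: s]) (X i @^-1` V' i))).
    congr (P _); apply/seteqP; split => [x [xk xs] i /=|x xks].
      rewrite /= inE => /predU1P[->|iks]; first by rewrite /V' eqxx.
      by rewrite VV'//; exact: xs.
    split; first by have := xks k; rewrite /= mem_head /V' eqxx; exact.
    by move=> i /= iks; have := xks i; rewrite /= inE iks orbT VV'//; exact.
  have mV' i : measurable (V' i) by rewrite /V'; case: ifP.
  rewrite Xind ?cons_uniq ?ks //= big_cons {1}/V' eqxx PXU; congr (_ * _).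
  rewrite (Xind _ V) // big_seq [RHS]big_seq; apply: eq_bigr => i iks.
  by rewrite VV'.
- by move=> _; rewrite m1E setIT PXU ltey_eq NU.
Qed.

(** The freezing lemma: one noise is integrated out while everything depending on the noises in Q
    stays fixed. The second component is the identity from T to T with the smaller sigma-algebra. It
    takes the place of conditional expectations throughout. *)
Lemma noise_fubini (Q : pred I) k (f : R * noise_algebra Q -> \bar R) :
  ~~ Q k -> measurable_fun setT f -> (forall z, 0 <= f z) ->
  \int[P]_o f (X k o, o) = \int[P]_o \int[N]_x f (x, o).
Proof.
move=> Qk mf f0.
have mid : measurable_fun [set: T] (id : T -> noise_algebra Q).
  by move=> _ A mA; rewrite setTI preimage_id; exact: sub_noise_algebra mA.
pose Ym := isMeasurableFun.Build _ _ _ _ _ mid.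
pose Y : {mfun T >-> noise_algebra Q} := HB.pack (id : T -> noise_algebra Q) Ym.
have XY U B : measurable U -> measurable B ->
    P (X k @^-1` U `&` Y @^-1` B) = N U * P (Y @^-1` B).
  by move=> mU mB; exact: (@noise_independent Q).
exact: (independent_fubini XY mf f0).
Qed.

End Noise.

(** * Null sequences *)

Section Moments.
Context {d : measure_display} {T : measurableType d} {R : realType}.
Variable P : probability T R.
Local Notation mfun f := (measurable_fun [set: T] f).

Definition moment (f : T -> R) k : \bar R := (\int[P]_o (`|f o| ^+ k)%:E)%E.

Lemma moment_ge0 f k : (0 <= moment f k)%E.
Proof. by apply: integral_ge0 => o _; rewrite lee_fin exprn_ge0. Qed.

Lemma measurable_normX (f : T -> R) k : mfun f -> mfun (fun o => (`|f o| ^+ k)%:E).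
Proof.
move=> mf; apply/measurable_EFinP; apply: measurable_funX.
exact: measurableT_comp.
Qed.

(** The exponents k, l, m are unrelated, which lets a pointwise AM-GM bound trade a moment of a
    product for higher moments of its factors. *)
Lemma moment_le2 (f g h : T -> R) (k l m : nat) (a b A B : R) :
  mfun f -> mfun g -> mfun h -> 0 <= a -> 0 <= b ->
  {ae P, forall o, `|f o| ^+ k <= a * `|g o| ^+ l + b * `|h o| ^+ m} ->
  (moment g l <= A%:E)%E -> (moment h m <= B%:E)%E ->
  (moment f k <= (a * A + b * B)%:E)%E.
Proof.
move=> mf mg mh a0 b0 fgh gA hB.
have mgl := measurable_normX l mg; have mhm := measurable_normX m mh.
have mag : mfun (fun o => (a%:E * (`|g o| ^+ l)%:E)%E) by exact: emeasurable_funM.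
have mbh : mfun (fun o => (b%:E * (`|h o| ^+ m)%:E)%E) by exact: emeasurable_funM.
apply: (@le_trans _ _ (\int[P]_o (a%:E * (`|g o| ^+ l)%:E + b%:E * (`|h o| ^+ m)%:E))%E).
  apply: ae_ge0_le_integral => //.
  - exact: measurable_normX.
  - by move=> o _; rewrite adde_ge0// mule_ge0// lee_fin ?exprn_ge0.
  - exact: emeasurable_funD.
  by apply: filterS fgh => o H _; rewrite -!EFinM -EFinD lee_fin.
rewrite ge0_integralD//; last 2 first.
- by move=> o _; rewrite mule_ge0// lee_fin ?exprn_ge0.
- by move=> o _; rewrite mule_ge0// lee_fin ?exprn_ge0.
rewrite !ge0_integralZl//.
by rewrite EFinD !EFinM leeD// lee_wpmul2l// lee_fin.
Qed.

Definition bddmom {I : Type} (f : I -> T -> R) : Prop :=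
  (forall i, mfun (f i)) /\
  forall k, exists C : R, forall i, (moment (f i) k <= C%:E)%E.

Lemma bddmomP {I : Type} (f : I -> T -> R) k : bddmom f ->
  exists2 C : R, 0 <= C & forall i, (moment (f i) k <= C%:E)%E.
Proof.
move=> [_ /(_ k) [C HC]]; exists (Num.max 0 C); first by rewrite le_max lexx.
by move=> i; apply: le_trans (HC i) _; rewrite lee_fin le_max lexx orbT.
Qed.

Lemma bddmom_ae_le2 {I : Type} (f g h : I -> T -> R) :
  (forall i, mfun (f i)) -> bddmom g -> bddmom h ->
  (forall k, exists (a b : R) (l m : nat), [/\ 0 <= a, 0 <= b & forall i,
    {ae P, forall o, `|f i o| ^+ k <= a * `|g i o| ^+ l + b * `|h i o| ^+ m}]) ->
  bddmom f.
Proof.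
move=> mf bg bh H; split => // k; have [a [b [l [m [a0 b0 Hi]]]]] := H k.
have [A A0 HA] := bddmomP l bg; have [B B0 HB] := bddmomP m bh.
exists (a * A + b * B) => i.
by apply: (moment_le2 (mf i) (bg.1 i) (bh.1 i) a0 b0).
Qed.

Lemma bddmom_le2 {I : Type} (f g h : I -> T -> R) :
  (forall i, mfun (f i)) -> bddmom g -> bddmom h ->
  (forall k, exists (a b : R) (l m : nat), [/\ 0 <= a, 0 <= b & forall i o,
    `|f i o| ^+ k <= a * `|g i o| ^+ l + b * `|h i o| ^+ m]) ->
  bddmom f.
Proof.
move=> mf bg bh H; apply: (bddmom_ae_le2 mf bg bh) => k.
have [a [b [l [m [a0 b0 Hi]]]]] := H k.
by exists a, b, l, m; split => // i; apply/aeW => o.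
Qed.

Lemma bddmom_ae_le {I : Type} (f g : I -> T -> R) : (forall i, mfun (f i)) ->
  bddmom g -> (forall i, {ae P, forall o, `|f i o| <= `|g i o|}) -> bddmom f.
Proof.
move=> mf bg fg; apply: (bddmom_ae_le2 mf bg bg) => k.
exists 1, 0, k, 0%N; split => // i; apply: filterS (fg i) => o Ho.
by rewrite mul1r mul0r addr0 lerXn2r// nnegrE.
Qed.

Lemma integral_constant (c : R) : (\int[P]_o c%:E = c%:E)%E.
Proof.
rewrite (integral_cst P measurableT c%:E).
by rewrite [X in (_ * X)%E](_ : _ = 1%E) ?mule1//; exact: probability_setT.
Qed.

Lemma bddmom_cst {I : Type} (c : I -> R) (C : R) : (forall i, `|c i| <= C) ->
  bddmom (fun i _ => c i).
Proof.
move=> cC; split => // k; exists (C ^+ k) => i.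
rewrite /moment integral_constant.
rewrite lee_fin lerXn2r// nnegrE//; exact: le_trans (cC i).
Qed.

Lemma bddmom_const {I : Type} (c : R) : bddmom (fun (_ : I) _ => c).
Proof. by apply: (@bddmom_cst _ _ `|c|). Qed.

Lemma bddmom_comp {I J : Type} (f : I -> T -> R) (s : J -> I) :
  bddmom f -> bddmom (fun j => f (s j)).
Proof.
move=> [mf bf]; split=> [j|k]; first exact: mf.
by have [C HC] := bf k; exists C => j.
Qed.

Lemma bddmomD {I : Type} (f g : I -> T -> R) :
  bddmom f -> bddmom g -> bddmom (fun i o => f i o + g i o).
Proof.
move=> bf bg; apply: (bddmom_le2 _ bf bg) => [i|k].
  by apply: measurable_funD; [exact: bf.1|exact: bg.1].
exists (2 ^+ k), (2 ^+ k), k, k; split; rewrite ?exprn_ge0// => i o.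
rewrite -mulrDr.
apply: (@le_trans _ _ ((2 * Num.max `|f i o| `|g i o|) ^+ k)).
  rewrite lerXn2r ?nnegrE// ?mulr_ge0// ?le_max ?normr_ge0//.
  apply: le_trans (ler_normD _ _) _; rewrite mulr2n mulrDl mul1r lerD// le_max lexx ?orbT//.
rewrite exprMn ler_wpM2l ?exprn_ge0//.
by rewrite /Num.max; case: ifP => _; rewrite ?lerDl ?lerDr exprn_ge0.
Qed.

Lemma bddmomM {I : Type} (f g : I -> T -> R) :
  bddmom f -> bddmom g -> bddmom (fun i o => f i o * g i o).
Proof.
move=> bf bg; apply: (bddmom_le2 _ bf bg) => [i|k].
  by apply: measurable_funM; [exact: bf.1|exact: bg.1].
exists 1, 1, (k * 2)%N, (k * 2)%N; split => // i o; rewrite !mul1r normrM exprMn !exprM.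
have := exprn_ge0 k (normr_ge0 (f i o)); have := exprn_ge0 k (normr_ge0 (g i o)).
by nra.
Qed.

Lemma bddmomN {I : Type} (f : I -> T -> R) :
  bddmom f -> bddmom (fun i o => - f i o).
Proof.
move=> bf; rewrite (_ : (fun i o => - f i o) = (fun i o => (-1) * f i o)).
  by apply: bddmomM => //; exact: bddmom_const.
by apply/funext => i; apply/funext => o; rewrite mulN1r.
Qed.

Lemma bddmom_sum {I : Type} {J : Type} (r : seq J) (Q : pred J) (f : J -> I -> T -> R) :
  (forall j, bddmom (f j)) -> bddmom (fun i o => \sum_(j <- r | Q j) f j i o).
Proof.
move=> bf; elim: r => [|j r IH].
  by under eq_fun do under eq_fun do rewrite big_nil; exact: bddmom_const.
under eq_fun do under eq_fun do rewrite big_cons.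
by case: (Q j) => //; apply: bddmomD.
Qed.

Lemma bddmom_prod {I : Type} {J : Type} (r : seq J) (Q : pred J) (f : J -> I -> T -> R) :
  (forall j, bddmom (f j)) -> bddmom (fun i o => \prod_(j <- r | Q j) f j i o).
Proof.
move=> bf; elim: r => [|j r IH].
  by under eq_fun do under eq_fun do rewrite big_nil; exact: bddmom_const.
under eq_fun do under eq_fun do rewrite big_cons.
by case: (Q j) => //; apply: bddmomM.
Qed.

Lemma bddmomX {I : Type} (f : I -> T -> R) n :
  bddmom f -> bddmom (fun i o => f i o ^+ n).
Proof.
move=> bf; elim: n => [|n IH].
  by under eq_fun do under eq_fun do rewrite expr0; exact: bddmom_const.
under eq_fun do under eq_fun do rewrite exprS.
exact: bddmomM.
Qed.

Lemma bddmom_integrable {I : Type} (f : I -> T -> R) i : bddmom f ->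
  P.-integrable [set: T] (EFin \o f i).
Proof.
move=> bf; have [C C0 HC] := bddmomP 1%N bf.
apply/integrableP; split; first by apply/measurable_EFinP; exact: bf.1.
apply: le_lt_trans (HC i) _ => /=; last exact: ltry.
Qed.

Lemma scaled_amgm (dl x y : R) : 0 < dl -> 0 <= x -> 0 <= y ->
  x * y <= dl^-1 * x ^+ 2 + dl * y ^+ 2.
Proof.
move=> dl0 x0 y0.
have -> : dl^-1 * x ^+ 2 + dl * y ^+ 2 = (x ^+ 2 + (dl * y) ^+ 2) / dl.
  by field; rewrite gt_eqF.
rewrite ler_pdivlMr//; have -> : x * y * dl = x * (dl * y) by ring.
have : 0 <= dl * y by rewrite mulr_ge0// ltW.
by move: (dl * y) => z; nra.
Qed.

(** Closing arithmetic for the parameter [dl] = e / 2 / (B + 1) in the AM-GM arguments: the small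
    factor contributes e/2, the merely bounded one at most e/2. *)
Lemma half_plus_small (e B : R) : 0 < e -> 0 <= B ->
  (e / 2 / (B + 1))^-1 * (e / 2 / (B + 1) * (e / 2)) + e / 2 / (B + 1) * B <= e.
Proof.
move=> e0 B0; rewrite mulKf; last by rewrite gt_eqF// !divr_gt0// ltr_pwDr.
have : B / (B + 1) <= 1 by rewrite ler_pdivrMr; lra.
have -> : e / 2 / (B + 1) * B = e / 2 * (B / (B + 1)) by ring.
by move: (B / (B + 1)) => z; nra.
Qed.

(* No moment of [f n] is required to be finite for all [n]: the moment of order
   [k] of a least-squares estimator is only known to be finite for [n >= N_k]. *)
Definition null (f : nat -> T -> R) : Prop :=
  (forall n, mfun (f n)) /\ forall k (e : R), 0 < e ->
    exists N, forall n, (N <= n)%N -> (moment (f n) k.+1 <= e%:E)%E.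

(* AM-GM with a small parameter replaces the usual appeals to Hoelder. *)
Lemma nullM (f g : nat -> T -> R) :
  null f -> bddmom g -> null (fun n o => f n o * g n o).
Proof.
move=> [mf nf] bg; split.
  by move=> n; apply: measurable_funM => //; exact: bg.1.
move=> k e e0; have [B B0 HB] := bddmomP (k.+1 * 2) bg.
pose dl := e / 2 / (B + 1).
have dl0 : 0 < dl by rewrite !divr_gt0// ltr_pwDr.
have de0 : 0 < dl * (e / 2) by rewrite mulr_gt0// divr_gt0.
have [N HN] := nf (k.+1 * 2).-1 (dl * (e / 2)) de0.
exists N => n /HN; rewrite prednK ?muln_gt0// => Hn.
apply: (@le_trans _ _ (dl^-1 * (dl * (e / 2)) + dl * B)%:E).
  apply: (moment_le2 _ (mf n) (bg.1 n) _ _ _ Hn (HB n)).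
  - by apply: measurable_funM; [exact: mf|exact: bg.1].
  - by rewrite invr_ge0 ltW.
  - exact: ltW.
  apply/aeW => o; rewrite normrM exprMn !exprM.
  by apply: scaled_amgm; rewrite ?exprn_ge0.
by rewrite lee_fin half_plus_small.
Qed.

Lemma nullMM (f g : nat -> T -> R) :
  null f -> null g -> null (fun n o => f n o * g n o).
Proof.
move=> [mf nf] [mg ng]; split; first by move=> n; exact: measurable_funM.
move=> k e e0; have e2 : 0 < e / 2 by rewrite divr_gt0.
have [N HN] := nf (k.+1 * 2).-1 _ e2; have [M HM] := ng (k.+1 * 2).-1 _ e2.
exists (maxn N M) => n; rewrite geq_max => /andP[/HN Hf /HM Hg].
rewrite [e]splitr -[e / 2 + _](_ : 1 * (e / 2) + 1 * (e / 2) = _); last by rewrite !mul1r.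
apply: (moment_le2 _ (mf n) (mg n) _ _ _ Hf Hg) => //; first exact: measurable_funM.
apply/aeW => o; rewrite prednK ?muln_gt0// normrM exprMn !exprM.
rewrite -{1}[1 in X in _ <= X]invr1; apply: scaled_amgm; rewrite ?exprn_ge0//.
Qed.

Lemma nullD (f g : nat -> T -> R) :
  null f -> null g -> null (fun n o => f n o + g n o).
Proof.
move=> [mf nf] [mg ng]; split; first by move=> n; exact: measurable_funD.
move=> k e e0; have c0 : 0 < 2 ^+ k.+1 :> R by rewrite exprn_gt0.
pose e' := e / 2 / 2 ^+ k.+1.
have e'0 : 0 < e' by rewrite !divr_gt0.
have [N HN] := nf k e' e'0; have [M HM] := ng k e' e'0.
exists (maxn N M) => n; rewrite geq_max => /andP[/HN Hf /HM Hg].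
apply: (@le_trans _ _ (2 ^+ k.+1 * e' + 2 ^+ k.+1 * e')%:E); last first.
  by rewrite lee_fin /e' mulrC divfK ?gt_eqF// -splitr.
apply: (moment_le2 _ (mf n) (mg n) _ _ _ Hf Hg); rewrite ?ltW//.
  exact: measurable_funD.
apply/aeW => o; rewrite -mulrDr.
apply: (@le_trans _ _ ((2 * Num.max `|f n o| `|g n o|) ^+ k.+1)).
  rewrite lerXn2r ?nnegrE// ?mulr_ge0// ?le_max ?normr_ge0//.
  apply: le_trans (ler_normD _ _) _; rewrite mulr2n mulrDl mul1r lerD// le_max lexx ?orbT//.
rewrite exprMn ler_wpM2l ?exprn_ge0//.
by rewrite /Num.max; case: ifP => _; rewrite ?lerDl ?lerDr exprn_ge0.
Qed.

Lemma null_cst (u : nat -> R) : u n @[n --> \oo] --> 0 -> null (fun n _ => u n).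
Proof.
move=> u0; split; first by move=> n; exact: measurable_cst.
move=> k e e0; have m0 : 0 < Num.min e 1 by rewrite lt_min e0 ltr01.
move/cvgr0Pnorm_le : u0 => /(_ _ m0) [N _ HN]; exists N => n /HN /=.
rewrite le_min => /andP[ue u1].
rewrite /moment integral_constant lee_fin exprS (le_trans _ ue)//.
by rewrite ler_piMr// exprn_ile1.
Qed.

Lemma null0 : null (fun _ _ => 0).
Proof. by apply: null_cst; exact: cvg_cst. Qed.

Lemma nullZ (f : nat -> T -> R) c : null f -> null (fun n o => c * f n o).
Proof.
move=> nf; rewrite (_ : (fun n o => _) = (fun n o => f n o * c)).
  by apply: nullM => //; exact: bddmom_const.
by apply/funext => n; apply/funext => o; rewrite mulrC.
Qed.

Lemma null_sum {J : Type} (r : seq J) (Q : pred J) (f : J -> nat -> T -> R) :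
  (forall j, null (f j)) -> null (fun i o => \sum_(j <- r | Q j) f j i o).
Proof.
move=> bf; elim: r => [|j r IH].
  by under eq_fun do under eq_fun do rewrite big_nil; exact: null0.
under eq_fun do under eq_fun do rewrite big_cons.
by case: (Q j) => //; apply: nullD.
Qed.

(** Interpolation: |f|^(k+1) = |f| |f|^k is at most dl^-1 |f|^2 + dl |f|^(2k), and the last moment
    is bounded uniformly. *)
Lemma null_of_second_moment (f : nat -> T -> R) : bddmom f ->
  (forall e : R, 0 < e -> exists N, forall n, (N <= n)%N -> (moment (f n) 2 <= e%:E)%E) ->
  null f.
Proof.
move=> bf f2; split => [|k e e0]; first exact: bf.1.
 have [B B0 HB] := bddmomP (k * 2) bf.
pose dl := e / 2 / (B + 1).
have dl0 : 0 < dl by rewrite !divr_gt0// ltr_pwDr.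
have de0 : 0 < dl * (e / 2) by rewrite mulr_gt0// divr_gt0.
have [N HN] := f2 (dl * (e / 2)) de0.
exists N => n /HN Hn.
apply: (@le_trans _ _ (dl^-1 * (dl * (e / 2)) + dl * B)%:E).
  apply: (moment_le2 (bf.1 n) (bf.1 n) (bf.1 n) _ _ _ Hn (HB n)).
  - by rewrite invr_ge0 ltW.
  - exact: ltW.
  apply/aeW => o; rewrite exprS exprM.
  by apply: scaled_amgm; rewrite ?exprn_ge0.
by rewrite lee_fin half_plus_small.
Qed.

Lemma null_expectation (f : nat -> T -> R) : null f ->
  (\int[P]_o (f n o)%:E)%E @[n --> \oo] --> 0%E.
Proof.
move=> [mf nf]; apply/cvg_abse0P.
have H n : (`|\int[P]_o (f n o)%:E| <= moment (f n) 1)%E.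
  by apply: le_trans (le_abse_integral P measurableT _) _ => //;
     exact/measurable_EFinP.
apply: (@squeeze_cvge _ _ _ _ (fun=> 0%E) _ (fun n => moment (f n) 1)).
- by apply: nearW => n; rewrite abse_ge0 H.
- exact: cvg_cst.
apply/fine_cvgP; split.
  have [N HN] := nf 0%N 1 ltr01; exists N => // n /= /HN H1.
  by rewrite ge0_fin_numE ?moment_ge0// (le_lt_trans H1)// ltry.
apply/cvgrPdist_le => e e0; have [N HN] := nf 0%N e e0.
exists N => // n /= /HN H1; rewrite sub0r normrN ger0_norm ?fine_ge0 ?moment_ge0//.
by rewrite -lee_fin fineK// ge0_fin_numE ?moment_ge0// (le_lt_trans H1)// ltry.
Qed.

Lemma null_eventually (f g : nat -> T -> R) N0 : (forall n, mfun (f n)) ->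
  (forall n, (N0 <= n)%N -> f n = g n) -> null g -> null f.
Proof.
move=> mf fg [mg ng]; split => // k e e0; have [N HN] := ng k e e0.
by exists (maxn N0 N) => n; rewrite geq_max => /andP[/fg -> /HN].
Qed.

(** Convexity of the power as a tangent-line inequality at c. Summed with weights whose barycentre
    is c, the linear terms cancel, which is Jensen's inequality. *)
Lemma expr_tangent (a c : R) k : 0 <= a -> 0 <= c ->
  c ^+ k.+1 + k.+1%:R * c ^+ k * (a - c) <= a ^+ k.+1.
Proof.
move=> a0 c0; elim: k => [|k IH]; first by rewrite !expr1 expr0 !mul1r; lra.
have := ler_wpM2l a0 IH; rewrite -exprS; apply: le_trans.
have ck : 0 <= c ^+ k by rewrite exprn_ge0.
rewrite !exprS -subr_ge0 -[k.+2%:R]natr1.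
have -> : a * (c * c ^+ k + k.+1%:R * c ^+ k * (a - c)) -
  (c * (c * c ^+ k) + (k.+1%:R + 1) * (c * c ^+ k) * (a - c)) =
  k.+1%:R * c ^+ k * (a - c) ^+ 2 by ring.
by rewrite mulr_ge0 ?sqr_ge0// mulr_ge0.
Qed.

Lemma mean_expr_le (n : nat) (a : nat -> R) k : (forall i, 0 <= a i) ->
  (n%:R^-1 * \sum_(i < n) a i) ^+ k.+1 <= n%:R^-1 * \sum_(i < n) a i ^+ k.+1.
Proof.
move=> a0; case: n => [|n]; first by rewrite !big_ord0 !mulr0 expr0n.
set c := _ * _; have c0 : 0 <= c by rewrite mulr_ge0 ?invr_ge0// sumr_ge0.
have n0 : n.+1%:R != 0 :> R by rewrite pnatr_eq0.
have Ec : \sum_(i < n.+1) a i = n.+1%:R * c by rewrite mulrA mulfV// mul1r.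
rewrite ler_pdivlMl ?ltr0Sn//.
apply: (@le_trans _ _ (\sum_(i < n.+1) (c ^+ k.+1 + k.+1%:R * c ^+ k * (a i - c)))); last first.
  by apply: ler_sum => i _; exact: expr_tangent.
have -> (X Y : R) : \sum_(i < n.+1) (X + Y * (a i - c)) =
    n.+1%:R * X + Y * (\sum_(i < n.+1) a i - n.+1%:R * c).
  rewrite big_split/= -mulr_sumr big_split/= !sumr_const card_ord.
  by rewrite -[X *+ _]mulr_natl -[(- c) *+ _]mulr_natl mulrN.
by rewrite Ec subrr mulr0 addr0.
Qed.

Definition avg (f : nat -> T -> R) (n : nat) (o : T) : R :=
  n%:R^-1 * \sum_(i < n) f i o.

Lemma measurable_avg (f : nat -> T -> R) n : (forall i, mfun (f i)) -> mfun (avg f n).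
Proof. by move=> mf; apply: measurable_funM => //; exact: measurable_sum. Qed.

(** Stated at a single order, because the ratios averaged later have a controlled moment only at the
    order for which their window was chosen. *)
Lemma moment_avg_le (f : nat -> T -> R) k (C : R) n : 0 <= C ->
  (forall i, mfun (f i)) -> (forall i, (moment (f i) k.+1 <= C%:E)%E) ->
  (moment (avg f n) k.+1 <= C%:E)%E.
Proof.
move=> C0 mf HC.
apply: (@le_trans _ _ (\int[P]_o ((n%:R^-1)%:E * \sum_(i < n) (`|f i o| ^+ k.+1)%:E))%E).
  apply: ge0_le_integral => //.
  - by apply: measurable_normX; exact: measurable_avg.
  - apply: emeasurable_funM => //; apply: emeasurable_sum => i; exact: measurable_normX.
  move=> o _; rewrite sumEFin -EFinM lee_fin.
  apply: le_trans (mean_expr_le n k (fun i => normr_ge0 (f i o))).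
  rewrite lerXn2r ?nnegrE// ?mulr_ge0 ?invr_ge0 ?sumr_ge0//.
  by rewrite normrM ger0_norm ?invr_ge0// ler_wpM2l ?invr_ge0// ler_norm_sum.
rewrite ge0_integralZl//; last 2 first.
- by apply: emeasurable_sum => i; exact: measurable_normX.
- by move=> o _; apply: sume_ge0.
rewrite ge0_integral_sum//; last by move=> i; exact: measurable_normX.
apply: (@le_trans _ _ ((n%:R^-1)%:E * \sum_(i < n) C%:E)%E).
  by rewrite lee_wpmul2l ?lee_fin ?invr_ge0//; apply: lee_sum => i _; exact: HC.
rewrite sumEFin -EFinM lee_fin sumr_const card_ord -(mulr_natl C).
case: n => [|n]; first by rewrite mul0r mulr0.
by rewrite mulrA mulVf ?mul1r// pnatr_eq0.
Qed.

Lemma bddmom_avg (f : nat -> T -> R) : bddmom f -> bddmom (avg f).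
Proof.
move=> bf; split=> [n|k]; first by apply: measurable_avg; exact: bf.1.
case: k => [|k].
  exists 1 => n; rewrite /moment; under eq_integral do rewrite expr0.
  by rewrite integral_constant.
have [C C0 HC] := bddmomP k.+1 bf.
by exists C => n; apply: moment_avg_le => //; exact: bf.1.
Qed.

(** An L^2 law of large numbers: the hypothesis, satisfied by orthogonal increments, bounds the
    second moment of the n-th sum by n C, hence that of the average by C / n. *)
Lemma null_avg_orthogonal (h : nat -> T -> R) (C : R) : 0 <= C -> bddmom h ->
  (forall n, (moment (fun o => \sum_(i < n.+1) h i o)%R 2 <=
     moment (fun o => \sum_(i < n) h i o)%R 2 + C%:E)%E) ->
  null (avg h).
Proof.
move=> C0 bh Hh; apply: null_of_second_moment; first exact: bddmom_avg.
have S2 n : (moment (fun o => \sum_(i < n) h i o)%R 2 <= (n%:R * C)%:E)%E.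
  elim: n => [|n IH].
    rewrite /moment; under eq_integral do rewrite big_ord0 normr0 expr0n.
    by rewrite integral_constant mul0r.
  apply: le_trans (Hh n) _; rewrite -natr1 mulrDl mul1r EFinD leeD2r//.
have avg2 n : (moment (avg h n) 2 <= (C / n%:R)%:E)%E.
  rewrite /moment/avg; under eq_integral do rewrite normrM exprMn EFinM.
  rewrite ge0_integralZl//; last first.
    by apply: measurable_normX; apply: measurable_sum => i; exact: bh.1.
  apply: (@le_trans _ _ ((`|n%:R^-1| ^+ 2)%:E * (n%:R * C)%:E)%E).
    by rewrite lee_wpmul2l ?lee_fin// S2.
  rewrite -EFinM lee_fin ger0_norm ?invr_ge0//.
  case: n => [|n]; first by rewrite mul0r mulr0 invr0 mulr0.
  by rewrite expr2 mulrA mulfVK ?pnatr_eq0// mulrC.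
move=> e e0; exists (Num.bound (C / e)) => n Hn; apply: le_trans (avg2 n) _.
have B0 : 0 <= C / e by rewrite divr_ge0// ltW.
have := archi_boundP B0; rewrite ltr_pdivrMr// => Hb.
have n0 : 0 < n%:R :> R.
  by rewrite ltr0n (leq_trans _ Hn).
rewrite lee_fin ler_pdivrMr// (le_trans (ltW Hb))// mulrC ler_wpM2l ?(ltW e0)//.
by rewrite ler_nat.
Qed.

End Moments.

(** * Stable matrices *)

Section StableMatrices.
Context {R : realType}.

Local Notation normc := (@Normc.normc R).

Lemma normc_real (x : R) : normc (real_complex R x) = `|x|.
Proof. by rewrite /Normc.normc /= expr0n/= addr0 sqrtr_sqr. Qed.

Lemma normc_ge0 (z : R[i]) : 0 <= normc z.
Proof. by case: z => a b; rewrite /Normc.normc sqrtr_ge0. Qed.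

(* If (B_{t+1}) - z (B_t) is O(r^t) with |z| < r, then so is (B_t); peeling off
   one root of the characteristic polynomial at a time, the claim reduces to
   Cayley-Hamilton. *)
Lemma power_decay_roots n (A : 'M[R[i]]_n.+1) (s : seq R[i]) (r rho : R) :
  0 <= rho -> rho < r -> (forall z, z \in s -> normc z <= rho) ->
  forall B : 'M[R[i]]_n.+1,
  (\prod_(z <- s) (A - z%:M)) * B = 0 ->
  exists2 c : R, 0 <= c & forall t i j, normc ((A ^+ t * B) i j) <= c * r ^+ t.
Proof.
move=> rho0 rhor; have r0 : 0 < r by exact: le_lt_trans rhor.
elim/last_ind: s => [|s z IH] hs B.
  rewrite big_nil mul1r => ->; exists 0 => // t i j.
  by rewrite mulr0 mxE mul0r Normc.normc0.
rewrite -cats1 big_cat big_seq1/= -mulrA => /IH[|c c0 Hc].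
  by move=> z' z's; apply: hs; rewrite mem_rcons inE z's orbT.
have zrho : normc z <= rho by apply: hs; rewrite mem_rcons mem_head.
pose m := \sum_i \sum_j normc (B i j).
have m0 : 0 <= m by apply: sumr_ge0 => i _; apply: sumr_ge0 => j _; exact: normc_ge0.
(* With b_(t+1) <= rho b_t + c r^t, a bound q r^t propagates as soon as q (r - rho) >= c; the
   summand m takes care of t = 0. *)
exists (m + c / (r - rho)).
  by rewrite addr_ge0// divr_ge0// subr_ge0 ltW.
elim=> [|t IHt] i j.
  rewrite expr0 expr0 mul1r mulr1 (@le_trans _ _ m)//; last first.
    by rewrite lerDl divr_ge0// subr_ge0 ltW.
  rewrite /m (bigD1 i)//= (bigD1 j)//= -addrA lerDl addr_ge0//.
    by apply: sumr_ge0 => ? _; exact: normc_ge0.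
  by apply: sumr_ge0 => ? _; apply: sumr_ge0 => ? _; exact: normc_ge0.
have -> : A ^+ t.+1 * B = z *: (A ^+ t * B) + A ^+ t * ((A - z%:M) * B).
  rewrite exprSr mulrBl mulrBr -!mulrA [z%:M * B](mul_scalar_mx z B).
  by rewrite -[A ^+ t * (z *: B)]scalemxAr addrC subrK.
rewrite !mxE; apply: le_trans (le_normcD _ _) _; rewrite Normc.normcM.
have {}Hc := Hc t i j; rewrite !mxE in Hc; have {}IHt := IHt i j; rewrite !mxE in IHt.
apply: (@le_trans _ _ (rho * ((m + c / (r - rho)) * r ^+ t) + c * r ^+ t)).
  apply: lerD => //; apply: ler_pM => //; exact: normc_ge0.
have rt := exprn_gt0 t r0; rewrite exprS; move: (r ^+ t) rt => p p0.
have H1 : m * rho <= m * r by rewrite ler_wpM2l// ltW.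
have H2 : c / (r - rho) * (r - rho) = c by rewrite divfK// subr_eq0 gt_eqF.
move: (c / (r - rho)) H2 => q H2.
have -> : rho * ((m + q) * p) + c * p = (rho * (m + q) + c) * p by ring.
have -> : (m + q) * (r * p) = (m + q) * r * p by ring.
rewrite ler_pM2r//; lra.
Qed.

Lemma stable_power_decay n (A : 'M[R]_n) : spectral_radius A < 1 ->
  exists c r : R, [/\ 0 <= c, 0 < r < 1 & forall t i j, `|(A ^+ t) i j| <= c * r ^+ t].
Proof.
case: n A => [|n] A hA.
  by exists 0, 2^-1; split=> [//||t []//]; lra.
pose Ac := map_mx (real_complex R) A.
have [s Es] := closed_field_poly_normal (char_poly Ac).
have mon : lead_coef (char_poly Ac) = 1 by have := char_poly_monic Ac; rewrite monicE => /eqP.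
rewrite mon scale1r in Es.
pose rho := Num.max 0 (spectral_radius A).
have rho1 : rho < 1 by rewrite gt_max ltr01.
have rho0 : 0 <= rho by rewrite le_max lexx.
have eigs z : eigenvalue Ac z = (z \in s).
  by rewrite eigenvalue_root_char Es root_prod_XsubC.
have hs z : z \in s -> normc z <= rho.
  move=> zs; rewrite le_max; apply/orP; right.
  apply: ub_le_sup; last by exists z => //=; rewrite eigs.
  (* A [sup] dominates its set only if the set is bounded above; the sum of the moduli of all roots
     is a crude bound. *)
  exists (\sum_(x <- s) normc x) ; move=> y [x /= ex <-]; move: ex; rewrite eigs => xs.
  rewrite (big_rem x)//= lerDl; apply: sumr_ge0 => ? _; exact: normc_ge0.
have hp : (\prod_(z <- s) (Ac - z%:M)) * 1 = 0.
  rewrite mulr1 -(Cayley_Hamilton Ac) Es rmorph_prod; apply: eq_bigr => z _.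
  by rewrite rmorphB /= horner_mx_X horner_mx_C.
have rr : rho < (1 + rho) / 2 by lra.
have [c c0 Hc] := power_decay_roots rho0 rr hs hp.
exists c, ((1 + rho) / 2); split => //; first by lra.
move=> t i j; have := Hc t i j; rewrite mulr1.
have -> : Ac ^+ t = map_mx (real_complex R) (A ^+ t) by rewrite rmorphXn.
by rewrite mxE normc_real.
Qed.

Lemma le_geometric_le0 (c r x : R) : 0 <= c -> 0 < r < 1 ->
  (forall t, x <= c * r ^+ t) -> x <= 0.
Proof.
move=> c0 /andP[r0 r1] H; rewrite leNgt; apply/negP => x0.
have : (c * r ^+ t) @[t --> \oo] --> c * 0.
  apply: cvgMr; apply: cvg_expr; by rewrite ger0_norm// ltW.
rewrite mulr0 => /cvgr0Pnorm_lt => /(_ x x0) [N _ HN].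
have := HN N (leqnn N); rewrite /= ger0_norm; last by rewrite mulr_ge0// exprn_ge0// ltW.
by rewrite ltNge H.
Qed.

Lemma power_sandwich_decay n (A X : 'M[R]_n) : spectral_radius A < 1 ->
  exists c r : R, [/\ 0 <= c, 0 < r < 1 &
    forall t i j, `|(A ^+ t *m X *m (A ^+ t)^T) i j| <= c * r ^+ t].
Proof.
move=> /stable_power_decay [c [r [c0 /andP[r0 r1] Hc]]].
pose m := \sum_i \sum_j `|X i j|.
have m0 : 0 <= m by apply: sumr_ge0 => i _; exact: sumr_ge0.
exists (c ^+ 2 * m), (r ^+ 2); split.
- by rewrite mulr_ge0 ?exprn_ge0.
- by rewrite exprn_gt0//= exprn_ilt1// ltW.
move=> t i j; rewrite !mxE.
apply: le_trans (ler_norm_sum _ _ _) _.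
apply: (@le_trans _ _ (\sum_k \sum_l (c * r ^+ t) * `|X l k| * (c * r ^+ t))).
  apply: ler_sum => k _; rewrite !mxE mulr_suml; apply: le_trans (ler_norm_sum _ _ _) _.
  apply: ler_sum => l _; rewrite !normrM.
  by apply: ler_pM; rewrite ?mulr_ge0//; apply: ler_pM.
have -> : \sum_k \sum_l c * r ^+ t * `|X l k| * (c * r ^+ t) =
    (c * r ^+ t) ^+ 2 * \sum_k \sum_l `|X l k|.
  rewrite mulr_sumr; apply: eq_bigr => k _; rewrite mulr_sumr.
  by apply: eq_bigr => l _; rewrite mulrAC -expr2.
by rewrite exchange_big/= -/m exprMn -exprM mulnC exprM mulrAC.
Qed.

Lemma lyapunov_iter n (A X : 'M[R]_n) : X = A *m X *m A^T ->
  forall t, X = A ^+ t *m X *m (A ^+ t)^T.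
Proof.
move=> HX; elim=> [|t IH]; first by rewrite expr0 trmx1 mulmx1 mul1mx.
rewrite {1}IH {1}HX exprSr trmx_mul -!mulmxA.
by [].
Qed.

Lemma lyapunov_unique n (A X : 'M[R]_n) : spectral_radius A < 1 ->
  X = A *m X *m A^T -> X = 0.
Proof.
move=> hA HX; have [c [r [c0 r01 Hc]]] := power_sandwich_decay X hA.
apply/matrixP => i j; rewrite mxE; apply/eqP; rewrite -normr_le0.
by apply: (le_geometric_le0 c0 r01) => t; rewrite {1}(lyapunov_iter HX t).
Qed.

(** The operator D - A D A^T is injective on a finite-dimensional space, hence invertible. A fixed
    matrix M for its inverse turns a random Lyapunov residual that is null into a null D. *)
Lemma lyapunov_inverse n (A : 'M[R]_n) : spectral_radius A < 1 ->
  exists M : 'M[R]_(n * n), forall D : 'M[R]_n,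
    mxvec D = mxvec (D - A *m D *m A^T) *m M.
Proof.
move=> hA; pose L := 1%:M - lin_mx (mulmx A) *m lin_mx (mulmxr A^T).
have LE (D : 'M[R]_n) : mxvec D *m L = mxvec (D - A *m D *m A^T).
  by rewrite mulmxBr mulmx1 mulmxA !mul_vec_lin /= linearB.
have uL : L \in unitmx.
  rewrite -row_free_unit; apply: inj_row_free => v vL0.
  have := LE (vec_mx v); rewrite vec_mxK vL0.
  move/esym/(canRL mxvecK); rewrite linear0 => /eqP; rewrite subr_eq0 => /eqP /(lyapunov_unique hA) v0.
  by rewrite -[v]vec_mxK v0 linear0.
by exists (invmx L) => D; rewrite -LE mulmxK.
Qed.

(** Each use of the equation drops a nonnegative term, so u^T X u dominates u^T A^t X (A^t)^T u for
    every t, and the latter tends to 0. *)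
Lemma lyapunov_psd n (A X Q : 'M[R]_n) : spectral_radius A < 1 ->
  X = A *m X *m A^T + Q ->
  (forall u : 'cV[R]_n, 0 <= (u^T *m Q *m u) ord0 ord0) ->
  forall u : 'cV[R]_n, 0 <= (u^T *m X *m u) ord0 ord0.
Proof.
move=> hA HX HQ u; have [c [r [c0 r01 Hc]]] := power_sandwich_decay X hA.
have step t : (u^T *m (A ^+ t *m X *m (A ^+ t)^T) *m u) ord0 ord0 <=
    (u^T *m X *m u) ord0 ord0.
  elim: t => [|t IH]; first by rewrite expr0 trmx1 mulmx1 mul1mx.
  apply: le_trans _ IH; rewrite [X in _ <= (_ *m (_ *m X *m _) *m _) _ _]HX.
  rewrite mulmxDr mulmxDl mulmxDr mulmxDl exprSr trmx_mul -!mulmxA [leRHS]mxE lerDl.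
  by have := HQ ((A ^+ t)^T *m u); rewrite trmx_mul trmxK !mulmxA.
pose m := \sum_i \sum_j `|u i ord0| * `|u j ord0|.
have m0 : 0 <= m by apply: sumr_ge0 => i _; apply: sumr_ge0 => j _; rewrite mulr_ge0.
rewrite -oppr_le0; apply: (le_geometric_le0 (mulr_ge0 m0 c0) r01) => t.
apply: (@le_trans _ _ (- (u^T *m (A ^+ t *m X *m (A ^+ t)^T) *m u) ord0 ord0)).
  by rewrite lerN2.
apply: le_trans (ler_norm _) _; rewrite normrN mxE.
apply: le_trans (ler_norm_sum _ _ _) _.
rewrite /m -mulrA mulr_suml; apply: ler_sum => i _; rewrite mxE mulr_suml.
rewrite mulr_suml; apply: le_trans (ler_norm_sum _ _ _) _; apply: ler_sum => j _.
by rewrite !normrM !mxE mulrAC [X in _ <= X * _]mulrC ler_wpM2l ?mulr_ge0// (le_trans _ (Hc t j i))// !mxE.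
Qed.

End StableMatrices.

(** * Sample averages *)

Section MatrixMoments.
Context {d : measure_display} {T : measurableType d} {R : realType}.
Variable P : probability T R.

Definition mbdd {I : Type} {m n : nat} (F : I -> T -> 'M[R]_(m, n)) : Prop :=
  forall i j, bddmom P (fun t o => F t o i j).

Definition mnull {m n : nat} (F : nat -> T -> 'M[R]_(m, n)) : Prop :=
  forall i j, null P (fun t o => F t o i j).

Definition mavg {m n : nat} (F : nat -> T -> 'M[R]_(m, n)) (N : nat) (o : T) :
    'M[R]_(m, n) := N%:R^-1 *: \sum_(t < N) F t o.

Lemma mavgE {m n : nat} (F : nat -> T -> 'M[R]_(m, n)) i j :
  (fun N o => mavg F N o i j) = avg (fun t o => F t o i j).
Proof.
by apply/funext => N; apply/funext => o; rewrite /avg mxE summxE.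
Qed.

Lemma mbdd_const {I : Type} {m n : nat} (M : 'M[R]_(m, n)) :
  mbdd (fun (_ : I) _ => M).
Proof. by move=> i j; exact: bddmom_const. Qed.

Lemma mbddD {I : Type} {m n : nat} (F G : I -> T -> 'M[R]_(m, n)) :
  mbdd F -> mbdd G -> mbdd (fun t o => F t o + G t o).
Proof.
by move=> bF bG i j; under eq_fun do under eq_fun do rewrite mxE; exact: bddmomD.
Qed.

Lemma mbddM {I : Type} {m n p : nat} (F : I -> T -> 'M[R]_(m, n))
    (G : I -> T -> 'M[R]_(n, p)) :
  mbdd F -> mbdd G -> mbdd (fun t o => F t o *m G t o).
Proof.
move=> bF bG i j; under eq_fun do under eq_fun do rewrite mxE.
by apply: bddmom_sum => k; apply: bddmomM; [exact: bF|exact: bG].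
Qed.

Lemma mbdd_tr {I : Type} {m n : nat} (F : I -> T -> 'M[R]_(m, n)) :
  mbdd F -> mbdd (fun t o => (F t o)^T).
Proof. by move=> bF i j; under eq_fun do under eq_fun do rewrite mxE; exact: bF. Qed.

Lemma mbdd_comp {I J : Type} {m n : nat} (F : I -> T -> 'M[R]_(m, n)) (s : J -> I) :
  mbdd F -> mbdd (fun t => F (s t)).
Proof. by move=> bF i j; exact: (bddmom_comp s (bF i j)). Qed.

Lemma mnullD {m n : nat} (F G : nat -> T -> 'M[R]_(m, n)) :
  mnull F -> mnull G -> mnull (fun t o => F t o + G t o).
Proof.
by move=> bF bG i j; under eq_fun do under eq_fun do rewrite mxE; exact: nullD.
Qed.

Lemma mnullN {m n : nat} (F : nat -> T -> 'M[R]_(m, n)) :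
  mnull F -> mnull (fun t o => - F t o).
Proof.
move=> nF i j; under eq_fun do under eq_fun do rewrite mxE -mulN1r; exact: nullZ.
Qed.

Lemma mnullMr {m n p : nat} (F : nat -> T -> 'M[R]_(m, n))
    (G : nat -> T -> 'M[R]_(n, p)) :
  mnull F -> mbdd G -> mnull (fun t o => F t o *m G t o).
Proof.
move=> bF bG i j; under eq_fun do under eq_fun do rewrite mxE.
by apply: null_sum => k; apply: nullM; [exact: bF|exact: bG].
Qed.

Lemma mnull_tr {m n : nat} (F : nat -> T -> 'M[R]_(m, n)) :
  mnull F -> mnull (fun t o => (F t o)^T).
Proof. by move=> bF i j; under eq_fun do under eq_fun do rewrite mxE; exact: bF. Qed.

Lemma mnullMl {m n p : nat} (F : nat -> T -> 'M[R]_(m, n))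
    (G : nat -> T -> 'M[R]_(n, p)) :
  mbdd F -> mnull G -> mnull (fun t o => F t o *m G t o).
Proof.
move=> bF nG; rewrite (_ : (fun t o => _) = (fun t o => ((G t o)^T *m (F t o)^T)^T)).
  by apply: mnull_tr; apply: mnullMr; [exact: mnull_tr|exact: mbdd_tr].
by apply/funext => t; apply/funext => o; rewrite trmx_mul !trmxK.
Qed.

Lemma null_invn : null P (fun n (_ : T) => n%:R^-1).
Proof.
apply: null_cst; have := @cvg_harmonic R.
by rewrite -(cvg_shiftS (fun n => n%:R^-1 : R^o)); apply.
Qed.

Lemma mnull_invn {m n : nat} (F : nat -> T -> 'M[R]_(m, n)) :
  mbdd F -> mnull (fun t o => t%:R^-1 *: F t o).
Proof.
move=> bF i j; under eq_fun do under eq_fun do rewrite mxE.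
by apply: nullM; [exact: null_invn|exact: bF].
Qed.

Lemma mavg_mull {m n p : nat} (M : 'M[R]_(m, n)) (F : nat -> T -> 'M[R]_(n, p)) N o :
  mavg (fun t o => M *m F t o) N o = M *m mavg F N o.
Proof. by rewrite /mavg -scalemxAr -mulmx_sumr. Qed.

Lemma mavg_mulr {m n p : nat} (M : 'M[R]_(n, p)) (F : nat -> T -> 'M[R]_(m, n)) N o :
  mavg (fun t o => F t o *m M) N o = mavg F N o *m M.
Proof. by rewrite /mavg -scalemxAl -mulmx_suml. Qed.

Lemma mavgD {m n : nat} (F G : nat -> T -> 'M[R]_(m, n)) N o :
  mavg (fun t o => F t o + G t o) N o = mavg F N o + mavg G N o.
Proof. by rewrite /mavg big_split scalerDr. Qed.

Lemma mavg_tr {m n : nat} (F : nat -> T -> 'M[R]_(m, n)) N o :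
  mavg (fun t o => (F t o)^T) N o = (mavg F N o)^T.
Proof.
apply/matrixP => i j; rewrite !mxE !summxE; congr (_ * _).
by apply: eq_bigr => t _; rewrite mxE.
Qed.

Lemma mavg_shift {m n : nat} (F : nat -> T -> 'M[R]_(m, n)) N o :
  mavg (fun t => F t.+1) N o =
  mavg F N o + N%:R^-1 *: (F N o - F 0%N o).
Proof.
rewrite /mavg -scalerDr; congr (_ *: _).
elim: N => [|N IH]; first by rewrite !big_ord0 subrr addr0.
by rewrite !big_ord_recr/= IH -!addrA [- _ + _]addrC.
Qed.

Lemma mnull_avg_shift {m n : nat} (F : nat -> T -> 'M[R]_(m, n)) M :
  mbdd F -> mnull (fun N o => mavg F N o - M) ->
  mnull (fun N o => mavg (fun t => F t.+1) N o - M).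
Proof.
move=> bF nF.
rewrite (_ : (fun N o => _) = (fun N o => (mavg F N o - M) +
   N%:R^-1 *: (F N o + - 1%:M *m F 0%N o))).
  apply: mnullD => //; apply: mnull_invn; apply: mbddD => //.
  apply: mbddM; first exact: mbdd_const.
  exact: (mbdd_comp (fun=> 0%N) bF).
apply/funext => N; apply/funext => o; rewrite mavg_shift mulNmx mul1mx.
by rewrite addrAC.
Qed.

End MatrixMoments.

Section NoiseAverages.
Context {d : measure_display} {T : measurableType d} {R : realType}.
Variable P : probability T R.
Context {I : eqType}.
Variable X : I -> {RV P >-> R}.
Hypothesis Xn : iid_std_normal X.

Lemma dep_horner (Q : pred I) (p : {poly R}) (f : T -> R) :
  dep X Q f -> dep X Q (fun o => p.[f o]).
Proof.
move=> Qf; rewrite /dep; under eq_fun do rewrite horner_coef.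
by apply: measurable_sum => i; apply: measurable_funM => //; exact: measurable_funX.
Qed.

Lemma moment_noise k n : moment P (X k) n = moment std_normal id n.
Proof.
have m0 : measurable_fun [set: R] (fun x : R => (`|x| ^+ n)%:E).
  exact: (@measurable_normX _ _ _ id).
have [Xlaw _] := Xn.
rewrite /moment -(@ge0_integral_distribution _ _ _ _ _ _ (X k) (fun x => (`|x| ^+ n)%:E))//.
apply: eq_measure_integral => A mA _; apply: etrans (esym (std_normalE A)).
exact: Xlaw.
Qed.

Lemma bddmom_noise {J : Type} (s : J -> I) : bddmom P (fun j => X (s j) : T -> R).
Proof.
split=> [j|k]; first exact: measurable_funPT.
have [C HC] := @normal_moment_bounded R k.
by exists C => j; rewrite moment_noise.
Qed.

Lemma bddmom_noise_poly {J : Type} (s : J -> I) (p : {poly R}) :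
  bddmom P (fun j o => p.[X (s j) o]).
Proof.
under eq_fun do under eq_fun do rewrite horner_coef.
apply: bddmom_sum => i; apply: bddmomM; first exact: bddmom_const.
by apply: bddmomX; exact: bddmom_noise.
Qed.

(** [normal_centered_square] with all but one noise frozen: Pythagoras for a martingale
    increment. *)
Lemma noise_centered_square (p : {poly R}) :
  (\int[std_normal]_x (p.[x])%:E = 0)%E ->
  exists2 c : R, 0 <= c & forall (Q : pred I) k (S F : T -> R),
   ~~ Q k -> dep X Q S -> dep X Q F ->
  (moment P (fun o => (S o + F o * p.[X k o])%R) 2 =
   moment P S 2 + c%:E * moment P F 2)%E.
Proof.
move=> p0; have [c c0 Hc] := normal_centered_square p0; exists c => //.
move=> Q k S F Qk dS dF; rewrite /moment.
pose f (z : R * noise_algebra X Q) : \bar R :=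
  (`|S z.2 + F z.2 * p.[z.1]| ^+ 2)%:E.
have mf : measurable_fun setT f.
  apply/measurable_EFinP; apply: measurable_funX; apply: measurableT_comp => //.
  apply: measurable_funD; first exact: (measurableT_comp dS measurable_snd).
  apply: measurable_funM; first exact: (measurableT_comp dF measurable_snd).
  under eq_fun do rewrite horner_coef.
  apply: measurable_sum => i; apply: measurable_funM => //.
  by apply: measurable_funX; exact: measurable_fst.
have f0 z : (0 <= f z)%E by rewrite lee_fin exprn_ge0.
transitivity (\int[P]_o f (X k o, o))%E; first by [].
rewrite (noise_fubini Xn Qk mf f0).
transitivity (\int[P]_o ((`|S o| ^+ 2)%:E + c%:E * (`|F o| ^+ 2)%:E))%E.
  apply: eq_integral => o _; rewrite /f /=.
  under eq_integral do rewrite real_normK ?num_real//.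
  by rewrite Hc !real_normK ?num_real// -EFinM -EFinD mulrC.
have mS := dep_measurable dS; have mF := dep_measurable dF.
rewrite ge0_integralD//.
- by rewrite ge0_integralZl//; exact: measurable_normX.
- exact: measurable_normX.
- by move=> o _; rewrite mule_ge0// lee_fin.
- apply: emeasurable_funM => //; exact: measurable_normX.
Qed.

(** A martingale law of large numbers. The Q t form a filtration, f t is known at time t, and the
    noise k t is fresh at t and known at every later time. *)
Lemma null_avg_noise (f : nat -> T -> R) (k : nat -> I) (Q : nat -> pred I)
    (p : {poly R}) :
  bddmom P f -> (\int[std_normal]_x (p.[x])%:E = 0)%E ->
  (forall t, ~~ Q t (k t)) -> (forall t, dep X (Q t) (f t)) ->
  (forall s t, (s < t)%N -> Q t (k s) /\ {subset Q s <= Q t}) ->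
  null P (avg (fun t o => f t o * p.[X (k t) o])).
Proof.
move=> bf p0 Qk df QQ.
have [c c0 Hc] := noise_centered_square p0.
have [C C0 HC] := bddmomP 2 bf.
apply: (@null_avg_orthogonal _ _ _ P _ (c * C)).
- by rewrite mulr_ge0.
- by apply: bddmomM => //; exact: bddmom_noise_poly.
move=> n; under [X in (moment _ X _ <= _)%E]eq_fun do rewrite big_ord_recr/=.
rewrite (Hc (Q n) (k n) _ _ (Qk n) _ (df n)).
  by rewrite leeD2l// EFinM lee_wpmul2l.
apply: measurable_sum => i; have [Qi QiQ] := QQ _ _ (ltn_ord i).
apply: measurable_funM; first exact: (sub_dep QiQ (df i)).
by apply: dep_horner; exact: dep_noise.
Qed.

Lemma null_avg_noise_linear (f : nat -> T -> R) (k : nat -> I) (Q : nat -> pred I) :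
  bddmom P f ->
  (forall t, ~~ Q t (k t)) -> (forall t, dep X (Q t) (f t)) ->
  (forall s t, (s < t)%N -> Q t (k s) /\ {subset Q s <= Q t}) ->
  null P (avg (fun t o => f t o * X (k t) o)).
Proof.
move=> bf Qk df QQ; have := @null_avg_noise f k Q 'X bf _ Qk df QQ.
rewrite (_ : (fun t o => f t o * 'X.[X (k t) o]) = (fun t o => f t o * X (k t) o)).
  by apply; under eq_integral do rewrite hornerX; exact: normal_mean.
by apply/funext => t; apply/funext => o; rewrite hornerX.
Qed.

Lemma null_avg_noise_square (k : nat -> I) : injective k ->
  null P (avg (fun t o => X (k t) o ^+ 2 - 1)).
Proof.
(* Q t consists of the indices used before time t. *)
move=> kinj; pose Q t := [pred i | [exists s : 'I_t, k s == i]].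
have := @null_avg_noise (fun _ _ => 1) k Q ('X^2 - 1).
rewrite (_ : (fun t o => 1 * _) = (fun t o => X (k t) o ^+ 2 - 1)); last first.
  by apply/funext => t; apply/funext => o; rewrite mul1r !hornerE.
apply.
- exact: bddmom_const.
- under eq_integral do rewrite !hornerE EFinB.
  rewrite integralB//.
  + by rewrite normal_second_moment normal_integral_cst subee.
  + by have := @normal_integrable_polynomial R 'X^2; under eq_fun do rewrite hornerXn.
  + by have := @normal_integrable_polynomial R 1; under eq_fun do rewrite hornerC.
- move=> t; apply/negP => /existsP[s /eqP/kinj st].
  by have := ltn_ord s; rewrite st ltnn.
- by move=> t; exact: measurable_cst.
move=> s t st; split; first by apply/existsP; exists (Ordinal st).
move=> i /existsP[u /eqP <-]; apply/existsP.
by exists (Ordinal (ltn_trans (ltn_ord u) st)).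
Qed.

End NoiseAverages.

Section Envelope.
Context {d : measure_display} {T : measurableType d} {R : realType}.
Variable P : probability T R.

(** The geometric convolution of g with ratio r, a scalar majorant of the state. *)
Fixpoint envelope (r : R) (g : nat -> T -> R) (t : nat) (o : T) : R :=
  if t is t'.+1 then r * envelope r g t' o + g t' o else 0.

Lemma bddmom_abs {I : Type} (f : I -> T -> R) :
  bddmom P f -> bddmom P (fun i o => `|f i o|).
Proof.
move=> bf; apply: (bddmom_ae_le _ bf) => i.
  apply: measurableT_comp => //; exact: bf.1.
by apply/aeW => o; rewrite normr_id.
Qed.

(** With h = 1 / (1 - r), r a + b = r a + (1 - r) (h b) is a convex combination, so the moments of
    order k+1 satisfy M_(t+1) <= r M_t + h^k G. The bound h^(k+1) G is the fixed point of this
    recursion. *)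
Lemma bddmom_envelope (r : R) (g : nat -> T -> R) : 0 < r < 1 ->
  bddmom P g -> (forall t o, 0 <= g t o) -> bddmom P (envelope r g).
Proof.
move=> /andP[r0 r1] bg g0; have q0 : 0 < 1 - r by rewrite subr_gt0.
have mE t : measurable_fun setT (envelope r g t).
  elim: t => [|t IH] /=; first exact: measurable_cst.
  by apply: measurable_funD; [exact: measurable_funM|exact: bg.1].
have e0 t o : 0 <= envelope r g t o.
  by elim: t => //= t IH; rewrite addr_ge0// mulr_ge0// ltW.
split => // k; case: k => [|k].
  exists 1 => t; rewrite /moment; under eq_integral do rewrite expr0.
  by rewrite integral_constant.
have [G G0 HG] := bddmomP k.+1 bg.
pose h := (1 - r)^-1; have h0 : 0 < h by rewrite invr_gt0.
have hq : h * (1 - r) = 1 by rewrite mulVf// gt_eqF.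
exists (h ^+ k.+1 * G); elim=> [|t IH].
  rewrite /moment; under eq_integral do rewrite /= normr0 expr0n.
  by rewrite integral_constant lee_fin mulr_ge0// exprn_ge0// ltW.
apply: (@le_trans _ _ (r * (h ^+ k.+1 * G) + h ^+ k * G)%:E); last first.
  rewrite lee_fin exprS; move: (h ^+ k) (exprn_ge0 k (ltW h0)) => z z0.
  have -> : r * (h * z * G) + z * G = (r * h + h * (1 - r)) * (z * G) by rewrite hq; ring.
  by rewrite le_eqVlt; apply/orP; left; apply/eqP; ring.
apply: (moment_le2 (mE t.+1) (mE t) (bg.1 t) _ _ _ IH (HG t)).
- exact: ltW.
- by rewrite exprn_ge0// ltW.
apply/aeW => o /=; rewrite !ger0_norm ?addr_ge0 ?mulr_ge0 ?(ltW r0)//.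
set a := envelope r g t o; set b := g t o.
have a0 : 0 <= a by exact: e0.
have b0 : 0 <= h * b by rewrite mulr_ge0 ?(ltW h0)//; exact: g0.
have Ec : r * a + b = r * a + (1 - r) * (h * b) by rewrite mulrA [_ * h]mulrC hq mul1r.
have c0 : 0 <= r * a + b by rewrite Ec addr_ge0// mulr_ge0// ltW.
have Ta := ler_wpM2l (ltW r0) (expr_tangent k a0 c0).
have Tb := ler_wpM2l (ltW q0) (expr_tangent k b0 c0).
have Eb : (1 - r) * (h * b) ^+ k.+1 = h ^+ k * b ^+ k.+1.
  by rewrite exprMn exprS !mulrA [_ * h]mulrC hq mul1r.
rewrite -Eb; apply: le_trans (lerD Ta Tb).
set c := r * a + b in Ec c0 Ta Tb *.
have -> : r * (c ^+ k.+1 + k.+1%:R * c ^+ k * (a - c)) +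
  (1 - r) * (c ^+ k.+1 + k.+1%:R * c ^+ k * (h * b - c)) =
  c ^+ k.+1 + k.+1%:R * c ^+ k * (r * a + (1 - r) * (h * b) - c) by ring.
by rewrite -Ec subrr mulr0 addr0.
Qed.

End Envelope.

(** * Laws of large numbers for the states and outputs of one rollout *)

Section SystemAverages.
Context {R : realType} {dx dy : nat}.
Variables (A Bw : 'M[R]_dx) (C : 'M[R]_(dy, dx)) (Dv : 'M[R]_dy).
Hypothesis A_stable : spectral_radius A < 1.
Context {d : measure_display} {T : measurableType d}.
Variable P : probability T R.
Variables (w : nat -> 'I_dx -> {RV P >-> R}) (v : nat -> 'I_dy -> {RV P >-> R}).
Hypothesis wv_noise : white_noise2 w v.

Definition noise_index : eqType := (nat * ('I_dx + 'I_dy))%type.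

Definition noise (k : noise_index) : {RV P >-> R} :=
  match k.2 with inl i => w k.1 i | inr j => v k.1 j end.

Let Xn : iid_std_normal noise := wv_noise.

Definition wr (t : nat) (o : T) := sample_path w o t.

Definition vr (t : nat) (o : T) := sample_path v o t.

Definition xr (t : nat) (o : T) := state A Bw (sample_path w o) t.

Definition yr (t : nat) (o : T) := random_output A Bw C Dv w v o t.

Lemma xrS t o : xr t.+1 o = A *m xr t o + Bw *m wr t o.
Proof. by []. Qed.

Lemma yrE t o : yr t o = C *m xr t o + Dv *m vr t o.
Proof. by []. Qed.

Lemma mbdd_v : mbdd P vr.
Proof.
move=> i j; under eq_fun do under eq_fun do rewrite mxE.
exact: (bddmom_noise Xn (fun t => (t, inr i))).
Qed.

Lemma dep_state (Q : pred noise_index) t i j :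
  (forall s e, (s < t)%N -> Q (s, inl e)) -> dep noise Q (fun o => xr t o i j).
Proof.
elim: t i j => [|t IH] i j HQ.
  by under eq_fun do rewrite mxE; exact: measurable_cst.
rewrite /dep; under eq_fun do rewrite xrS !mxE.
apply: measurable_funD; apply: measurable_sum => k; apply: measurable_funM => //.
  by apply: IH => s e st; apply: HQ; exact: ltnW.
under eq_fun do rewrite mxE.
exact: (@dep_noise _ _ _ _ _ noise Q (t, inl k) (HQ t k (ltnSn t))).
Qed.

Lemma measurable_state t i j : measurable_fun [set: T] (fun o => xr t o i j).
Proof. by apply: (dep_measurable (@dep_state predT t i j _)). Qed.

Lemma mbdd_x : mbdd P xr.
Proof.
have [c [r [c0 r01 Hc]]] := stable_power_decay A_stable.
pose g t o : R := \sum_i `|w t i o|.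
have bg : bddmom P g.
  apply: bddmom_sum => i; apply: bddmom_abs.
  exact: (bddmom_noise Xn (fun t => (t, inl i))).
have g0 t o : 0 <= g t o by exact: sumr_ge0.
have be := bddmom_envelope r01 bg g0.
have [r0 r1] := andP r01.
pose b := \sum_i \sum_j `|Bw i j|.
have b0 : 0 <= b by apply: sumr_ge0 => i _; exact: sumr_ge0.
have AB m i j : `|(A ^+ m *m Bw) i j| <= c * b * r ^+ m.
  rewrite mxE; apply: le_trans (ler_norm_sum _ _ _) _.
  apply: (@le_trans _ _ (\sum_k c * r ^+ m * `|Bw k j|)).
    by apply: ler_sum => k _; rewrite normrM ler_wpM2r.
  rewrite -mulr_sumr [leRHS]mulrAC ler_wpM2l ?mulr_ge0 ?exprn_ge0 ?(ltW r0)//.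
  apply: ler_sum => k _; rewrite (bigD1 j)//= lerDl; exact: sumr_ge0.
(* Only the powers of A are known to decay, A itself need not contract entrywise; hence the
   induction on t carries an arbitrary A^m in front. *)
have key t o m i j : `|(A ^+ m *m xr t o) i j| <= c * b * r ^+ m * envelope r g t o.
  elim: t m => [|t IH] m; first by rewrite mulmx0 mxE normr0 mulr0.
  rewrite xrS mulmxDr mulmxA mulmxA -[A ^+ m *m A]exprSr mxE.
  apply: le_trans (ler_normD _ _) _; rewrite /= mulrDr; apply: lerD.
    by apply: le_trans (IH m.+1) _; rewrite exprS !mulrA [_ * r * _]mulrAC.
  rewrite mxE; apply: le_trans (ler_norm_sum _ _ _) _.
  rewrite /g mulr_sumr; apply: ler_sum => k _; rewrite normrM [wr _ _ _ _]mxE.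
  exact: ler_pM.
move=> i j; apply: (@bddmom_ae_le _ _ _ P _ _ (fun t o => c * b * envelope r g t o)).
- by move=> t; exact: measurable_state.
- by apply: bddmomM => //; exact: bddmom_const.
move=> t; apply/aeW => o; have := key t o 0%N i j.
by rewrite expr0 mul1mx mulr1 => H; apply: le_trans (ler_norm _).
Qed.

Lemma mbdd_y : mbdd P yr.
Proof.
apply: (@mbddD _ _ _ P _ _ _ (fun t o => C *m xr t o) (fun t o => Dv *m vr t o)).
  by apply: mbddM; [exact: mbdd_const|exact: mbdd_x].
by apply: mbddM; [exact: mbdd_const|exact: mbdd_v].
Qed.

Lemma colM_trE {p q : nat} (x : 'cV[R]_p) (y : 'cV[R]_q) i j :
  (x *m y^T) i j = x i ord0 * y j ord0.
Proof. by rewrite mxE big_ord1 mxE. Qed.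

(** The fresh noise is v_t although x_(t+m) already involves later disturbances. The filtration
    therefore admits w up to time t + m but v only before t. *)
Lemma null_state_measurement m : mnull P (mavg (fun t o => xr (t + m) o *m (vr t o)^T)).
Proof.
move=> i j; rewrite mavgE.
rewrite (_ : (fun t o => _) = (fun t o => xr (t + m) o i ord0 * noise (t, inr j) o)); last first.
  by apply/funext => t; apply/funext => o; rewrite colM_trE [vr _ _ _ _]mxE.
apply: (null_avg_noise_linear Xn (Q := fun t (k : noise_index) =>
   match k.2 with inl _ => (k.1 < t + m)%N | inr _ => (k.1 < t)%N end)).
- exact: (bddmom_comp (fun t => (t + m)%N) (mbdd_x i ord0)).
- by move=> t /=; rewrite ltnn.
- by move=> t; apply: dep_state.
move=> s t st; split => // -[u [e|e]]; rewrite !unfold_in /= => us.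
  by rewrite (leq_trans us)// leq_add2r ltnW.
exact: ltn_trans st.
Qed.

Lemma null_disturbance_state m : mnull P (mavg (fun t o => wr (t + m) o *m (xr t o)^T)).
Proof.
move=> i j; rewrite mavgE.
rewrite (_ : (fun t o => _) = (fun t o => xr t o j ord0 * noise ((t + m)%N, inl i) o)); last first.
  by apply/funext => t; apply/funext => o; rewrite colM_trE [wr _ _ _ _]mxE mulrC.
apply: (null_avg_noise_linear Xn (Q := fun t (k : noise_index) => (k.1 < t + m)%N)).
- exact: mbdd_x.
- by move=> t /=; rewrite ltnn.
- by move=> t; apply: dep_state => s e st /=; rewrite (leq_trans st)// leq_addr.
move=> s t st; split => [|[u e]]; rewrite ?unfold_in /=; first by rewrite ltn_add2r.
by move=> us; rewrite (leq_trans us)// leq_add2r ltnW.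
Qed.

Lemma null_measurement_state m : mnull P (mavg (fun t o => vr (t + m) o *m (xr t o)^T)).
Proof.
move=> i j; rewrite mavgE.
rewrite (_ : (fun t o => _) = (fun t o => xr t o j ord0 * noise ((t + m)%N, inr i) o)); last first.
  by apply/funext => t; apply/funext => o; rewrite colM_trE [vr _ _ _ _]mxE mulrC.
apply: (null_avg_noise_linear Xn (Q := fun t (k : noise_index) => (k.1 < t + m)%N)).
- exact: mbdd_x.
- by move=> t /=; rewrite ltnn.
- by move=> t; apply: dep_state => s e st /=; rewrite (leq_trans st)// leq_addr.
move=> s t st; split => [|[u e]]; rewrite ?unfold_in /=; first by rewrite ltn_add2r.
by move=> us; rewrite (leq_trans us)// leq_add2r ltnW.
Qed.

Lemma null_measurement_lag m : mnull P (mavg (fun t o => vr (t + m.+1) o *m (vr t o)^T)).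
Proof.
move=> i j; rewrite mavgE.
rewrite (_ : (fun t o => _) = (fun t o => vr t o j ord0 * noise ((t + m.+1)%N, inr i) o)); last first.
  by apply/funext => t; apply/funext => o; rewrite colM_trE [vr (_ + _)%N _ _ _]mxE mulrC.
apply: (null_avg_noise_linear Xn (Q := fun t (k : noise_index) => (k.1 < t + m.+1)%N)).
- exact: mbdd_v.
- by move=> t /=; rewrite ltnn.
- move=> t; rewrite (_ : (fun o => vr t o j ord0) = noise (t, inr j)); last first.
    by apply/funext => o; rewrite mxE.
  apply: (@dep_noise _ _ _ _ _ noise _ (t, inr j)) => /=.
  by rewrite addnS ltnS leq_addr.
move=> s t st; split => [|[u e]]; rewrite ?unfold_in /=; first by rewrite ltn_add2r.
by move=> us; rewrite (leq_trans us)// leq_add2r ltnW.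
Qed.

Lemma null_noise_pair (e e' : 'I_dx + 'I_dy) :
  null P (fun n o => avg (fun t o => noise (t, e) o * noise (t, e') o) n o - (e == e')%:R).
Proof.
have [<-|ee'] := eqVneq e e'; last first.
  under eq_fun do under eq_fun do rewrite subr0.
  (* The index (t, e) is counted as past, so that (t, e') of the same instant is the fresh noise. *)
  apply: (@null_avg_noise_linear _ _ _ _ _ noise Xn (fun t => noise (t, e)) (fun t => (t, e'))
    (fun t (k : noise_index) => (k.1 < t)%N || (k == (t, e)))).
  - exact: (bddmom_noise Xn (fun t => (t, e))).
  - by move=> t /=; rewrite ltnn xpair_eqE eqxx eq_sym (negbTE ee').
  - by move=> t; apply: dep_noise; rewrite eqxx orbT.
  move=> s t st; split => [|[u f]]; rewrite ?unfold_in /=; first by rewrite st.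
  by rewrite xpair_eqE => /orP[us|/andP[/eqP -> _]]; rewrite ?st ?(ltn_trans us).
have inj : injective (fun t : nat => (t, e) : noise_index) by move=> s t [].
have nn := null_avg_noise_square Xn inj.
(* At n = 0 the average is 0, so subtracting 1 inside and outside the average agree only from n = 1
   on. *)
apply: (@null_eventually _ _ _ P _ _ 1%N _ _ nn).
  have b1 := bddmom_noise Xn (fun t => (t, e)).
  have [mm _] : bddmom P (fun n o => avg (fun t o => noise (t, e) o * noise (t, e) o) n o - true%:R).
    apply: bddmomD; last by apply: bddmomN; exact: bddmom_const.
    by apply: bddmom_avg; apply: bddmomM.
  exact: mm.
move=> n n0; apply/funext => o; rewrite /avg big_split/= sumr_const card_ord mulrDr mulNrn.
rewrite mulrN mulVf ?pnatr_eq0 -?lt0n//.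
Qed.

Lemma null_disturbance_pair :
  mnull P (fun n o => mavg (fun t o => wr t o *m (wr t o)^T) n o - 1%:M).
Proof.
move=> i j; have := null_noise_pair (inl i) (inl j).
rewrite (_ : (fun n o => _) = (fun n o => (mavg (fun t o => wr t o *m (wr t o)^T) n o - 1%:M) i j))//.
apply/funext => n; apply/funext => o; rewrite !mxE summxE /avg (inj_eq (@inl_inj _ _)).
by congr (_ * _ - _); apply: eq_bigr => t _; rewrite colM_trE /wr !mxE.
Qed.

Lemma null_measurement_pair :
  mnull P (fun n o => mavg (fun t o => vr t o *m (vr t o)^T) n o - 1%:M).
Proof.
move=> i j; have := null_noise_pair (inr i) (inr j).
rewrite (_ : (fun n o => _) = (fun n o => (mavg (fun t o => vr t o *m (vr t o)^T) n o - 1%:M) i j))//.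
apply/funext => n; apply/funext => o; rewrite !mxE summxE /avg (inj_eq (@inr_inj _ _)).
by congr (_ * _ - _); apply: eq_bigr => t _; rewrite colM_trE /vr !mxE.
Qed.

Variable Sigma : 'M[R]_dx.
Hypothesis Sigma_lyapunov : Sigma = A *m Sigma *m A^T + Bw *m Bw^T.

(** The average of x_(t+1) x_(t+1)^T differs from that of x_t x_t^T by the boundary term E, while
    the recursion expands it. So the error D of the average satisfies D - A D A^T = N with N null,
    and [lyapunov_inverse] recovers D linearly from N. *)
Lemma state_covariance_average :
  mnull P (fun n o => mavg (fun t o => xr t o *m (xr t o)^T) n o - Sigma).
Proof.
pose S n o := mavg (fun t o => xr t o *m (xr t o)^T) n o.
pose U n o := mavg (fun t o => wr (t + 0) o *m (xr t o)^T) n o.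
pose W n o := mavg (fun t o => wr t o *m (wr t o)^T) n o.
pose E n o := n%:R^-1 *: (xr n o *m (xr n o)^T + (- 1%:M) *m (xr 0 o *m (xr 0 o)^T)).
have bxx : mbdd P (fun t o => xr t o *m (xr t o)^T).
  by apply: mbddM; [exact: mbdd_x|apply: mbdd_tr; exact: mbdd_x].
have nE : mnull P E.
  apply: mnull_invn; apply: mbddD => //; apply: mbddM; first exact: mbdd_const.
  exact: (mbdd_comp (fun=> 0%N) bxx).
pose N n o := Bw *m U n o *m A^T + (Bw *m U n o *m A^T)^T +
  (Bw *m (W n o - 1%:M) *m Bw^T - E n o).
have nBUA : mnull P (fun n o => Bw *m U n o *m A^T).
  apply: (@mnullMr _ _ _ P _ _ _ (fun n o => Bw *m U n o)); last exact: mbdd_const.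
  by apply: mnullMl; [exact: mbdd_const|exact: null_disturbance_state].
have nN : mnull P N.
  apply: mnullD; first by apply: mnullD => //; exact: mnull_tr.
  apply: mnullD; last exact: mnullN.
  apply: (@mnullMr _ _ _ P _ _ _ (fun n o => Bw *m (W n o - 1%:M))); last exact: mbdd_const.
  by apply: mnullMl; [exact: mbdd_const|exact: null_disturbance_pair].
have DN n o : (S n o - Sigma) - A *m (S n o - Sigma) *m A^T = N n o.
  have SE : S n o + E n o = A *m S n o *m A^T + (Bw *m U n o *m A^T)^T +
      Bw *m U n o *m A^T + Bw *m W n o *m Bw^T.
    rewrite /E mulNmx mul1mx -(mavg_shift (fun t o => xr t o *m (xr t o)^T)).
    rewrite /S /U /W -!mavg_mull -!mavg_mulr -mavg_tr -!mavgD.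
    congr (mavg _ n o); apply/funext => t; apply/funext => o'.
    rewrite xrS addn0 linearD /= !trmx_mul !trmxK mulmxDl !mulmxDr !mulmxA !addrA.
    by [].
  have SE' : S n o = A *m S n o *m A^T + (Bw *m U n o *m A^T)^T +
      Bw *m U n o *m A^T + Bw *m W n o *m Bw^T - E n o by rewrite -SE addrK.
  rewrite /N {1}SE' {1}Sigma_lyapunov !mulmxBr !mulmxBl mulmx1.
  move: (A *m S n o *m A^T) (A *m Sigma *m A^T) (Bw *m U n o *m A^T) (Bw *m W n o *m Bw^T)
    (Bw *m Bw^T) (E n o) => a b c e f g.
  by apply/matrixP => i j; rewrite !mxE; ring.
have [M HM] := lyapunov_inverse A_stable.
have DE n o i j : (S n o - Sigma) i j = \sum_q mxvec (N n o) ord0 q * M q (mxvec_index i j).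
  by rewrite -mxvecE HM DN mxE.
move=> i j; rewrite (_ : (fun n o => _) =
    (fun n o => \sum_q mxvec (N n o) ord0 q * M q (mxvec_index i j))); last first.
  by apply/funext => n; apply/funext => o; rewrite -DE.
apply: null_sum => q; apply: nullM; last exact: bddmom_const.
case/mxvec_indexP: q => k l.
rewrite (_ : (fun n o => _) = (fun n o => N n o k l)); first exact: nN.
by apply/funext => n; apply/funext => o; rewrite mxvecE.
Qed.

Lemma state_lag_average m :
  mnull P (fun n o => mavg (fun t o => xr (t + m) o *m (xr t o)^T) n o - A ^+ m *m Sigma).
Proof.
elim: m => [|m IH].
  under eq_fun do under eq_fun do rewrite expr0 mul1mx.
  rewrite (_ : (fun t o => _) = (fun t o => xr t o *m (xr t o)^T)).
    exact: state_covariance_average.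
  by apply/funext => t; apply/funext => o; rewrite addn0.
rewrite (_ : (fun n o => _) = (fun n o =>
  A *m (mavg (fun t o => xr (t + m) o *m (xr t o)^T) n o - A ^+ m *m Sigma) +
  Bw *m mavg (fun t o => wr (t + m) o *m (xr t o)^T) n o)).
  apply: mnullD; apply: mnullMl; try exact: mbdd_const; first exact: IH.
  exact: null_disturbance_state.
apply/funext => n; apply/funext => o; rewrite mulmxBr -!mavg_mull addrAC -mavgD.
rewrite exprS mulmxA; congr (mavg _ n o - _).
apply/funext => t; apply/funext => o'.
by rewrite addnS xrS mulmxDl !mulmxA.
Qed.

Definition output_lag_covariance m : 'M[R]_dy :=
  C *m A ^+ m *m Sigma *m C^T + if m == 0%N then Dv *m Dv^T else 0.

Lemma output_lag_average m :
  mnull P (fun n o => mavg (fun t o => yr (t + m) o *m (yr t o)^T) n o -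
    output_lag_covariance m).
Proof.
pose XX n o := mavg (fun t o => xr (t + m) o *m (xr t o)^T) n o.
pose XV n o := mavg (fun t o => xr (t + m) o *m (vr t o)^T) n o.
pose VX n o := mavg (fun t o => vr (t + m) o *m (xr t o)^T) n o.
pose VV n o := mavg (fun t o => vr (t + m) o *m (vr t o)^T) n o.
have nVV : mnull P (fun n o => VV n o - if m == 0%N then 1%:M else 0).
  rewrite /VV; case: m {XX XV VX VV} => [|m] /=.
    rewrite (_ : (fun t o => vr (t + 0) o *m (vr t o)^T) = (fun t o => vr t o *m (vr t o)^T)).
      exact: null_measurement_pair.
    by apply/funext => t; apply/funext => o; rewrite addn0.
  under eq_fun do under eq_fun do rewrite subr0.
  exact: null_measurement_lag.
have sand (p q r s : nat) (M : 'M[R]_(p, q)) (F : nat -> T -> 'M[R]_(q, r)) (M' : 'M[R]_(r, s)) :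
    mnull P F -> mnull P (fun n o => M *m F n o *m M').
  move=> nF; apply: (@mnullMr _ _ _ P _ _ _ (fun n o => M *m F n o)); last exact: mbdd_const.
  by apply: mnullMl; first exact: mbdd_const.
rewrite (_ : (fun n o => _) = (fun n o =>
  C *m (XX n o - A ^+ m *m Sigma) *m C^T + C *m XV n o *m Dv^T +
  (Dv *m VX n o *m C^T + Dv *m (VV n o - if m == 0%N then 1%:M else 0) *m Dv^T))).
  apply: mnullD; apply: mnullD; apply: sand => //.
  - exact: state_lag_average.
  - exact: null_state_measurement.
  - exact: null_measurement_state.
apply/funext => n; apply/funext => o.
have -> : mavg (fun t o => yr (t + m) o *m (yr t o)^T) n o =
  C *m XX n o *m C^T + C *m XV n o *m Dv^T + (Dv *m VX n o *m C^T + Dv *m VV n o *m Dv^T).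
  rewrite /XX /XV /VX /VV -!mavg_mull -!mavg_mulr -!mavgD; congr (mavg _ n o).
  apply/funext => t; apply/funext => o'.
  by rewrite !yrE linearD /= !trmx_mul mulmxDl !mulmxDr !mulmxA.
rewrite /output_lag_covariance !mulmxBr !mulmxBl !mulmxA.
have -> : (if m == 0%N then Dv *m Dv^T else 0) = Dv *m (if m == 0%N then 1%:M else 0) *m Dv^T.
  by case: ifP => _; rewrite ?mulmx1// mulmx0 mul0mx.
move: (C *m XX n o *m C^T) (C *m XV n o *m Dv^T) (Dv *m VX n o *m C^T) (Dv *m VV n o *m Dv^T)
  (C *m A ^+ m *m Sigma *m C^T) (Dv *m _ *m Dv^T) => a b c e f g.
by apply/matrixP => i j; rewrite !mxE; ring.
Qed.

(** The least-squares costs start at t = 1; reindexed from 0, their averages involve y_(t+1). *)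
Lemma output_lag_average_from1 m :
  mnull P (fun n o => mavg (fun t o => yr (t.+1 + m) o *m (yr t.+1 o)^T) n o -
    output_lag_covariance m).
Proof.
apply: (@mnull_avg_shift _ _ _ P _ _ (fun t o => yr (t + m) o *m (yr t o)^T)).
  apply: mbddM; first exact: (mbdd_comp (fun t => (t + m)%N) mbdd_y).
  by apply: mbdd_tr; exact: mbdd_y.
exact: output_lag_average.
Qed.

End SystemAverages.

(** * Inverse moments of block determinants *)

Section MeasurableDeterminant.
Context {d : measure_display} {T : measurableType d} {R : realType}.

Lemma measurable_det n (F : T -> 'M[R]_n) :
  (forall i j, measurable_fun [set: T] (fun o => F o i j)) ->
  measurable_fun [set: T] (fun o => \det (F o)).
Proof.
move=> mF; rewrite /determinant; apply: measurable_sum => s.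
apply: measurable_funM => //; apply: measurable_prod => i _; exact: mF.
Qed.

Lemma measurable_inv_ge0 (f : T -> R) : measurable_fun [set: T] f ->
  (forall o, 0 <= f o) -> measurable_fun [set: T] (fun o => (f o)^-1).
Proof.
move=> mf f0; rewrite (_ : (fun o => _) = (fun o => f o `^ (- 1))).
  have mp : measurable_fun [set: R] (fun x : R => x `^ (- 1)) by exact: measurable_powR.
  exact: (measurableT_comp mp mf).
by apply/funext => o; rewrite powR_inv1.
Qed.

(** Only entries outside row i and column j are constrained: expanding along the last row, this
    keeps the last diagonal entry, which carries the fresh noise, out of the cofactors. *)
Lemma measurable_cofactor n (F : T -> 'M[R]_n) i j :
  (forall i' j', i' != i -> j' != j -> measurable_fun [set: T] (fun o => F o i' j')) ->
  measurable_fun [set: T] (fun o => cofactor (F o) i j).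
Proof.
move=> mF; rewrite /cofactor; apply: measurable_funM => //; apply: measurable_det => k l.
under eq_fun do rewrite !mxE.
by apply: mF; rewrite eq_sym neq_lift.
Qed.

End MeasurableDeterminant.

Section DeterminantMoment.
Context {d : measure_display} {T : measurableType d} {R : realType}.
Variable P : probability T R.
Context {I : eqType}.
Variable X : I -> {RV P >-> R}.
Hypothesis Xn : iid_std_normal X.

(** [normal_inv_sqrt_affine] after freezing all but X k. The weight g carries the earlier blocks, so
    that the estimates can be chained. *)
Lemma noise_affine_inv_sqrt (Q : pred I) k (g : T -> \bar R) (a b : T -> R) :
  ~~ Q k -> dep X Q g -> dep X Q a -> dep X Q b -> (forall o, 0 <= g o)%E ->
  (\int[P]_o (g o * inv_sqrt_abs (a o * X k o + b o)%R) <=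
   9%:E * \int[P]_o (g o * inv_sqrt_abs (a o)))%E.
Proof.
move=> Qk dg da db g0.
pose f (z : R * noise_algebra X Q) : \bar R :=
  (g z.2 * inv_sqrt_abs (a z.2 * z.1 + b z.2)%R)%E.
have mf : measurable_fun setT f.
  apply: emeasurable_funM; first exact: (measurableT_comp dg measurable_snd).
  apply: (measurableT_comp measurable_inv_sqrt_abs); apply: measurable_funD.
    apply: measurable_funM; first exact: (measurableT_comp da measurable_snd).
    exact: measurable_fst.
  exact: (measurableT_comp db measurable_snd).
have f0 z : (0 <= f z)%E by rewrite mule_ge0// inv_sqrt_abs_ge0.
have mg := dep_measurable dg; have ma := dep_measurable da.
have ms : measurable_fun [set: T] (fun o => g o * inv_sqrt_abs (a o))%E.
  by apply: emeasurable_funM => //; exact: (measurableT_comp measurable_inv_sqrt_abs).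
have s0 o : (0 <= g o * inv_sqrt_abs (a o))%E by rewrite mule_ge0// inv_sqrt_abs_ge0.
rewrite -[leLHS]/(\int[P]_o f (X k o, o))%E (noise_fubini Xn Qk mf f0).
rewrite -ge0_integralZl//.
have mF : measurable_fun [set: T] (fun o => \int[std_normal]_x f (x, o))%E.
  apply: (@dep_measurable _ _ _ _ _ X _ _ Q).
  exact: (@measurable_fun_fubini_tonelli_G _ _ _ (noise_algebra X Q) R std_normal f mf f0).
apply: ge0_le_integral => //.
- by move=> o _; apply: integral_ge0.
- exact: emeasurable_funM.
move=> o _; rewrite /f /= ge0_integralZl//; last 2 first.
- by apply: (measurableT_comp measurable_inv_sqrt_abs); apply: measurable_funD.
- by move=> x _; exact: inv_sqrt_abs_ge0.
by rewrite muleCA lee_wpmul2l// normal_inv_sqrt_affine.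
Qed.

Variables (n : nat) (a : nat -> nat -> T -> R) (b : nat -> T -> R) (k : nat -> I).
Variable g : T -> \bar R.
Hypothesis g_ge0 : forall o, (0 <= g o)%E.
Hypothesis dep_g : forall m, (m < n)%N -> dep X (predC1 (k m)) g.
Hypothesis diagE : forall m o, (m < n)%N -> a m m o = X (k m) o + b m o.
Hypothesis dep_b : forall m, (m < n)%N -> dep X (predC1 (k m)) (b m).
Hypothesis dep_a : forall m i j, (m < n)%N -> (i <= m)%N -> (j <= m)%N ->
  (i, j) != (m, m) -> dep X (predC1 (k m)) (a i j).

Definition leading_mx m (o : T) : 'M[R]_m := \matrix_(i, j) a i j o.

(* The newest diagonal noise enters the next leading minor affinely, with the
   previous leading minor as coefficient. *)
Lemma det_leading_mxS m o : (m < n)%N -> \det (leading_mx m.+1 o) =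
  \det (leading_mx m o) * X (k m) o +
  (\det (leading_mx m o) * b m o +
   \sum_(j < m.+1 | j != ord_max)
     a m j o * cofactor (leading_mx m.+1 o) ord_max j).
Proof.
move=> mn; rewrite (expand_det_row _ ord_max) (bigD1 ord_max)//= addrA -mulrDr.
congr (_ + _); last first.
  by apply: eq_bigr => j _; rewrite mxE.
rewrite mxE /= diagE// mulrC; congr (_ * _).
rewrite /cofactor /= exprD -expr2 sqrr_sign mul1r; congr (\det _).
by apply/matrixP => i j; rewrite !mxE !lift_max.
Qed.

Lemma dep_det_leading_mx m : (m < n)%N ->
  dep X (predC1 (k m)) (fun o => \det (leading_mx m o)).
Proof.
move=> mn; apply: measurable_det => i j.
rewrite (_ : (fun o => leading_mx m o i j) = a i j); last first.
  by apply/funext => o; rewrite mxE.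
apply: dep_a => //; try exact: ltnW.
by rewrite xpair_eqE (ltn_eqF (ltn_ord i)).
Qed.

(** Enlarging the minor by one integrates out one diagonal noise, at the cost of a factor 9. *)
Lemma det_leading_mx_moment m : (m <= n)%N ->
  (\int[P]_o (g o * inv_sqrt_abs (\det (leading_mx m o))) <=
   (9 ^+ m)%:E * \int[P]_o g o)%E.
Proof.
elim: m => [|m IH] mn.
  rewrite expr0 mul1e; under eq_integral do rewrite det_mx00.
  rewrite (_ : inv_sqrt_abs 1 = 1%E); last first.
    by rewrite /inv_sqrt_abs oner_eq0 normr1 sqrtr1 invr1.
  by under eq_integral do rewrite mule1.
under eq_integral do rewrite det_leading_mxS//.
apply: (@le_trans _ _ (9%:E * \int[P]_o (g o * inv_sqrt_abs (\det (leading_mx m o))))%E).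
  apply: (@noise_affine_inv_sqrt (predC1 (k m)) (k m)) => //.
  - by rewrite /= eqxx.
  - exact: dep_g.
  - exact: dep_det_leading_mx.
  apply: measurable_funD.
    by apply: measurable_funM; [exact: dep_det_leading_mx|exact: dep_b].
  under eq_fun do rewrite big_mkcond/=.
  apply: measurable_sum => j; case: (boolP (j != ord_max)) => jm; last exact: measurable_cst.
  apply: measurable_funM.
    apply: dep_a => //; first by rewrite -ltnS.
    by rewrite xpair_eqE eqxx /= -[X in _ != X]/(val (@ord_max m)) (inj_eq val_inj).
  apply: measurable_cofactor => i' j' i'm j'j.
  rewrite (_ : (fun o => leading_mx m.+1 o i' j') = a i' j'); last first.
    by apply/funext => o; rewrite mxE.
  apply: dep_a => //; try by rewrite -ltnS.
  by rewrite xpair_eqE -[X in (_ == X) && _]/(val (@ord_max m)) (inj_eq val_inj) (negbTE i'm).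
rewrite exprS EFinM -muleA lee_wpmul2l ?lee_fin//.
by apply: IH; exact: ltnW.
Qed.

End DeterminantMoment.

Section OutputBlocks.
Context {R : realType} {dx dy : nat}.
Variables (A Bw : 'M[R]_dx) (C : 'M[R]_(dy, dx)) (Dv : 'M[R]_dy).
Hypothesis A_stable : spectral_radius A < 1.
Hypothesis Dv_unit : Dv \in unitmx.
Context {d : measure_display} {T : measurableType d}.
Variable P : probability T R.
Variables (w : nat -> 'I_dx -> {RV P >-> R}) (v : nat -> 'I_dy -> {RV P >-> R}).
Hypothesis wv_noise : white_noise2 w v.
Variable j0 : 'I_dy.

Local Notation X := (noise w v).
Let Xn : iid_std_normal X := wv_noise.

(** Normalised so that every coordinate of v_t enters its own coordinate of z_t with coefficient
    1. *)
Definition zr (t : nat) (o : T) : 'cV[R]_dy := invmx Dv *m yr A Bw C Dv w v t o.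

Lemma zrE t o : zr t o = invmx Dv *m C *m xr A Bw w t o + vr v t o.
Proof. by rewrite /zr yrE mulmxDr !mulmxA mulVmx// mul1mx. Qed.

Lemma mbdd_z : mbdd P zr.
Proof. by apply: mbddM; [exact: mbdd_const|exact: mbdd_y]. Qed.

(** Natural-number indices match the array of [leading_mx]; for j < dy, [insubd j0] returns the
    coordinate j itself. *)
Definition zcoord (t j : nat) (o : T) : R := zr t o (insubd j0 j) ord0.

Definition zshift (t j : nat) (o : T) : R :=
  (invmx Dv *m C *m xr A Bw w t o) (insubd j0 j) ord0.

Definition noise_key (t j : nat) : @noise_index dx dy := (t, inr (insubd j0 j)).

Lemma zcoordE t j o : zcoord t j o = X (noise_key t j) o + zshift t j o.
Proof. by rewrite /zcoord zrE mxE addrC [vr _ _ _ _ _]mxE. Qed.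

(** The state is driven by w alone, so freezing everything but one coordinate of v leaves all shifts
    fixed. *)
Lemma dep_zshift (Q : pred (@noise_index dx dy)) t j :
  (forall s e, Q (s, inl e)) -> dep X Q (zshift t j).
Proof.
move=> HQ; rewrite /zshift; set M := invmx Dv *m C.
rewrite (_ : (fun o => _) = (fun o => \sum_k M (insubd j0 j) k * xr A Bw w t o k ord0)).
  apply: measurable_sum => k; apply: measurable_funM; first exact: measurable_cst.
  by apply: dep_state => s e _; exact: HQ.
by apply/funext => o; rewrite mxE.
Qed.

Lemma dep_zcoord (Q : pred (@noise_index dx dy)) t j :
  (forall s e, Q (s, inl e)) -> Q (noise_key t j) -> dep X Q (zcoord t j).
Proof.
move=> HQ Hk; rewrite (_ : zcoord t j = (fun o => X (noise_key t j) o + zshift t j o)).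
  by apply: measurable_funD; [exact: dep_noise|exact: dep_zshift].
by apply/funext => o; rewrite zcoordE.
Qed.

(** The rows are dy consecutive normalised outputs, so the diagonal noises belong to distinct times
    and distinct coordinates. *)
Definition zblock (t : nat) (o : T) : 'M[R]_dy :=
  leading_mx (fun i j => zcoord (t + i) j) dy o.

Lemma zblockE t o i j : zblock t o i j = zr (t + i) o j ord0.
Proof. by rewrite mxE /zcoord valKd. Qed.

Fixpoint block_weight (t B : nat) (o : T) : \bar R :=
  if B is B'.+1 then
    (block_weight t B' o * inv_sqrt_abs (\det (zblock (t + B' * dy) o)))%E
  else 1%E.

Lemma block_weight_ge0 t B o : (0 <= block_weight t B o)%E.
Proof. by elim: B => //= B IH; rewrite mule_ge0// inv_sqrt_abs_ge0. Qed.

Lemma noise_key_neq s i t j : s != t -> noise_key s i != noise_key t j.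
Proof. by move=> st; rewrite /noise_key xpair_eqE (negbTE st). Qed.

Lemma noise_key_inr t j s e : (s, inl e) != noise_key t j.
Proof. by rewrite /noise_key xpair_eqE andbF. Qed.

Lemma dep_block_weight t B s m : (t + B * dy <= s)%N ->
  dep X (predC1 (noise_key s m)) (block_weight t B).
Proof.
elim: B s m => [|B IH] s m Bs /=; first exact: measurable_cst.
have Bs' : (t + B * dy + dy <= s)%N by rewrite -addnA -mulSnr.
apply: emeasurable_funM; first by apply: IH; exact: leq_trans (leq_addr _ _) Bs'.
apply: (measurableT_comp measurable_inv_sqrt_abs).
apply: measurable_det => i j.
rewrite (_ : (fun o => zblock _ o i j) = zcoord (t + B * dy + i) j); last first.
  by apply/funext => o; rewrite mxE.
have ne : noise_key (t + B * dy + i) j != noise_key s m.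
  by apply: noise_key_neq; rewrite ltn_eqF// (leq_trans _ Bs')// ltn_add2l ltn_ord.
by apply: dep_zcoord ne => s' e; exact: noise_key_inr.
Qed.

(** The blocks are dependent through the state, but each new block costs 9^dy with all earlier ones
    frozen, so the constants multiply. *)
Lemma block_weight_moment t B :
  (\int[P]_o block_weight t B o <= (9 ^+ (dy * B))%:E)%E.
Proof.
elim: B => [|B IH] /=; first by rewrite muln0 expr0 integral_constant.
rewrite mulnS exprD EFinM.
apply: le_trans (lee_wpmul2l _ IH); last by rewrite lee_fin exprn_ge0.
apply: (@det_leading_mx_moment _ _ _ P _ X Xn dy
  (fun i j => zcoord (t + B * dy + i) j) (fun m => zshift (t + B * dy + m) m)
  (fun m => noise_key (t + B * dy + m) m) (block_weight t B)) => //.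
- by move=> o; exact: block_weight_ge0.
- by move=> m _; apply: dep_block_weight; rewrite leq_addr.
- by move=> m o _; rewrite zcoordE.
- by move=> m _; apply: dep_zshift => s e; exact: noise_key_inr.
move=> m i j mn im jm ij.
have ne : noise_key (t + B * dy + i) j != noise_key (t + B * dy + m) m; last first.
 by apply: dep_zcoord ne => s e; exact: noise_key_inr.
rewrite /noise_key xpair_eqE eqn_add2l negb_and.
move: ij; rewrite xpair_eqE negb_and; case: (eqVneq i m) => //= _ jm'.
apply: contra_neq jm' => -[] /(congr1 val); rewrite !val_insubd mn.
by rewrite (leq_ltn_trans jm mn).
Qed.

Definition block_det2 (t B : nat) (o : T) : R :=
  \sum_(b < B) \det (zblock (t + b * dy) o) ^+ 2.

Lemma block_det2_ge0 t B o : 0 <= block_det2 t B o.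
Proof. by apply: sumr_ge0 => b _; exact: sqr_ge0. Qed.

(** The hypothesis is q <= |det|^(-1/2) raised to the fourth power; in this polynomial form it also
    makes sense for a zero determinant. *)
Lemma block_weight_ge t B o (q : R) : 0 < q ->
  (forall b, (b < B)%N -> q ^+ 4 * \det (zblock (t + b * dy) o) ^+ 2 <= 1) ->
  ((q ^+ B)%:E <= block_weight t B o)%E.
Proof.
move=> q0; elim: B => [|B IH] H /=; first by rewrite expr0.
rewrite exprSr EFinM; apply: lee_pmul; rewrite ?lee_fin ?exprn_ge0 ?(ltW q0)//.
  by apply: IH => b bB; apply: H; exact: ltnW.
have := H B (ltnSn B); move: (\det _) => y Hy.
rewrite /inv_sqrt_abs; case: eqVneq => [_|y0]; first by rewrite leey.
have ay : 0 < `|y| by rewrite normr_gt0.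
have sy : 0 < Num.sqrt `|y| by rewrite sqrtr_gt0.
rewrite lee_fin -[leRHS]mul1r ler_pdivlMr//.
rewrite -(@ler_pXn2r _ 4) ?nnegrE ?mulr_ge0 ?(ltW sy) ?(ltW q0)// expr1n exprMn.
by rewrite (_ : Num.sqrt `|y| ^+ 4 = y ^+ 2)//; rewrite (exprM _ 2 2) sqr_sqrtr// real_normK ?num_real.
Qed.

Lemma measurable_zcoord t j : measurable_fun [set: T] (zcoord t j).
Proof. exact: (dep_measurable (@dep_zcoord predT t j _ _)). Qed.

Lemma measurable_det_zblock t : measurable_fun [set: T] (fun o => \det (zblock t o)).
Proof.
apply: measurable_det => i j; rewrite (_ : (fun o => _) = zcoord (t + i) j).
  exact: measurable_zcoord.
by apply/funext => o; rewrite mxE.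
Qed.

Lemma measurable_block_weight t B : measurable_fun [set: T] (block_weight t B).
Proof.
elim: B => [|B IH] /=; first exact: measurable_cst.
apply: emeasurable_funM => //; apply: (measurableT_comp measurable_inv_sqrt_abs).
exact: measurable_det_zblock.
Qed.

Lemma measurable_block_det2 t B : measurable_fun [set: T] (block_det2 t B).
Proof.
apply: measurable_sum => b; apply: measurable_funX; exact: measurable_det_zblock.
Qed.

(* Each |det|^-1/2 of the [4 k] blocks dominates D^-1/4, D being the sum of the
   squared determinants. *)
Lemma inverse_block_moment t k : (0 < k)%N ->
  (moment P (fun o => ((block_det2 t (4 * k) o)^-1)%R) k <= (9 ^+ (dy * (4 * k)))%:E)%E.
Proof.
move=> k0; apply: le_trans (block_weight_moment t (4 * k)).
apply: ge0_le_integral => //.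
- apply: measurable_normX; apply: measurable_inv_ge0; last exact: block_det2_ge0.
  exact: measurable_block_det2.
- exact: measurable_block_weight.
move=> o _; have D0 := block_det2_ge0 t (4 * k) o.
rewrite ger0_norm ?invr_ge0//; have [->|Dn0] := eqVneq (block_det2 t (4 * k) o) 0.
  by rewrite invr0 expr0n gtn_eqF//= block_weight_ge0.
have {}D0 : 0 < block_det2 t (4 * k) o by rewrite lt_neqAle eq_sym Dn0.
pose q := Num.sqrt (Num.sqrt (block_det2 t (4 * k) o)^-1).
have q0 : 0 < q by rewrite !sqrtr_gt0 invr_gt0.
have q4 : q ^+ 4 = (block_det2 t (4 * k) o)^-1.
  by rewrite (exprM _ 2 2) !sqr_sqrtr ?sqrtr_ge0// invr_ge0 ltW.
rewrite -q4 -exprM; apply: block_weight_ge => // b bB.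
rewrite q4 mulrC ler_pdivrMr// mul1r /block_det2 (bigD1 (Ordinal bB))//= lerDl.
by apply: sumr_ge0 => ? _; exact: sqr_ge0.
Qed.

(** A weight with finite expectation is finite almost everywhere. Where all determinants vanish,
    [block_weight_ge] holds for every q > 0, so the weight is +oo. *)
Lemma block_det2_gt0_ae t B : (0 < B)%N -> {ae P, forall o, 0 < block_det2 t B o}.
Proof.
move=> B0.
have iW : P.-integrable [set: T] (block_weight t B).
  apply/integrableP; split; first exact: measurable_block_weight.
  under eq_integral do rewrite gee0_abs ?block_weight_ge0//.
  by apply: le_lt_trans (block_weight_moment t B) _; exact: ltry.
have := integrable_ae measurableT iW; apply: filterS => o /(_ Logic.I) Wfin.
rewrite lt_neqAle block_det2_ge0 andbT eq_sym; apply/eqP => D0.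
suff W : block_weight t B o = +oo%E by rewrite W in Wfin.
have det0 b : (b < B)%N -> \det (zblock (t + b * dy) o) = 0.
  move=> bB; apply/eqP; rewrite -sqrf_eq0; apply/eqP.
  move/psumr_eq0P : D0 => /(_ (fun b _ => sqr_ge0 _) (Ordinal bB) isT).
  by [].
apply: eq_infty => r; apply: (@le_trans _ _ ((`|r| + 1) ^+ B)%:E).
  rewrite lee_fin; apply: (@le_trans _ _ (`|r| + 1)).
    by rewrite (le_trans (ler_norm r))// lerDl.
  by case: (B) B0 => // B' _; rewrite exprS ler_peMr ?addr_ge0// exprn_ege1// lerDr.
apply: block_weight_ge; first by rewrite ltr_wpDl.
by move=> b bB; rewrite det0// expr0n mulr0.
Qed.

End OutputBlocks.

(** * Least squares *)

Section FrobeniusForm.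
Context {R : realType}.

Lemma sqnorm_tr {m n} (A : 'M[R]_(m, n)) : sqnorm A = \tr (A *m A^T).
Proof.
apply: eq_bigr => i _; rewrite mxE; apply: eq_bigr => j _.
by rewrite mxE expr2.
Qed.

Lemma sqnorm_ge0 {m n} (A : 'M[R]_(m, n)) : 0 <= sqnorm A.
Proof. by do 2 (apply: sumr_ge0 => ? _); exact: sqr_ge0. Qed.

Lemma sqnorm_entry {m n} (A : 'M[R]_(m, n)) i j : A i j ^+ 2 <= sqnorm A.
Proof.
rewrite /sqnorm (bigD1 i)//= (bigD1 j)//= -addrA lerDl.
by rewrite addr_ge0//; [|apply: sumr_ge0 => ? _]; apply: sumr_ge0 => ? _; exact: sqr_ge0.
Qed.

Lemma sqnorm_trmx {m n} (A : 'M[R]_(m, n)) : sqnorm A^T = sqnorm A.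
Proof.
by rewrite /sqnorm exchange_big /=; do 2 (apply: eq_bigr => ? _); rewrite mxE.
Qed.

Lemma sqnormZ {m n} c (A : 'M[R]_(m, n)) : sqnorm (c *: A) = c ^+ 2 * sqnorm A.
Proof.
rewrite /sqnorm mulr_sumr; apply: eq_bigr => i _; rewrite mulr_sumr.
by apply: eq_bigr => j _; rewrite mxE exprMn.
Qed.

Lemma mxtrace_mul_sum {m n} (A B : 'M[R]_(m, n)) :
  \tr (A *m B^T) = \sum_i \sum_j A i j * B i j.
Proof.
by apply: eq_bigr => i _; rewrite mxE; apply: eq_bigr => j _; rewrite mxE.
Qed.

Lemma mxtrace_form_sym {m n} (A B : 'M[R]_(m, n)) : \tr (A *m B^T) = \tr (B *m A^T).
Proof. by rewrite -mxtrace_tr trmx_mul trmxK. Qed.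

Lemma sqnormB {m n} (A B : 'M[R]_(m, n)) :
  sqnorm (A - B) = sqnorm A - \tr (A *m B^T) *+ 2 + sqnorm B.
Proof.
rewrite !sqnorm_tr linearB /= mulmxBl !mulmxBr !linearB /=.
by rewrite (mxtrace_form_sym B A) mulr2n; ring.
Qed.

(** Lagrange's identity: the defect is half the double sum of the squares (a_i b_j - a_j b_i)^2. *)
Lemma sum_cauchy_schwarz (I : finType) (a b : I -> R) :
  (\sum_i a i * b i) ^+ 2 <= (\sum_i a i ^+ 2) * \sum_i b i ^+ 2.
Proof.
rewrite -subr_ge0.
suff -> : (\sum_i a i ^+ 2) * (\sum_i b i ^+ 2) - (\sum_i a i * b i) ^+ 2 =
    2^-1 * \sum_i \sum_j (a i * b j - a j * b i) ^+ 2.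
  rewrite mulr_ge0 ?invr_ge0//; do 2 (apply: sumr_ge0 => ? _); exact: sqr_ge0.
have -> : \sum_i \sum_j (a i * b j - a j * b i) ^+ 2 =
    \sum_i \sum_j a i ^+ 2 * b j ^+ 2 + \sum_i \sum_j a j ^+ 2 * b i ^+ 2 -
    (\sum_i \sum_j (a i * b i) * (a j * b j)) *+ 2.
  rewrite -big_split -sumrMnl -sumrB; apply: eq_bigr => i _ /=.
  rewrite -big_split -sumrMnl -sumrB; apply: eq_bigr => j _ /=.
  by rewrite mulr2n; ring.
rewrite [X in _ + X - _]exchange_big /= expr2 !big_distrlr /=.
by move: (\sum_i \sum_j a i ^+ 2 * _) (\sum_i \sum_j a i * b i * _) => x y; field.
Qed.

Lemma form_cauchy_schwarz {m n} (A B : 'M[R]_(m, n)) :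
  \tr (A *m B^T) ^+ 2 <= sqnorm A * sqnorm B.
Proof.
rewrite mxtrace_mul_sum /sqnorm !pair_big /=.
exact: (sum_cauchy_schwarz (fun p : 'I_m * 'I_n => A p.1 p.2) (fun p => B p.1 p.2)).
Qed.

Lemma sqnorm_mulmx {m n p} (A : 'M[R]_(m, n)) (B : 'M[R]_(n, p)) :
  sqnorm (A *m B) <= sqnorm A * sqnorm B.
Proof.
rewrite /sqnorm [X in _ * X]exchange_big /= big_distrlr /=.
apply: ler_sum => i _; apply: ler_sum => j _.
rewrite mxE; exact: sum_cauchy_schwarz.
Qed.

Lemma geometric_mean_le (a b x : R) : 0 <= a -> 0 <= b -> 0 <= x -> x ^+ 2 <= a * b ->
  x *+ 2 <= a + b.
Proof.
move=> a0 b0 x0 ab; rewrite -(@ler_pXn2r _ 2) ?nnegrE ?mulrn_wge0 ?addr_ge0//.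
have := sqr_ge0 (a - b); rewrite mulr2n; nra.
Qed.

(** Lets the average of inverse energies over windows stand in for the inverse of the average
    energy. In the induction step each cross term F m * s j + F j * s m is at least 2 x, since the
    product of its two summands is at least x^2. *)
Lemma sum_mul_sum_ge (F s : nat -> R) (x : R) m : 0 <= x ->
  (forall j, 0 <= F j) -> (forall j, 0 <= s j) -> (forall j, x <= F j * s j) ->
  m%:R ^+ 2 * x <= (\sum_(j < m) F j) * \sum_(j < m) s j.
Proof.
move=> x0 F0 s0 xFs; elim: m => [|m IH]; first by rewrite !big_ord0 expr0n !mul0r.
rewrite !big_ord_recr /=.
have cross : (x *+ 2) *+ m <= F m * (\sum_(j < m) s j) + (\sum_(j < m) F j) * s m.
  rewrite mulr_sumr mulr_suml -big_split /= -[X in _ *+ X]card_ord -sumr_const.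
  apply: ler_sum => j _; apply: geometric_mean_le; rewrite ?mulr_ge0//.
  have -> : F m * s j * (F j * s m) = F m * s m * (F j * s j) by ring.
  by rewrite expr2 ler_pM.
have := xFs m; move: IH cross.
move: (\sum_(j < m) F j) (\sum_(j < m) s j) => a b IH cross last.
rewrite -natr1; move: cross; rewrite -mulr_natr -(mulr_natr x 2) => cross.
nra.
Qed.

Lemma sum_blocks (f : nat -> R) B l :
  \sum_(i < B * l) f i = \sum_(b < B) \sum_(i < l) f (b * l + i)%N.
Proof.
elim: B => [|B IH]; first by rewrite !big_ord0.
by rewrite mulSnr big_split_ord /= IH big_ord_recr.
Qed.

End FrobeniusForm.

Section LeastSquares.
Context {R : realType} {p q : nat}.

(** Expanding the squares around Gs, the excess energy of Gh - Gs is bounded by twice its pairing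
    with the residual correlation at Gs. *)
Lemma least_squares_error (Y : nat -> 'cV[R]_p) (y : nat -> 'cV[R]_q)
    (Gs Gh : 'M[R]_(p, q)) n :
  \sum_(t < n) sqnorm (Y t - Gh *m y t) <= \sum_(t < n) sqnorm (Y t - Gs *m y t) ->
  \sum_(t < n) sqnorm ((Gh - Gs) *m y t) <=
  \tr ((\sum_(t < n) (Y t - Gs *m y t) *m (y t)^T) *m (Gh - Gs)^T) *+ 2.
Proof.
have E t : sqnorm (Y t - Gh *m y t) = sqnorm (Y t - Gs *m y t) -
    \tr ((Y t - Gs *m y t) *m (y t)^T *m (Gh - Gs)^T) *+ 2 +
    sqnorm ((Gh - Gs) *m y t).
  rewrite -mulmxA -trmx_mul -sqnormB mulmxBl; congr sqnorm.
  by rewrite opprB addrA subrK.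
rewrite mulmx_suml linear_sum /= -sumrMnl => H.
move: H; rewrite -subr_ge0 -sumrB => H; rewrite -subr_ge0 -sumrB.
apply: le_trans H _; apply: ler_sum => t _; rewrite E.
move: (sqnorm _) (\tr _ *+ 2) (sqnorm _) => a b c; lra.
Qed.

Lemma quadratic_bound (x a : R) : 0 <= a -> 0 <= x -> x ^+ 2 <= a * x -> x <= a.
Proof.
move=> a0; rewrite le_eqVlt => /predU1P[<-//|x0]; by rewrite expr2 ler_pM2r.
Qed.

End LeastSquares.

Section Shift.
Context {d : measure_display} {T : measurableType d} {R : realType}.
Variable P : probability T R.

Lemma null_shift (f : nat -> T -> R) m : (forall n, measurable_fun [set: T] (f n)) ->
  null P (fun n => f (n + m)%N) -> null P f.
Proof.
move=> mf [_ H]; split=> // k e e0; have [N HN] := H k e e0.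
exists (N + m)%N => n Nn; have := HN (n - m)%N; rewrite subnK; last first.
  by rewrite (leq_trans _ Nn) ?leq_addl.
by apply; rewrite leq_subRL ?(leq_trans _ Nn) ?leq_addl// addnC.
Qed.

Lemma bddmom_det {I : Type} n (F : I -> T -> 'M[R]_n) :
  mbdd P F -> bddmom P (fun i o => \det (F i o)).
Proof.
move=> bF; apply: bddmom_sum => s; apply: bddmomM; first exact: bddmom_const.
by apply: bddmom_prod => i; exact: bF.
Qed.

Lemma mbdd_adj {I : Type} n (F : I -> T -> 'M[R]_n) :
  mbdd P F -> mbdd P (fun i o => \adj (F i o)).
Proof.
move=> bF i j.
rewrite (_ : (fun t o => _) = (fun t o => cofactor (F t o) j i)); last first.
  by apply/funext => t; apply/funext => o; rewrite mxE.
rewrite /cofactor; apply: bddmomM; first exact: bddmom_const.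
apply: bddmom_det => k l.
rewrite (_ : (fun t o => _) = (fun t o => F t o (lift j k) (lift i l))); last first.
  by apply/funext => t; apply/funext => o; rewrite !mxE.
exact: bF.
Qed.

Lemma bddmom_sqnorm {I : Type} m n (F : I -> T -> 'M[R]_(m, n)) :
  mbdd P F -> bddmom P (fun i o => sqnorm (F i o)).
Proof.
by move=> bF; do 2 (apply: bddmom_sum => ?); apply: bddmomX; exact: bF.
Qed.

Lemma null_sqnorm m n (F : nat -> T -> 'M[R]_(m, n)) :
  mnull P F -> null P (fun i o => sqnorm (F i o)).
Proof.
move=> bF; apply: null_sum => i; apply: null_sum => j; exact: nullMM.
Qed.
(* The moments of [F] need only be bounded one order at a time, by a bound
   depending on [F] itself: in the application [F] has few inverse moments. *)
Lemma null_of_dominated (f q : nat -> T -> R) :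
  (forall n, measurable_fun [set: T] (f n)) -> null P q ->
  (forall n o, 0 <= q n o) ->
  (forall k, exists (F : nat -> T -> R) (C : R) (n0 : nat), [/\ 0 <= C,
     forall n, measurable_fun [set: T] (F n),
     forall n, (moment P (F n) k.+1 <= C%:E)%E &
     forall n, (n0 <= n)%N -> {ae P, forall o, f n o ^+ 2 <= F n o ^+ 2 * q n o}]) ->
  null P f.
Proof.
move=> mf [mq nq] q0 H; split => // k e e0.
have [F [C [n0 [C0 mF FC fF]]]] := H (k.+1 * 2).-1.
pose dl := e / 2 / (C + 1).
have dl0 : 0 < dl by rewrite !divr_gt0// ltr_wpDl.
have [N HN] := nq k (dl * (e / 2)) (mulr_gt0 dl0 (divr_gt0 e0 (ltr0Sn _ _))).
exists (maxn n0 N) => n; rewrite geq_max => /andP[n0n Nn].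
apply: (@le_trans _ _ (dl^-1 * (dl * (e / 2)) + dl * C)%:E); last first.
  by rewrite lee_fin; exact: half_plus_small.
apply: (moment_le2 (mf n) (mq n) (mF n) _ (ltW dl0) _ (HN n Nn) (FC n)).
  by rewrite invr_ge0 ltW.
apply: filterS (fF n n0n) => o fo.
pose r := Num.sqrt (q n o).
have fr : `|f n o| <= `|F n o| * r.
  rewrite -(@ler_pXn2r _ 2) ?nnegrE ?mulr_ge0 ?sqrtr_ge0//.
  by rewrite exprMn sqr_sqrtr// !real_normK ?num_real.
apply: (@le_trans _ _ ((r * `|F n o|) ^+ k.+1)).
  by rewrite lerXn2r ?nnegrE ?mulr_ge0 ?sqrtr_ge0// mulrC.
rewrite exprMn; apply: le_trans (scaled_amgm dl0 _ _) _; rewrite ?exprn_ge0 ?sqrtr_ge0//.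
by rewrite [r ^+ _ ^+ _]exprAC sqr_sqrtr// (ger0_norm (q0 n o)) -exprM.
Qed.

End Shift.

(** * Lower bounds for the energy of a window of outputs *)

Section BlockRatio.
Context {R : realType} {dx dy : nat}.
Variables (A Bw : 'M[R]_dx) (C : 'M[R]_(dy, dx)) (Dv : 'M[R]_dy).
Hypothesis A_stable : spectral_radius A < 1.
Hypothesis Dv_unit : Dv \in unitmx.
Context {d : measure_display} {T : measurableType d}.
Variable P : probability T R.
Variables (w : nat -> 'I_dx -> {RV P >-> R}) (v : nat -> 'I_dy -> {RV P >-> R}).
Hypothesis wv_noise : white_noise2 w v.
Variable j0 : 'I_dy.
Local Notation z := (zr A Bw C Dv w v).
Local Notation Z := (zblock A Bw C Dv w v j0).
Local Notation det2 := (block_det2 A Bw C Dv w v j0).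

Definition block_adj (B t : nat) (o : T) : R := \sum_(b < B) sqnorm (\adj (Z (t + b * dy) o)).

(** The factor F for one window. The inverse of a block is adj / det; adj is polynomial in the
    outputs and has all moments. Summing numerators and denominators separately keeps one
    denominator D, whose inverse moments improve with B. *)
Definition block_ratio (B t : nat) (o : T) : R := block_adj B t o * (det2 t B o)^-1.

Lemma bddmom_block_adj B : bddmom P (block_adj B).
Proof.
apply: bddmom_sum => b; apply: bddmom_sqnorm; apply: mbdd_adj => i j.
rewrite (_ : (fun t o => _) = (fun t o => z (t + b * dy + i) o j ord0)); last first.
  by apply/funext => t; apply/funext => o; rewrite zblockE.
exact: (bddmom_comp (fun t => (t + b * dy + i)%N) (mbdd_z Bw C Dv A_stable wv_noise j ord0)).
Qed.

Lemma block_adj_ge0 B t o : 0 <= block_adj B t o.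
Proof. by apply: sumr_ge0 => ? _; exact: sqnorm_ge0. Qed.

Lemma block_ratio_ge0 B t o : 0 <= block_ratio B t o.
Proof. by rewrite mulr_ge0 ?block_adj_ge0// invr_ge0 block_det2_ge0. Qed.

Lemma measurable_block_ratio B t : measurable_fun [set: T] (block_ratio B t).
Proof.
apply: measurable_funM; first exact: (proj1 (bddmom_block_adj B)).
apply: measurable_inv_ge0; last exact: block_det2_ge0.
exact: measurable_block_det2.
Qed.

(** AM-GM splits order k+1 of the ratio into order 2(k+1) of the adjugates and of D^-1;
    [inverse_block_moment] provides the latter from 4 * 2(k+1) blocks. *)
Lemma block_ratio_moment k : exists2 c : R, 0 <= c &
  forall t, (moment P (block_ratio (4 * (k.+1 * 2)) t) k.+1 <= c%:E)%E.
Proof.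
have [c c0 Hc] := bddmomP (k.+1 * 2) (bddmom_block_adj (4 * (k.+1 * 2))).
exists (1 * c + 1 * 9 ^+ (dy * (4 * (k.+1 * 2)))).
  by rewrite !mul1r addr_ge0// exprn_ge0.
move=> t; set B := (4 * _)%N.
apply: (moment_le2 (g := block_adj B t) (h := fun o => ((det2 t B o)^-1)%R)
  (l := (k.+1 * 2)%N) (m := (k.+1 * 2)%N)) => //.
- exact: measurable_block_ratio.
- exact: (proj1 (bddmom_block_adj B)).
- apply: measurable_inv_ge0; last exact: block_det2_ge0.
  exact: measurable_block_det2.
- apply: aeW => o; rewrite !mul1r normrM exprMn.
  have := @scaled_amgm _ 1 (`|block_adj B t o| ^+ k.+1) (`|(det2 t B o)^-1| ^+ k.+1).
  by rewrite ltr01 invr1 !mul1r -!exprM; apply; rewrite ?exprn_ge0.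
exact: inverse_block_moment.
Qed.

(** From adj(Z) Z D^T = det(Z) D^T and submultiplicativity of the Frobenius norm. *)
Lemma block_energy p (D : 'M[R]_(p, dy)) t o :
  \det (Z t o) ^+ 2 * sqnorm D <=
  sqnorm (\adj (Z t o)) * \sum_(i < dy) sqnorm (D *m z (t + i) o).
Proof.
have -> : \sum_(i < dy) sqnorm (D *m z (t + i) o) = sqnorm (Z t o *m D^T).
  rewrite [RHS]/sqnorm; apply: eq_bigr => i _; rewrite /sqnorm exchange_big big_ord1.
  apply: eq_bigr => j _; congr (_ ^+ 2); rewrite !mxE; apply: eq_bigr => l _.
  by rewrite zblockE [D^T _ _]mxE mulrC.
rewrite -(sqnorm_trmx D) -sqnormZ -mul_scalar_mx -mul_adj_mx -mulmxA.
exact: sqnorm_mulmx.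
Qed.

Lemma block_ratio_energy p (D : 'M[R]_(p, dy)) B t o : 0 < det2 t B o ->
  sqnorm D <= block_ratio B t o * \sum_(i < B * dy) sqnorm (D *m z (t + i) o).
Proof.
move=> D0; rewrite /block_ratio mulrAC ler_pdivlMr//.
rewrite (sum_blocks (fun i => sqnorm (D *m z (t + i) o))) mulrC /block_det2 mulr_suml.
pose a b := sqnorm (\adj (Z (t + b * dy) o)).
pose s b := \sum_(i < dy) sqnorm (D *m z (t + (b * dy + i)) o).
have s0 b : 0 <= s b by apply: sumr_ge0 => ? _; exact: sqnorm_ge0.
apply: (@le_trans _ _ (\sum_(b < B) a b * s b)).
  apply: ler_sum => b _; apply: le_trans (block_energy _ _ _) _.
  by rewrite /s; under [X in _ <= _ * X]eq_bigr do rewrite addnA.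
rewrite mulr_sumr; apply: ler_sum => b _; rewrite ler_wpM2r//.
rewrite /block_adj (bigD1 b)//= lerDl.
by apply: sumr_ge0 => ? _; exact: sqnorm_ge0.
Qed.

Lemma det2_block_gt0_ae B : (0 < B)%N ->
  {ae P, forall o, forall t, 0 < det2 t B o}.
Proof.
move=> B0; apply: ae_foralln => t; exact: block_det2_gt0_ae.
Qed.

End BlockRatio.

(** Here x is the squared error, F the mean window ratio, s the energy in the m complete windows of
    length L, S the whole energy, b the pairing of error and averaged residual, q the squared
    residual. The chain m^2 x <= m F s <= 2 m F n b <= 4 m^2 L F b gives x <= 4 L F b; squaring and
    b^2 <= q x give the claim. *)
Lemma least_squares_arithmetic {R : realType} (m n L : nat) (x F b q S s : R) :
  (0 < m)%N -> (0 < n)%N -> (n <= 2 * (m * L))%N -> 0 <= x -> 0 <= F -> 0 <= S -> 0 <= q ->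
  m%:R ^+ 2 * x <= m%:R * F * s -> s <= S -> S <= (n%:R * b) *+ 2 -> b ^+ 2 <= q * x ->
  x <= ((4 * L)%:R * F) ^+ 2 * q.
Proof.
move=> m0 n0 nmL x0 F0 S0 q0 H1 H2 H3 H4.
have b0 : 0 <= b.
  by move: (le_trans S0 H3); rewrite pmulrn_lge0// pmulr_rge0// ltr0n.
have xb : x <= (4 * L)%:R * F * b.
  have m20 : 0 < m%:R ^+ 2 :> R by rewrite exprn_gt0// ltr0n.
  rewrite -(ler_pM2l m20); apply: le_trans H1 _.
  apply: (@le_trans _ _ (m%:R * F * ((2 * (m * L))%:R * b *+ 2))).
    rewrite ler_wpM2l ?mulr_ge0//; apply: le_trans H2 _; apply: le_trans H3 _.
    by rewrite lerMn2r /= ler_wpM2r// ler_nat.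
  rewrite !natrM -[X in _ * X]mulr_natr le_eqVlt; apply/predU1P; left; ring.
apply: quadratic_bound => //; first by rewrite mulr_ge0 ?sqr_ge0.
apply: (@le_trans _ _ (((4 * L)%:R * F * b) ^+ 2)).
  by rewrite lerXn2r ?nnegrE// (le_trans x0 xb).
by rewrite exprMn -mulrA ler_wpM2l ?sqr_ge0.
Qed.

Lemma sum_ord_le {R : realType} (f : nat -> R) m n : (forall i, 0 <= f i) -> (m <= n)%N ->
  \sum_(i < m) f i <= \sum_(i < n) f i.
Proof.
move=> f0 mn; rewrite -(subnKC mn) big_split_ord /= lerDl.
by apply: sumr_ge0 => ? _; exact: f0.
Qed.

Section Consistency.
Context {R : realType} {dx dy : nat}.
Variables (A Bw : 'M[R]_dx) (C : 'M[R]_(dy, dx)) (Dv : 'M[R]_dy).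
Hypothesis A_stable : spectral_radius A < 1.
Hypothesis Dv_unit : Dv \in unitmx.
Context {d : measure_display} {T : measurableType d}.
Variable P : probability T R.
Variables (w : nat -> 'I_dx -> {RV P >-> R}) (v : nat -> 'I_dy -> {RV P >-> R}).
Hypothesis wv_noise : white_noise2 w v.
Local Notation y := (yr A Bw C Dv w v).
Local Notation z := (zr A Bw C Dv w v).
Local Notation ratio := (block_ratio A Bw C Dv w v).

(** Passing to D = (Gh - Gs) Dv turns the energies of y into those of z, to which the block
    estimates apply; D Dv^-1 returns Gh - Gs in the pairing. *)
Lemma least_squares_pointwise (j0 : 'I_dy) p (Y : nat -> 'cV[R]_p) (Gs Gh : 'M[R]_(p, dy))
    (B n : nat) (o : T) :
  (0 < B)%N -> (B * dy <= n)%N ->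
  (forall t, 0 < block_det2 A Bw C Dv w v j0 t B o) ->
  \sum_(t < n) sqnorm (Y t - Gh *m y t.+1 o) <=
    \sum_(t < n) sqnorm (Y t - Gs *m y t.+1 o) ->
  sqnorm ((Gh - Gs) *m Dv) <=
  ((4 * (B * dy))%:R * avg (fun m => ratio j0 B (1 + m * (B * dy))) (n %/ (B * dy)) o) ^+ 2 *
  sqnorm (n%:R^-1 *: (\sum_(t < n) (Y t - Gs *m y t.+1 o) *m (y t.+1 o)^T) *m (invmx Dv)^T).
Proof.
move=> B0 Ln det0 LS0.
have LS := @least_squares_error _ _ _ Y (fun t => y t.+1 o) Gs Gh n LS0.
have dy0 : (0 < dy)%N by exact: leq_ltn_trans (leq0n j0) (ltn_ord j0).
set L := (B * dy)%N; have L0 : (0 < L)%N by rewrite muln_gt0 B0.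
have n0 : (0 < n)%N by exact: leq_trans L0 Ln.
set m := (n %/ L)%N; have m0 : (0 < m)%N by rewrite divn_gt0.
set D := (Gh - Gs) *m Dv.
pose f t := sqnorm (D *m z t.+1 o).
have f0 t : 0 <= f t by exact: sqnorm_ge0.
have Dz t : (Gh - Gs) *m y t o = D *m z t o by rewrite /zr mulmxA mulmxK.
pose s (l : nat) := \sum_(i < L) f (l * L + i)%N.
have s0 l : 0 <= s l by apply: sumr_ge0 => ? _; exact: f0.
have m0R : (m%:R : R) != 0 by rewrite pnatr_eq0 -lt0n.
have n0R : (n%:R : R) != 0 by rewrite pnatr_eq0 -lt0n.
apply: (@least_squares_arithmetic _ m n L _ _
  (\tr (n%:R^-1 *: (\sum_(t < n) (Y t - Gs *m y t.+1 o) *m (y t.+1 o)^T) *m (invmx Dv)^T *m D^T))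
  _ (\sum_(t < n) f t) (\sum_(l < m) s l)) => //.
(* The incomplete last window is shorter than L <= m L, so n <= 2 m L. *)
- rewrite mulnA mul2n -addnn mulnDl; have := divn_eq n L; rewrite -/m => nE.
  by rewrite {1}nE leq_add2l (leq_trans (ltnW (ltn_pmod n L0)))// leq_pmull.
- exact: sqnorm_ge0.
- by rewrite mulr_ge0 ?invr_ge0// sumr_ge0// => i _; exact: block_ratio_ge0.
- by rewrite sumr_ge0.
- exact: sqnorm_ge0.
- rewrite /avg mulVKf//; apply: (@sum_mul_sum_ge _ (fun l => ratio j0 B (1 + l * L) o) s) => //.
    exact: sqnorm_ge0.
    by move=> j; exact: block_ratio_ge0.
  move=> l; rewrite /s /f.
  rewrite (_ : \sum_(i < L) _ = \sum_(i < B * dy) sqnorm (D *m z (1 + l * L + i) o)) //.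
  exact: block_ratio_energy.
- by rewrite /s -(sum_blocks f); apply: (@sum_ord_le _ f) => //; exact: leq_trunc_div.
- rewrite /f; under eq_bigr do rewrite -Dz.
  apply: le_trans LS _; rewrite -mulmxA -trmx_mul mulmxK//.
  by rewrite -scalemxAl linearZ /= mulVKf.
exact: form_cauchy_schwarz.
Qed.

(** The estimator is fixed while the dominating factor is chosen anew for each moment order, as
    [null_of_dominated] allows. *)
Theorem least_squares_consistent p (Y : nat -> T -> 'cV[R]_p) (Gs : 'M[R]_(p, dy))
    (G : nat -> T -> 'M[R]_(p, dy)) N0 :
  (forall n i j, measurable_fun [set: T] (fun o => G n o i j)) ->
  mnull P (mavg (fun t o => (Y t o - Gs *m y t.+1 o) *m (y t.+1 o)^T)) ->
  (forall n, (N0 <= n)%N -> {ae P, forall o,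
    \sum_(t < n) sqnorm (Y t o - G n o *m y t.+1 o) <=
    \sum_(t < n) sqnorm (Y t o - Gs *m y t.+1 o)}) ->
  mnull P (fun n o => G n o - Gs).
Proof.
move=> mG nE argG.
suff nD : mnull P (fun n o => (G n o - Gs) *m Dv).
  rewrite (_ : (fun n o => _) = (fun n o => ((G n o - Gs) *m Dv) *m invmx Dv)).
    exact: mnullMr nD (mbdd_const P (invmx Dv)).
  by apply/funext => n; apply/funext => o; rewrite mulmxK.
move=> i j.
have nq := null_sqnorm (mnullMr nE (mbdd_const P (invmx Dv)^T)).
apply: null_of_dominated nq _ _.
- move=> n; rewrite (_ : (fun o => _) =
    (fun o => \sum_l (G n o i l - Gs i l) * Dv l j)); last first.
    by apply/funext => o; rewrite mxE; apply: eq_bigr => l _; rewrite !mxE.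
  apply: measurable_sum => l; apply: measurable_funM => //.
  by apply: measurable_funB => //; exact: mG.
- by move=> n o; exact: sqnorm_ge0.
(* The window length L depends on k, and the domination starts once n >= L, when there is a complete
   window. *)
move=> k; have [c c0 Hc] := block_ratio_moment Bw C A_stable Dv_unit wv_noise j k.
move: Hc; set B := (4 * (k.+1 * 2))%N => Hc; pose L := (B * dy)%N.
pose F n (o : T) : R := avg (fun m => ratio j B (1 + m * L)) (n %/ L) o.
have mF n : measurable_fun [set: T] (F n).
  by apply: measurable_avg => m; exact: measurable_block_ratio.
have FC n : (moment P (F n) k.+1 <= c%:E)%E.
  apply: (@moment_avg_le _ _ _ P (fun m => ratio j B (1 + m * L)) k c _ c0) => m.
    exact: measurable_block_ratio.
  exact: Hc.
exists (fun n o => (4 * L)%:R * F n o).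
exists ((4 * L)%:R ^+ k.+1 * c + 0 * c), (maxn N0 L); split.
- by rewrite mul0r addr0 mulr_ge0// exprn_ge0.
- by move=> n; apply: measurable_funM.
- move=> n; apply: (moment_le2 _ (mF n) (mF n) _ (lexx 0) _ (FC n) (FC n)) => //.
  + exact: measurable_funM.
  + by apply: aeW => o; rewrite mul0r addr0 normrM exprMn ger0_norm.
move=> n; rewrite geq_max => /andP[N0n Ln].
have B0 : (0 < B)%N by [].
have detB : {ae P, forall o, forall t, 0 < block_det2 A Bw C Dv w v j t B o}.
  exact: det2_block_gt0_ae.
apply: filterS2 (argG n N0n) detB => o H1 H2.
apply: le_trans (sqnorm_entry _ i j) _.
exact: (@least_squares_pointwise j p (fun t => Y t o) Gs (G n o) B n o).
Qed.

End Consistency.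

(** * Stationary covariance *)

Section GaussianCovariance.
Context {d : measure_display} {T : measurableType d} {R : realType}.
Variable P : probability T R.

(** Fubini is available for nonnegative functions, so the positive and negative parts of X Y are
    treated apart; the symmetry x to -x of the normal law exchanges them, and integrability allows
    the subtraction. *)
Lemma independent_normal_product (X Y : {RV P >-> R}) :
  (forall U B : set R, measurable U -> measurable B ->
     P (X @^-1` U `&` Y @^-1` B) = (std_normal U * P (Y @^-1` B))%E) ->
  P.-integrable [set: T] (fun o => (X o * Y o)%:E) ->
  (\int[P]_o (X o * Y o)%:E = 0)%E.
Proof.
move=> XY iXY.
pose f (z : R * R) : \bar R := (Num.max (z.1 * z.2) 0)%:E.
pose g (z : R * R) : \bar R := (Num.max (- (z.1 * z.2)) 0)%:E.
have mf : measurable_fun [set: R * R] f.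
  apply/measurable_EFinP; apply: measurable_maxr => //.
  by apply: measurable_funM; [exact: measurable_fst|exact: measurable_snd].
have mg : measurable_fun [set: R * R] g.
  apply/measurable_EFinP; apply: measurable_maxr => //.
  apply: measurable_funN.
  by apply: measurable_funM; [exact: measurable_fst|exact: measurable_snd].
have f0 z : (0 <= f z)%E by rewrite lee_fin le_max lexx orbT.
have g0 z : (0 <= g z)%E by rewrite lee_fin le_max lexx orbT.
have fg : (\int[P]_o f (X o, Y o) = \int[P]_o g (X o, Y o))%E.
  rewrite (independent_fubini XY mf f0) (independent_fubini XY mg g0).
  apply: eq_integral => o _.
  rewrite -(@normal_symmetric R (fun x => g (x, Y o))) //; last first.
    by apply: measurableT_comp => //; exact: measurable_pair2.
  by apply: eq_integral => x _; rewrite /f /g /= mulNr opprK.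
have fin := integrable_fin_num measurableT iXY.
have E : (\int[P]_o (X o * Y o)%:E =
    \int[P]_o f (X o, Y o) - \int[P]_o f (X o, Y o))%E.
  rewrite {2}fg integralE; congr (_ - _)%E; apply: eq_integral => o _.
    by rewrite funeposE /f EFin_max.
  by rewrite funenegE /g EFin_max.
rewrite E; apply: subee; move: fin; rewrite E.
by case: (\int[P]_o f _)%E.
Qed.

Lemma Lfun2_integrableM (X Y : T -> R) : X \in Lfun P 2%:E -> Y \in Lfun P 2%:E ->
  P.-integrable [set: T] (fun o => (X o * Y o)%:E).
Proof. by move=> X2 Y2; apply/Lfun1_integrable; exact: Lfun2_mul_Lfun1. Qed.

Lemma Lfun2_Lfun1 (X : T -> R) : X \in Lfun P 2%:E -> X \in Lfun P 1.
Proof. by apply: Lfun_subset12; exact: fin_num_measure. Qed.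

Lemma independent_normal_covariance (X Y : {RV P >-> R}) :
  (forall U B : set R, measurable U -> measurable B ->
     P (X @^-1` U `&` Y @^-1` B) = (std_normal U * P (Y @^-1` B))%E) ->
  (X : T -> R) \in Lfun P 2%:E -> (Y : T -> R) \in Lfun P 2%:E ->
  ('E_P[X] = 0)%E -> covariance P X Y = 0%E.
Proof.
move=> XY X2 Y2 EX; rewrite (covarianceE (Lfun2_Lfun1 X2) (Lfun2_Lfun1 Y2) (Lfun2_mul_Lfun1 X2 Y2)).
rewrite EX mul0e sube0 unlock; apply: independent_normal_product => //.
exact: Lfun2_integrableM.
Qed.

Lemma covariance_linear_l {I : Type} (r : seq I) (c : I -> R) (X : I -> T -> R) :
  (forall i, X i \in Lfun P 2%:E) ->
  (fun o => \sum_(i <- r) c i * X i o) \in Lfun P 2%:E /\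
  forall Y, Y \in Lfun P 2%:E ->
    covariance P (fun o => \sum_(i <- r) c i * X i o) Y =
    (\sum_(i <- r) (c i)%:E * covariance P (X i) Y)%E.
Proof.
move=> X2; elim: r => [|i r [IH1 IH2]].
  have -> : (fun o => \sum_(i <- [::]) c i * X i o) = cst 0.
    by apply/funext => o; rewrite big_nil.
  by split=> [|Y Y2]; [exact: Lfun_cst|rewrite big_nil covariance_cst_l].
have -> : (fun o => \sum_(j <- i :: r) c j * X j o) =
    (c i \o* X i) \+ (fun o => \sum_(j <- r) c j * X j o).
  by apply/funext => o; rewrite big_cons /= mulrC.
have cX : c i \o* X i \in Lfun P 2%:E by apply: Lfun_scale => //; rewrite ler1n.
split=> [|Y Y2].
  have [_ H] := @Lfun_addr_closed _ _ _ P 2%:E (ltac:(by rewrite lee_fin ler1n)).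
  exact: H.
by rewrite covarianceDl// IH2// big_cons (covarianceZl _ (Lfun2_Lfun1 (X2 i)) (Lfun2_Lfun1 Y2) (Lfun2_mul_Lfun1 (X2 i) Y2)).
Qed.

Lemma covariance_bilinear {I : finType} (a b : I -> R) (X : I -> T -> R) (V : I -> I -> R) :
  (forall i, X i \in Lfun P 2%:E) -> (forall i j, covariance P (X i) (X j) = (V i j)%:E) ->
  covariance P (fun o => \sum_i a i * X i o) (fun o => \sum_i b i * X i o) =
  (\sum_i \sum_j a i * b j * V i j)%:E.
Proof.
move=> X2 XV; have [bX2 bcov] := covariance_linear_l (index_enum I) b X2.
have [_ ->//] := covariance_linear_l (index_enum I) a X2.
rewrite -sumEFin; apply: eq_bigr => i _.
rewrite covarianceC bcov// -sumEFin.
under eq_bigr do rewrite covarianceC XV -EFinM.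
rewrite !sumEFin -EFinM mulr_sumr; congr EFin.
by apply: eq_bigr => j _; rewrite mulrA.
Qed.

End GaussianCovariance.

Lemma bigcap_pair {T : Type} {I : eqType} (F : I -> set T) a b :
  \bigcap_(i in [set` [:: a; b]]) F i = F a `&` F b.
Proof.
apply/seteqP; split => [x H|x [Fa Fb] i]; last by rewrite /= !inE => /orP[]/eqP->.
by split; apply: H; rewrite /= !inE eqxx ?orbT.
Qed.

Lemma white_noise_law {d : measure_display} {T : measurableType d} {R : realType}
    (P : probability T R) {I : eqType} (X : I -> {RV P >-> R}) k :
  iid_std_normal X -> [/\ (X k : T -> R) \in Lfun P 2%:E, ('E_P[X k] = 0)%E &
    covariance P (X k) (X k) = 1%:E].
Proof.
move=> Xn; have bX := @bddmom_noise _ _ _ P _ X Xn unit (fun=> k).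
have iX := bddmom_integrable tt bX.
have iX2 := bddmom_integrable tt (bddmomM bX bX).
have Xlaw : forall A, measurable A -> distribution P (X k) A = (std_normal : probability R R) A.
  by move=> A mA; rewrite std_normalE; exact: (proj1 Xn).
have X2 : (X k : T -> R) \in Lfun P 2%:E.
  rewrite inE; apply/andP; split; rewrite inE/=; first exact: measurable_funPT.
  rewrite /finite_norm unlock /Lnorm poweR_lty//.
  rewrite (eq_integral (fun o => (X k o * X k o)%:E)); first exact: integrable_lty measurableT _ iX2.
  by move=> o _; rewrite /= powR_mulrn// real_normK ?num_real// expr2.
have EX : ('E_P[X k] = 0)%E.
  rewrite unlock -(@normal_mean R).
  rewrite -(@integral_distribution _ _ _ _ _ P (X k) (fun x => x%:E)) //; last exact: EFin_measurable.
  by apply: eq_measure_integral => A mA _; exact: Xlaw.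
split => //.
rewrite (covarianceE (Lfun2_Lfun1 X2) (Lfun2_Lfun1 X2) (Lfun2_mul_Lfun1 X2 X2)).
rewrite EX mule0 sube0 unlock.
have := @moment_noise _ _ _ P _ X Xn k 2.
rewrite /moment; under eq_integral do rewrite real_normK ?num_real//.
under [X in _ = X -> _]eq_integral do rewrite real_normK ?num_real//.
rewrite normal_second_moment => <-.
by apply: eq_integral => o _; rewrite expr2.
Qed.

(** Compares the covariances of z_1 and z_0: z_1 is linear in the joint family (z_0, e_0), whose
    covariance is block diagonal with blocks Sigma and the identity. *)
Theorem stationary_covariance_lyapunov {R : realType} {n m : nat}
    (A : 'M[R]_n) (B : 'M[R]_(n, m)) (Sigma : 'M[R]_n) :
  is_stationary_covariance A B Sigma -> Sigma = A *m Sigma *m A^T + B *m B^T.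
Proof.
move=> [d [T [P [z [e [en ind zS z2 zcov]]]]]].
pose U (k : 'I_n + 'I_m) : {RV P >-> R} :=
  match k with inl i => z 0%N i | inr l => e 0%N l end.
pose V (k l : 'I_n + 'I_m) : R :=
  match k, l with inl i, inl j => Sigma i j | inr i, inr j => (i == j)%:R | _, _ => 0 end.
pose c (i : 'I_n) (k : 'I_n + 'I_m) : R :=
  match k with inl j => A i j | inr l => B i l end.
have elaw l := white_noise_law (0%N, l) en.
have e2 l : (e 0%N l : T -> R) \in Lfun P 2%:E by have [] := elaw l.
have U2 k : (U k : T -> R) \in Lfun P 2%:E by case: k => [i|l]; [exact: z2|exact: e2].
have ez l i : covariance P (e 0%N l) (z 0%N i) = 0%E.
  have [_ Ee _] := elaw l; apply: independent_normal_covariance => // X Y mX mY.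
  have := ind [:: i] [:: (0%N, l)] (fun=> Y) (fun=> X) (fun=> mY) (fun=> mX).
  rewrite !set_cons1 !bigcap_set1 /= setIC => ->; rewrite muleC; congr (_ * _)%E.
  by rewrite std_normalE; exact: (proj1 en (0%N, l)).
have ee k l : k != l -> covariance P (e 0%N k) (e 0%N l) = 0%E.
  move=> kl; have [_ Ee _] := elaw k; apply: independent_normal_covariance => // X Y mX mY.
  have mXY (i : nat * 'I_m) : measurable (if i.2 == k then X else Y) by case: ifP.
  have := proj2 en [:: (0%N, k); (0%N, l)] (fun i => if i.2 == k then X else Y) _ mXY.
  rewrite /= inE xpair_eqE eqxx /= kl => /(_ isT).
  rewrite bigcap_pair /= eqxx eq_sym (negbTE kl) => ->.
  rewrite !big_cons big_nil /= eqxx [l == k]eq_sym (negbTE kl) mule1; congr (_ * _)%E.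
  by rewrite std_normalE; exact: (proj1 en (0%N, k)).
have UV k l : covariance P (U k) (U l) = (V k l)%:E.
  case: k l => [i|k] [j|l] //=; first by rewrite covarianceC ez.
  by case: (eqVneq k l) => [->|/ee//]; have [] := elaw l.
have zE i : (z 1%N i : T -> R) = (fun o => \sum_k c i k * U k o).
  apply/funext => o; have := zS 0%N o => /(congr1 (fun M : 'cV_n => M i ord0)).
  rewrite !mxE => ->; rewrite big_sumType /=.
  by congr (_ + _); apply: eq_bigr => k _; rewrite mxE.
apply/matrixP => i j.
have := covariance_bilinear (c i) (c j) U2 UV.
rewrite -!zE zcov => -[->].
rewrite big_sumType /= !mxE; congr (_ + _).
  transitivity (\sum_k \sum_l A i k * A j l * Sigma k l).
    apply: eq_bigr => k _; rewrite big_sumType /= [X in _ + X]big1 ?addr0// => l _.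
    by rewrite mulr0.
  rewrite exchange_big; apply: eq_bigr => l _; rewrite mxE mxE mulr_suml.
  by apply: eq_bigr => k _; rewrite mulrAC.
apply: eq_bigr => k _; rewrite big_sumType /= big1 ?add0r => [|l _]; last by rewrite mulr0.
rewrite (bigD1 k)//= eqxx mulr1 big1 ?addr0 ?mxE// => l lk.
by rewrite eq_sym (negbTE lk) mulr0.
Qed.

(** * Loss *)

Section NullMatrices.
Context {d : measure_display} {T : measurableType d} {R : realType}.
Variable P : probability T R.

Lemma mnullMM {m n p : nat} (F : nat -> T -> 'M[R]_(m, n)) (G : nat -> T -> 'M[R]_(n, p)) :
  mnull P F -> mnull P G -> mnull P (fun t o => F t o *m G t o).
Proof.
move=> nF nG i j; rewrite (_ : (fun t o => _) =
    (fun t o => \sum_k F t o i k * G t o k j)); last first.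
  by apply/funext => t; apply/funext => o; rewrite mxE.
by apply: null_sum => k; exact: nullMM.
Qed.

Lemma null_mxtrace {n : nat} (F : nat -> T -> 'M[R]_n) :
  mnull P F -> null P (fun t o => \tr (F t o)).
Proof. by move=> nF; apply: null_sum => i; exact: nF. Qed.

(** The telescoping keeps a product of two null factors, since F itself need not have bounded
    moments for small t. *)
Lemma mnull_power {n : nat} (F : nat -> T -> 'M[R]_n) (M : 'M[R]_n) k :
  mnull P (fun t o => F t o - M) -> mnull P (fun t o => F t o ^+ k - M ^+ k).
Proof.
move=> nF; elim: k => [|k IH].
  rewrite (_ : (fun t o => _) = (fun _ _ => 0)).
    move=> i j; rewrite (_ : (fun t o => _) = (fun _ _ => 0)); first exact: null0.
    by apply/funext => t; apply/funext => o; rewrite mxE.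
  by apply/funext => t; apply/funext => o; rewrite subrr.
rewrite (_ : (fun t o => _) = (fun t o => (F t o - M) *m (F t o ^+ k - M ^+ k) +
    ((F t o - M) *m M ^+ k + M *m (F t o ^+ k - M ^+ k)))).
  apply: mnullD; first exact: mnullMM.
  by apply: mnullD; [apply: mnullMr => //|apply: mnullMl => //]; exact: mbdd_const.
apply/funext => t; apply/funext => o; rewrite !exprS -!mulmxE addrA.
by rewrite -mulmxDr subrK mulmxBl mulmxBr addrA subrK.
Qed.

Lemma mnull_ext {m n : nat} (F G : nat -> T -> 'M[R]_(m, n)) :
  (forall t o, F t o = G t o) -> mnull P F -> mnull P G.
Proof. by move=> FG; suff -> : F = G by []; apply/funext => t; apply/funext => o. Qed.

Lemma null_ext (f g : nat -> T -> R) :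
  (forall t o, f t o = g t o) -> null P f -> null P g.
Proof. by move=> fg; suff -> : f = g by []; apply/funext => t; apply/funext => o. Qed.

(** Integrability of f n is only eventual: it comes from the first moment of f n - c being at most 1
    for large n. *)
Lemma expectation_cvg (f : nat -> T -> R) c : null P (fun n o => f n o - c) ->
  (\int[P]_o (f n o)%:E)%E @[n --> \oo] --> c%:E.
Proof.
move=> nf; have [mf Hf] := nf; have [N HN] := Hf 0%N 1 ltr01.
have lim0 : (c%:E + \int[P]_o (f n o - c)%:E)%E @[n --> \oo] --> (c%:E + 0)%E.
  apply: cvgeD => //; first exact: cvg_cst.
  exact: null_expectation.
rewrite adde0 in lim0; apply: cvg_trans lim0; apply: near_eq_cvg.
near=> n.
have Nn : (N <= n)%N by near: n; exists N.
rewrite -[in LHS](integral_constant P c) -integralD//.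
- by apply: eq_integral => o _; rewrite -EFinD addrC subrK.
- exact: (bddmom_integrable tt (@bddmom_const _ _ _ P unit c)).
apply/integrableP; split; first by apply/measurable_EFinP; exact: mf.
apply: le_lt_trans (ltry 1); apply: le_trans (HN n Nn).
by rewrite /moment; under [leRHS]eq_integral do rewrite expr1.
Unshelve. all: by end_near. Qed.

End NullMatrices.

Section Averages.
Context {R : realType} {dx dy : nat} (H : nat).
Variables (A Bw : 'M[R]_dx) (C : 'M[R]_(dy, dx)) (Dv : 'M[R]_dy).
Hypothesis A_stable : spectral_radius A < 1.
Context {d : measure_display} {T : measurableType d}.
Variable P : probability T R.
Variables (w : nat -> 'I_dx -> {RV P >-> R}) (v : nat -> 'I_dy -> {RV P >-> R}).
Hypothesis wv_noise : white_noise2 w v.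
Variable Sigma : 'M[R]_dx.
Hypothesis Sigma_lyapunov : Sigma = A *m Sigma *m A^T + Bw *m Bw^T.
Local Notation y := (yr A Bw C Dv w v).
Local Notation Gam := (output_lag_covariance A C Dv Sigma).
Let fut (t : nat) (o : T) := future H (random_output A Bw C Dv w v o) t.

Definition future_covariance : 'M[R]_(\sum_(i < H) dy, dy) := \mxcol_(i < H) Gam i.+1.

Definition loss_form (G : 'M[R]_(\sum_(i < H) dy, dy)) : R :=
  \tr (Gam 0%N) *+ H - \tr (future_covariance *m G^T) *+ 2 + \tr (G *m Gam 0%N *m G^T).

Lemma future_entry t o k j : fut t o k j = y (t + (tagnat.sig1 k).+1) o (tagnat.sig2 k) j.
Proof. by rewrite mxE. Qed.

Lemma mbdd_future : mbdd P fut.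
Proof.
move=> k j; rewrite (_ : (fun t o => _) = (fun t o => y (t + (tagnat.sig1 k).+1) o (tagnat.sig2 k) j)).
  exact: (bddmom_comp (fun t => (t + (tagnat.sig1 k).+1)%N) (mbdd_y Bw C Dv A_stable wv_noise _ _)).
by apply/funext => t; apply/funext => o; rewrite future_entry.
Qed.

(** The time change s is the identity for the loss and the successor for the least-squares cost. *)
Lemma mnull_stack (s : nat -> nat) :
  (forall m, mnull P (fun n o => mavg (fun t o => y (s t + m) o *m (y (s t) o)^T) n o - Gam m)) ->
  mnull P (fun n o => mavg (fun t o => fut (s t) o *m (y (s t) o)^T) n o - future_covariance).
Proof.
move=> lag k j; have := lag (tagnat.sig1 k).+1 (tagnat.sig2 k) j; apply: null_ext => n o.
rewrite mxE [RHS]mxE; congr (_ + _); last by rewrite !mxE.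
rewrite (congr1 (fun h => h n o) (mavgE _ _ _)) [RHS](congr1 (fun h => h n o) (mavgE _ _ _)).
congr (_ * _); apply: eq_bigr => t _.
by rewrite !colM_trE future_entry.
Qed.

Lemma output_square_average m :
  mnull P (fun n o => mavg (fun t o => y (t + m) o *m (y (t + m) o)^T) n o - Gam 0%N).
Proof.
elim: m => [|m IH].
  have := output_lag_average C Dv A_stable wv_noise Sigma_lyapunov 0.
  by apply: mnull_ext => n o; congr (mavg _ n o - _); apply/funext => t; rewrite addn0.
have by_ := mbdd_comp (fun t => (t + m)%N) (mbdd_y Bw C Dv A_stable wv_noise).
apply: mnull_ext (mnull_avg_shift (mbddM by_ (mbdd_tr by_)) IH) => n o.
by congr (mavg _ n o - _); apply/funext => t; rewrite addSnnS.
Qed.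

Lemma sqnorm_future t o : sqnorm (fut t o) =
  \sum_(i < H) \tr (y (t + i.+1) o *m (y (t + i.+1) o)^T).
Proof.
rewrite sqnorm_tr /fut /future tr_mxcol mul_mxcol_mxrow mxtrace_mxblock.
by apply: eq_bigr.
Qed.

Lemma prediction_error_average G :
  null P (fun n o => avg (fun t o => sqnorm (fut t o - G *m y t o)) n o - loss_form G).
Proof.
pose a i n o := mavg (fun t o => y (t + i) o *m (y (t + i) o)^T) n o.
pose b n o := mavg (fun t o => fut t o *m (y t o)^T) n o.
have nb : mnull P (fun n o => b n o - future_covariance).
  exact: (@mnull_stack id (output_lag_average C Dv A_stable wv_noise Sigma_lyapunov)).
have nf : null P (fun n o => \sum_(i < H) \tr (a i.+1 n o - Gam 0%N) +
    ((-2) * \tr ((b n o - future_covariance) *m G^T) +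
     \tr (G *m (a 0%N n o - Gam 0%N) *m G^T))).
  apply: nullD.
    by apply: null_sum => i; apply: null_mxtrace; exact: output_square_average.
  apply: nullD; first apply: nullZ; apply: null_mxtrace.
    by apply: mnullMr => //; exact: mbdd_const.
  apply: mnullMr; last exact: mbdd_const.
  by apply: mnullMl; [exact: mbdd_const|exact: output_square_average].
apply: null_ext nf => n o.
have -> : avg (fun t o => sqnorm (fut t o - G *m y t o)) n o =
    \sum_(i < H) \tr (a i.+1 n o) + ((-2) * \tr (b n o *m G^T) + \tr (G *m a 0%N n o *m G^T)).
  rewrite /avg /a /b /mavg.
  under [in LHS]eq_bigr => t _ do rewrite sqnormB sqnorm_future trmx_mul mulmxA.
  rewrite big_split sumrB /= mulrDr mulrBr -addrA; congr (_ + (_ + _)).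
  - rewrite exchange_big mulr_sumr; apply: eq_bigr => i _.
    by rewrite linearZ /= linear_sum.
  - have -> : \tr (n%:R^-1 *: (\sum_(t < n) fut t o *m (y t o)^T) *m G^T) =
        n%:R^-1 * \sum_(t < n) \tr (fut t o *m (y t o)^T *m G^T).
      by rewrite -scalemxAl linearZ /= mulmx_suml linear_sum.
    rewrite -mulrN -sumrN !mulr_sumr; apply: eq_bigr => t _; rewrite mulr2n; ring.
  rewrite -scalemxAr -scalemxAl [RHS]linearZ /= mulmx_sumr mulmx_suml linear_sum /=.
  congr (_ * _); apply: eq_bigr => t _.
  by rewrite sqnorm_tr trmx_mul !mulmxA addn0.
rewrite /loss_form; under eq_bigr do rewrite linearB /=.
rewrite sumrB sumr_const card_ord mulmxBl linearB /= mulmxBr mulmxBl linearB /=.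
by rewrite -(mulr_natl _ 2); ring.
Qed.

Lemma mean_loss_cvg G :
  mean_loss P (random_output A Bw C Dv w v) H G n @[n --> \oo] --> (loss_form G)%:E.
Proof.
pose g t o := sqnorm (fut t o - G *m y t o).
have bg : bddmom P g.
  apply: bddmom_sqnorm; apply: mbddD; first exact: mbdd_future.
  rewrite (_ : (fun t o => _) = (fun t o => (- G) *m y t o)).
    by apply: mbddM; [exact: mbdd_const|exact: mbdd_y].
  by apply/funext => t; apply/funext => o; rewrite mulNmx.
(* The mean loss has n + 1 terms, t = 0, ..., n, divided by n; the last term over n is null by
   itself. *)
have := nullD (prediction_error_average G) (nullM (null_invn P) bg).
move=> /(null_ext (g := fun n o => (avg g n o + n%:R^-1 * g n o) - loss_form G)) nf.
have {nf} := expectation_cvg (nf _); rewrite /mean_loss expectation.unlock => lim.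
have {}lim := lim (fun t o => addrAC _ _ _).
apply: cvg_trans lim.
apply: near_eq_cvg; apply: nearW => n; apply: eq_integral => o _.
by rewrite /avg -mulrDr big_mkord big_ord_recr.
Qed.

Lemma loss_formE G : loss P (random_output A Bw C Dv w v) H G = (loss_form G)%:E.
Proof. by rewrite /loss; apply: cvg_lim => //; exact: mean_loss_cvg. Qed.

End Averages.

Section PositiveForms.
Context {R : realType}.

Lemma posdefmx_unit n (M : 'M[R]_n) : posdefmx M -> M \in unitmx.
Proof.
move=> [_ Mpos]; rewrite -row_free_unit -kermx_eq0; apply/negPn/negP => K0.
pose u := (nz_row (kermx M))^T.
have u0 : u != 0 by rewrite trmx_eq0 nz_row_eq0.
have /sub_kermxP uM : (nz_row (kermx M) <= kermx M)%MS by exact: nz_row_sub.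
by have := Mpos u u0; rewrite trmxK uM mul0mx mxE ltxx.
Qed.

Lemma mxtrace_form_ge0 p n (Q : 'M[R]_n) (G : 'M[R]_(p, n)) :
  (forall u : 'cV[R]_n, 0 <= (u^T *m Q *m u) ord0 ord0) -> 0 <= \tr (G *m Q *m G^T).
Proof.
move=> Q0; apply: sumr_ge0 => i _; have := Q0 (row i G)^T.
rewrite trmxK; congr (0 <= _).
by rewrite -row_mul mxE [RHS]mxE; apply: eq_bigr => j _; rewrite !mxE.
Qed.

Lemma lyapunov_sym n (A X Q : 'M[R]_n) : spectral_radius A < 1 ->
  Q^T = Q -> X = A *m X *m A^T + Q -> X^T = X.
Proof.
move=> A_stable Qs XE.
have XtE : X^T = A *m X^T *m A^T + Q.
  by rewrite {1}XE linearD /= Qs !trmx_mul trmxK mulmxA.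
apply/eqP; rewrite -subr_eq0; apply/eqP; apply: (lyapunov_unique A_stable).
have {1}-> : X^T - X = (A *m X^T *m A^T + Q) - (A *m X *m A^T + Q) by rewrite -XtE -XE.
by rewrite mulmxBr mulmxBl opprD addrACA subrr addr0.
Qed.

Lemma quadratic_difference p n (c : R) (F X Y : 'M[R]_(p, n)) (S : 'M[R]_n) :
  (c - \tr (F *m X^T) *+ 2 + \tr (X *m S *m X^T)) -
  (c - \tr (F *m Y^T) *+ 2 + \tr (Y *m S *m Y^T)) =
  (-2) * \tr (F *m (X - Y)^T) +
  (\tr ((X - Y) *m S *m Y^T) +
   (\tr (Y *m S *m (X - Y)^T) + \tr ((X - Y) *m S *m (X - Y)^T))).
Proof.
pose D := X - Y; rewrite -/D (_ : X = Y + D); last by rewrite /D addrC subrK.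
rewrite [(Y + D)^T]linearD /= !mulmxDl !mulmxDr !mxtraceD.
move: (\tr _) (\tr _) (\tr _) (\tr _) (\tr _) (\tr _) => a1 a2 a3 a4 a5 a6.
rewrite !mulr2n; ring.
Qed.

End PositiveForms.

(** * The optimal predictor and the limits of the estimators *)

Section Predictors.
Context {R : realType} {dx dy : nat} (H : nat).
Variables (A Bw : 'M[R]_dx) (C : 'M[R]_(dy, dx)) (Dv : 'M[R]_dy).
Hypothesis A_stable : spectral_radius A < 1.
Hypothesis Dv_posdef : posdefmx (Dv *m Dv^T).
Variable Sigma : 'M[R]_dx.
Hypothesis Sigma_lyapunov : Sigma = A *m Sigma *m A^T + Bw *m Bw^T.
Local Notation Gam := (output_lag_covariance A C Dv Sigma).
Local Notation Psi := (future_covariance H A C Dv Sigma).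
Local Notation ell := (loss_form (H := H) A C Dv Sigma).

Definition optimal_predictor : 'M[R]_(\sum_(i < H) dy, dy) := Psi *m invmx (Gam 0%N).

Lemma Dv_unit : Dv \in unitmx.
Proof. by have := posdefmx_unit Dv_posdef; rewrite unitmx_mul => /andP[]. Qed.

Lemma gram_ge0 n m (B : 'M[R]_(n, m)) (u : 'cV[R]_n) :
  0 <= (u^T *m (B *m B^T) *m u) ord0 ord0.
Proof.
have -> : u^T *m (B *m B^T) *m u = (B^T *m u)^T *m (B^T *m u).
  by rewrite trmx_mul trmxK !mulmxA.
by rewrite mxE; apply: sumr_ge0 => i _; rewrite mxE -expr2 sqr_ge0.
Qed.

Lemma output_covariance_posdef : posdefmx (Gam 0%N).
Proof.
have Sym : Sigma^T = Sigma.
  by apply: (lyapunov_sym A_stable _ Sigma_lyapunov); rewrite trmx_mul trmxK.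
have Spsd := lyapunov_psd A_stable Sigma_lyapunov (gram_ge0 Bw).
rewrite /output_lag_covariance expr0 mulmx1; split.
  by rewrite linearD /= !trmx_mul !trmxK Sym mulmxA.
move=> u u0; rewrite mulmxDr mulmxDl mxE ltr_wpDl//; last exact: (proj2 Dv_posdef).
by have := Spsd (C^T *m u); rewrite trmx_mul trmxK !mulmxA.
Qed.

Lemma optimal_predictorE : optimal_predictor *m Gam 0%N = Psi.
Proof. by rewrite mulmxKV//; exact: posdefmx_unit output_covariance_posdef. Qed.

Lemma loss_form_optimal G : ell G = ell optimal_predictor +
  \tr ((G - optimal_predictor) *m Gam 0%N *m (G - optimal_predictor)^T).
Proof.
have [Sym _] := output_covariance_posdef; set Gs := optimal_predictor.
have GsE : Gs *m Gam 0%N = Psi := optimal_predictorE.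
apply/eqP; rewrite addrC -subr_eq /loss_form quadratic_difference; apply/eqP.
have -> : \tr ((G - Gs) *m Gam 0%N *m Gs^T) = \tr (Psi *m (G - Gs)^T).
  by rewrite -GsE -mulmxA -{1}Sym -trmx_mul mxtrace_form_sym.
rewrite GsE; set a := \tr (Psi *m _); set b := \tr (_ *m _ *m _); ring.
Qed.

Lemma loss_form_min G : ell optimal_predictor <= ell G.
Proof.
rewrite [leRHS]loss_form_optimal lerDl; apply: mxtrace_form_ge0 => u.
have [_ pos] := output_covariance_posdef.
have [->|u0] := eqVneq u 0; first by rewrite mulmx0 mxE.
exact: ltW (pos u u0).
Qed.
Context {d : measure_display} {T : measurableType d}.
Variable P : probability T R.
Variables (w : nat -> 'I_dx -> {RV P >-> R}) (v : nat -> 'I_dy -> {RV P >-> R}).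
Hypothesis wv_noise : white_noise2 w v.
Local Notation y := (yr A Bw C Dv w v).
Let fut (t : nat) (o : T) := future H (random_output A Bw C Dv w v o) t.

(** Expanded around G0, the error of the loss consists of terms linear in E, a null factor times
    constants, and one quadratic term, a product of two null factors. *)
Lemma loss_form_cvg (G : nat -> T -> 'M[R]_(\sum_(i < H) dy, dy)) G0 :
  mnull P (fun n o => G n o - G0) ->
  (\int[P]_o (ell (G n o))%:E)%E @[n --> \oo] --> (ell G0)%:E.
Proof.
move=> nE; apply: expectation_cvg; have cst := fun p q (M : 'M[R]_(p, q)) => @mbdd_const _ _ _ P nat _ _ M.
pose E n o := G n o - G0.
have nEt : mnull P (fun n o => (E n o)^T) by exact: mnull_tr.
have : null P (fun n o => (-2) * \tr (Psi *m (E n o)^T) +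
    (\tr (E n o *m Gam 0%N *m G0^T) + (\tr (G0 *m Gam 0%N *m (E n o)^T) +
     \tr (E n o *m Gam 0%N *m (E n o)^T)))).
  apply: nullD; first by apply: nullZ; apply: null_mxtrace; apply: mnullMl.
  apply: nullD; first by apply: null_mxtrace; do 2 apply: mnullMr => //.
  apply: nullD; apply: null_mxtrace; first exact: mnullMl.
  by apply: mnullMM => //; exact: mnullMr.
apply: null_ext => n o; rewrite /E; set X := G n o.
by rewrite /loss_form quadratic_difference.
Qed.

Lemma rollout_null (F : nat -> T -> 'M[R]_dy) M : mnull P (fun n o => F n o - M) ->
  mnull P (fun n o => rollout H (F n o) - rollout H M).
Proof.
move=> nF k j; have := mnull_power (tagnat.sig1 k).+1 nF (tagnat.sig2 k) j.
by apply: null_ext => n o; rewrite !mxE.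
Qed.

(** With Gs Gam0 = Phi the averaged correlation of the residual at Gs with y tends to Phi - Gs Gam0
    = 0. This serves both estimators. *)
Lemma predictor_consistent p (Y : nat -> T -> 'cV[R]_p) (Phi Gs : 'M[R]_(p, dy))
    (G : nat -> T -> 'M[R]_(p, dy)) N0 :
  Gs *m Gam 0%N = Phi ->
  mnull P (fun n o => mavg (fun t o => Y t o *m (y t.+1 o)^T) n o - Phi) ->
  (forall n i j, measurable_fun [set: T] (fun o => G n o i j)) ->
  (forall n, (N0 <= n)%N -> {ae P, forall o,
    \sum_(t < n) sqnorm (Y t o - G n o *m y t.+1 o) <=
    \sum_(t < n) sqnorm (Y t o - Gs *m y t.+1 o)}) ->
  mnull P (fun n o => G n o - Gs).
Proof.
move=> GsE nY mG argG; apply: (least_squares_consistent A_stable Dv_unit wv_noise mG _ argG).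
have n0 := output_lag_average_from1 C Dv A_stable wv_noise Sigma_lyapunov 0.
have := mnullD nY (mnullN (mnullMl (@mbdd_const _ _ _ P nat _ _ Gs) n0)).
apply: mnull_ext => n o; rewrite mulmxBr GsE opprB addrA subrK -mavg_mull.
rewrite /mavg -scalerBr -sumrB; congr (_ *: _); apply: eq_bigr => t _.
by rewrite mulmxBl addn0 mulmxA.
Qed.

Lemma multi_step_consistent (G : nat -> T -> 'M[R]_(\sum_(i < H) dy, dy)) :
  (forall N, random_matrix (G N)) ->
  (\forall N \near \oo, {ae P, forall o,
     is_argmin (multi_step_cost H N (random_output A Bw C Dv w v o)) (G N o)}) ->
  mnull P (fun N o => G N o - optimal_predictor).
Proof.
move=> mG [N0 _ argG].
(* With N = n + H the cost has exactly n terms, t = 1, ..., n. *)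
have shifted : mnull P (fun n o => G (n + H)%N o - optimal_predictor).
  apply: (@predictor_consistent _ (fun t o => fut t.+1 o) Psi _ (fun n => G (n + H)%N) N0).
  - exact: optimal_predictorE.
  - apply: (@mnull_stack _ _ _ H A Bw C Dv _ _ P w v Sigma S) => m.
    exact: output_lag_average_from1.
  - by move=> n i j; exact: mG.
  move=> n N0n; have /argG : (N0 <= n + H)%N by rewrite (leq_trans N0n)// leq_addr.
  apply: filterS => o /(_ optimal_predictor).
  by rewrite /multi_step_cost addnK !big_add1 /= !big_mkord.
move=> i j; apply: null_shift (shifted i j) => n.
rewrite (_ : (fun o => _) = (fun o => G n o i j - optimal_predictor i j)).
  by apply: measurable_funB => //; exact: mG.
by apply/funext => o; rewrite !mxE.
Qed.

Lemma single_step_consistent (G : nat -> T -> 'M[R]_dy) :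
  (forall N, random_matrix (G N)) ->
  (\forall N \near \oo, {ae P, forall o,
     is_argmin (single_step_cost N (random_output A Bw C Dv w v o)) (G N o)}) ->
  mnull P (fun N o => G N o - Gam 1%N *m invmx (Gam 0%N)).
Proof.
move=> mG [N0 _ argG]; set G1 := _ *m _.
have shifted : mnull P (fun n o => G (n + 1)%N o - G1).
  apply: (@predictor_consistent _ (fun t o => y (t.+1 + 1) o) (Gam 1%N) _
    (fun n => G (n + 1)%N) N0).
  - by rewrite mulmxKV//; exact: posdefmx_unit output_covariance_posdef.
  - exact: output_lag_average_from1.
  - by move=> n i j; exact: mG.
  move=> n N0n; have /argG : (N0 <= n + 1)%N by rewrite (leq_trans N0n)// leq_addr.
  apply: filterS => o /(_ G1); under eq_bigr do rewrite addn1.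
  under [X in _ -> _ <= X]eq_bigr do rewrite addn1.
  by rewrite /single_step_cost addn1 !big_add1 /= !big_mkord.
move=> i j; apply: null_shift (shifted i j) => n.
rewrite (_ : (fun o => _) = (fun o => G n o i j - G1 i j)).
  by apply: measurable_funB => //; exact: mG.
by apply/funext => o; rewrite !mxE.
Qed.

End Predictors.

(** * Innovations form *)

Section BlockTraces.
Context {R : realType}.

Lemma mxtrace_mxcol_form (H p n : nat) (B : 'I_H -> 'M[R]_(p, n)) (Q : 'M[R]_n) :
  \tr ((\mxcol_(i < H) B i) *m Q *m (\mxcol_(i < H) B i)^T) =
  \sum_(i < H) \tr (B i *m Q *m (B i)^T).
Proof. by rewrite mxcol_mul tr_mxcol mul_mxcol_mxrow mxtrace_mxblock. Qed.

Lemma sqnorm_mxblock (H p : nat) (B : 'I_H -> 'I_H -> 'M[R]_p) :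
  sqnorm (\mxblock_(i < H, j < H) B i j) = \sum_(i < H) \sum_(j < H) sqnorm (B i j).
Proof.
rewrite sqnorm_tr tr_mxblock mul_mxblock mxtrace_mxblock.
apply: eq_bigr => i _; rewrite linear_sum; apply: eq_bigr => j _.
by rewrite sqnorm_tr.
Qed.

Lemma mxtrace_sub_form p n (Q : 'M[R]_n) (U W : 'M[R]_(p, n)) : Q^T = Q ->
  \tr ((U - W) *m Q *m (U - W)^T) =
  \tr (U *m Q *m U^T) - \tr (U *m Q *m W^T) *+ 2 + \tr (W *m Q *m W^T).
Proof.
move=> Qs; have E : \tr (W *m Q *m U^T) = \tr (U *m Q *m W^T).
  by rewrite mxtrace_form_sym trmx_mul Qs mulmxA.
rewrite -[W in LHS]opprK opprK [(U - W)^T]raddfB /= !mulmxBl !mulmxBr !raddfB /= E.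
by rewrite mulr2n; move: (\tr _) (\tr _) (\tr _) => a b c; ring.
Qed.

(** Row i of a block Toeplitz matrix such as [Gamma_e], reindexed by the distance l = i - j - 1
    below the diagonal. *)
Lemma sum_below_diagonal (H i : nat) (a : R) (g : nat -> R) : (i < H)%N ->
  \sum_(j < H) (if (i == j)%N then a else if (j < i)%N then g (i - j - 1)%N else 0) =
  a + \sum_(l < i) g l.
Proof.
move=> iH.
pose F j := if (i == j)%N then a else if (j < i)%N then g (i - j - 1)%N else 0.
rewrite -(big_mkord xpredT F) (big_cat_nat (n := i)) //=; last exact: ltnW.
rewrite addrC; congr (_ + _).
  rewrite big_ltn// {1}/F eqxx big_nat big1 ?addr0// => j /andP[ij _].
  by rewrite /F ltn_eqF// ltnNge ltnW.
rewrite big_nat_rev big_mkord; apply: eq_bigr => j _; rewrite /F add0n.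
have ji : (i - j.+1 < i)%N by rewrite ltn_subrL /= (leq_ltn_trans (leq0n j)).
rewrite gtn_eqF// ji; congr g.
by rewrite subKn ?ltn_ord// subn1.
Qed.

Lemma lyapunov_expand n (A X Q : 'M[R]_n) i : X = A *m X *m A^T + Q ->
  X = A ^+ i *m X *m (A ^+ i)^T + \sum_(l < i) A ^+ l *m Q *m (A ^+ l)^T.
Proof.
move=> XE; elim: i => [|i IH]; first by rewrite big_ord0 addr0 expr0 mul1mx trmx1 mulmx1.
have step : A ^+ i *m X *m (A ^+ i)^T =
    A ^+ i.+1 *m X *m (A ^+ i.+1)^T + A ^+ i *m Q *m (A ^+ i)^T.
  by rewrite {1}XE mulmxDr mulmxDl exprSr -mulmxE trmx_mul !mulmxA.
by rewrite {1}IH step big_ord_recr /= -addrA [_ *m Q *m _ + _]addrC.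
Qed.

End BlockTraces.

Section Innovations.
Context {R : realType} {dx dy : nat} (H : nat).
Variables (A Bw : 'M[R]_dx) (C : 'M[R]_(dy, dx)) (Dv : 'M[R]_dy).
Variables (S : 'M[R]_dx) (K : 'M[R]_(dx, dy)) (De : 'M[R]_dy) (X : 'M[R]_dx).
Hypothesis A_stable : spectral_radius A < 1.
Hypothesis Dv_posdef : posdefmx (Dv *m Dv^T).
Hypothesis S_riccati : is_stabilizing_riccati A Bw C Dv S.
Hypothesis K_gain : K = kalman_gain A C Dv S.
Hypothesis De_sqrt : is_sqrtmx (innovation_cov C Dv S) De.
Hypothesis X_lyapunov : X = A *m X *m A^T + (K *m De) *m (K *m De)^T.
Local Notation V := (innovation_cov C Dv S).
Local Notation Gam := (output_lag_covariance A C Dv (S + X)).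

Definition gain_stack : 'M[R]_(\sum_(i < H) dy, dy) := \mxcol_(i < H) (C *m A ^+ i *m K).

Lemma riccati_sym : S^T = S.
Proof. by have [[]] := S_riccati. Qed.

Lemma innovation_covE : De *m De^T = V.
Proof. by have [[-> _]] := De_sqrt. Qed.

Lemma innovation_cov_sym : V^T = V.
Proof. by rewrite -innovation_covE trmx_mul trmxK. Qed.

Lemma innovation_cov_unit : V \in unitmx.
Proof.
apply: posdefmx_unit; split; first exact: innovation_cov_sym.
move=> u u0; rewrite /innovation_cov mulmxDr mulmxDl mxE ltr_wpDl//.
  have [[_ Spos] _ _] := S_riccati.
  by have := Spos (C^T *m u); rewrite trmx_mul trmxK !mulmxA.
exact: (proj2 Dv_posdef).
Qed.

Lemma kalman_gainE : K *m V = A *m S *m C^T.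
Proof. by rewrite K_gain mulmxKV// innovation_cov_unit. Qed.

Lemma gain_form : (K *m De) *m (K *m De)^T = K *m V *m K^T.
Proof. by rewrite trmx_mul mulmxA -(mulmxA K) innovation_covE. Qed.

(** The state covariance is error covariance S plus estimate covariance X: the term subtracted in
    the Riccati equation is K V K^T, exactly the one added in the equation of X. *)
Lemma state_covariance_lyapunov : S + X = A *m (S + X) *m A^T + Bw *m Bw^T.
Proof.
have [_ SE _] := S_riccati.
have KVK : A *m S *m C^T *m invmx V *m C *m S *m A^T = K *m V *m K^T.
  have -> : K *m V *m K^T = K *m (K *m V)^T.
    by rewrite trmx_mul innovation_cov_sym mulmxA.
  by rewrite kalman_gainE K_gain /kalman_gain !trmx_mul trmxK riccati_sym !mulmxA.
rewrite {1}SE {1}X_lyapunov gain_form KVK [A *m (S + X)]mulmxDr [(_ + _) *m A^T]mulmxDl.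
move: (A *m S *m A^T) (A *m X *m A^T) (K *m V *m K^T) (Bw *m Bw^T) => a b c e.
by rewrite [b + c]addrC addrACA subrK addrA addrAC.
Qed.

Lemma innovation_sym : X^T = X.
Proof.
by apply: (lyapunov_sym A_stable _ X_lyapunov); rewrite trmx_mul trmxK.
Qed.

Lemma output_covariance_innovation : Gam 0%N = C *m X *m C^T + V.
Proof.
rewrite /output_lag_covariance expr0 mulmx1 /innovation_cov mulmxDr mulmxDl.
by rewrite [in RHS]addrCA addrA.
Qed.

Lemma output_lag_innovation i :
  Gam i.+1 = C *m A ^+ i *m A *m X *m C^T + C *m A ^+ i *m K *m V.
Proof.
rewrite /output_lag_covariance /= addr0 -(mulmxA _ K) kalman_gainE mulmxDr mulmxDl addrC.
by rewrite exprSr -mulmxE !mulmxA.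
Qed.

Lemma Gamma_e_sqnorm : sqnorm (Gamma_e H A C K De) =
  \sum_(i < H) (\tr V + \sum_(l < i) \tr (C *m (A ^+ l *m (K *m V *m K^T) *m (A ^+ l)^T) *m C^T)).
Proof.
rewrite /Gamma_e sqnorm_mxblock; apply: eq_bigr => i _.
rewrite -(sum_below_diagonal _
  (fun l => \tr (C *m (A ^+ l *m (K *m V *m K^T) *m (A ^+ l)^T) *m C^T)) (ltn_ord i)).
apply: eq_bigr => j _.
rewrite -?val_eqE /=; case: eqP => _; first by rewrite sqnorm_tr innovation_covE.
case: ifP => _; last first.
  by rewrite /sqnorm big1// => k _; rewrite big1// => l _; rewrite mxE expr0n.
by rewrite sqnorm_tr -gain_form !trmx_mul !mulmxA.
Qed.

(** The variance of y_(t+i+1) splits into the part carried by the estimate of x_(t+1) and the part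
    from the later innovations; i uses of the equation of X separate them. *)
Lemma output_covariance_trace : \tr (Gam 0%N) *+ H =
  \sum_(i < H) \tr (C *m A ^+ i *m X *m (C *m A ^+ i)^T) + sqnorm (Gamma_e H A C K De).
Proof.
rewrite Gamma_e_sqnorm -big_split /= -[in LHS](card_ord H) -sumr_const.
apply: eq_bigr => i _; rewrite output_covariance_innovation mxtraceD.
rewrite [in LHS](lyapunov_expand i X_lyapunov) mulmxDr mulmxDl mxtraceD gain_form.
have -> : \tr (C *m A ^+ i *m X *m (C *m A ^+ i)^T) =
    \tr (C *m (A ^+ i *m X *m (A ^+ i)^T) *m C^T) by rewrite trmx_mul !mulmxA.
by rewrite mulmx_sumr mulmx_suml linear_sum /= -addrA [\sum_(l < i) _ + _]addrC.
Qed.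

(** In the innovations form the prediction error would read (O - G C) xhat_t + (K^ - G) De e_t +
    [Gamma_e] times the future innovations, with uncorrelated summands. The proof checks the
    resulting identity of traces algebraically. *)
Lemma predictor_objective_loss G :
  predictor_objective C De X (Phi_mx H A C K) (gain_stack - G) + sqnorm (Gamma_e H A C K De) =
  loss_form (H := H) A C Dv (S + X) G.
Proof.
pose O : 'M[R]_(\sum_(i < H) dy, dx) := \mxcol_(i < H) (C *m A ^+ i *m A).
have OE : Phi_mx H A C K + (gain_stack - G) *m C = O - G *m C.
  rewrite mulmxBl addrA; congr (_ - _).
  rewrite /Phi_mx /gain_stack mxcol_mul -mxcolD; apply/eq_mxcol => i.
  by rewrite mulmxBr !mulmxA subrK.
have PsiE : future_covariance H A C Dv (S + X) = O *m X *m C^T + gain_stack *m V.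
  rewrite /future_covariance /O /gain_stack !mxcol_mul -mxcolD; apply/eq_mxcol => i.
  exact: output_lag_innovation.
(* One more use of the equation of X moves from the estimate at time t + 1 to the estimate and the
   innovation at time t. *)
have traces : \sum_(i < H) \tr (C *m A ^+ i *m X *m (C *m A ^+ i)^T) =
    \tr (O *m X *m O^T) + \tr (gain_stack *m V *m gain_stack^T).
  rewrite !mxtrace_mxcol_form -big_split /=; apply: eq_bigr => i _.
  rewrite [X in LHS]X_lyapunov gain_form mulmxDr mulmxDl mxtraceD.
  by rewrite !trmx_mul !mulmxA.
rewrite /predictor_objective OE -[_ *m De *m De^T]mulmxA innovation_covE.
rewrite (mxtrace_sub_form _ _ innovation_sym) (mxtrace_sub_form _ _ innovation_cov_sym).
rewrite /loss_form output_covariance_trace traces PsiE output_covariance_innovation.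
rewrite mulmxDl mulmxDr mulmxDl !mxtraceD trmx_mul !mulmxA !mulr2n.
move: (\tr _) (\tr _) (\tr _) (\tr _) (\tr _) (\tr _) => a1 a2 a3 a4 a5 a6.
ring.
Qed.

End Innovations.

Theorem mainTheorem6 (R : realType) (dx dy H : nat)
  (A Bw : 'M[R]_dx) (C : 'M[R]_(dy, dx)) (Dv : 'M[R]_dy)
  (H_ge1 : (1 <= H)%N)
  (A_stable : spectral_radius A < 1)
  (AC_observable : observable A C)
  (ABw_controllable : controllable A Bw)
  (Dv_posdef : posdefmx (Dv *m Dv^T))
  (* dataset rollout *)
  (d : measure_display) (T : measurableType d) (P : probability T R)
  (w : nat -> 'I_dx -> {RV P >-> R}) (v : nat -> 'I_dy -> {RV P >-> R})
  (wv_noise : white_noise2 w v)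
  (* evaluation rollout, on its own probability space *)
  (d' : measure_display) (T' : measurableType d') (P' : probability T' R)
  (w' : nat -> 'I_dx -> {RV P' >-> R}) (v' : nat -> 'I_dy -> {RV P' >-> R})
  (wv'_noise : white_noise2 w' v')
  (* least-squares predictors *)
  (Gms : nat -> T -> 'M[R]_(\sum_(i < H) dy, dy))
  (Gy : nat -> T -> 'M[R]_dy)
  (Gms_random : forall N, random_matrix (Gms N))
  (Gy_random : forall N, random_matrix (Gy N))
  (Gms_argmin : \forall N \near \oo, {ae P, forall o,
     is_argmin (multi_step_cost H N (random_output A Bw C Dv w v o))
       (Gms N o)})
  (Gy_argmin : \forall N \near \oo, {ae P, forall o,
     is_argmin (single_step_cost N (random_output A Bw C Dv w v o))
       (Gy N o)})
  (* innovations form *)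
  (S : 'M[R]_dx) (K : 'M[R]_(dx, dy)) (De : 'M[R]_dy) (Sxhat : 'M[R]_dx)
  (S_riccati : is_stabilizing_riccati A Bw C Dv S)
  (K_gain : K = kalman_gain A C Dv S)
  (De_sqrt : is_sqrtmx (innovation_cov C Dv S) De)
  (Sxhat_cov : is_stationary_covariance A (K *m De) Sxhat) :
  let y' := random_output A Bw C Dv w' v' in
  let L := loss P' y' H in
  let Gss := fun N o => rollout H (Gy N o) in
  let J := predictor_objective C De Sxhat (Phi_mx H A C K) in
  (* the limits defining L, B(Gms) and B(Gss) exist *)
  [/\ forall G, cvgn (mean_loss P' y' H G),
      cvgn (expected_loss P L Gms),
      cvgn (expected_loss P L Gss) /\ irreducible_error P L Gss \is a fin_num,
      (exists2 M0, is_argmin J M0 &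
         irreducible_error P L Gms = (J M0 + sqnorm (Gamma_e H A C K De))%:E)
    & (irreducible_error P L Gms <= irreducible_error P L Gss)%E].
Proof.
move=> y' L Gss J.
have X_lyapunov := stationary_covariance_lyapunov Sxhat_cov.
have Sigma_lyapunov := state_covariance_lyapunov Dv_posdef S_riccati K_gain De_sqrt X_lyapunov.
pose ell := loss_form (H := H) A C Dv (S + Sxhat).
pose Gs := optimal_predictor H A C Dv (S + Sxhat).
have JE G : J (gain_stack H A C K - G) + sqnorm (Gamma_e H A C K De) = ell G.
  exact: (predictor_objective_loss A_stable Dv_posdef S_riccati K_gain De_sqrt X_lyapunov G).
have LE : L = fun G => (ell G)%:E.
  apply/funext => G; exact: (loss_formE _ _ A_stable wv'_noise Sigma_lyapunov).
have ms_cvg : expected_loss P L Gms N @[N --> \oo] --> (ell Gs)%:E.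
  rewrite /expected_loss LE; apply: loss_form_cvg.
  exact: (multi_step_consistent A_stable Dv_posdef Sigma_lyapunov wv_noise Gms_random Gms_argmin).
pose G1 := output_lag_covariance A C Dv (S + Sxhat) 1 *m
  invmx (output_lag_covariance A C Dv (S + Sxhat) 0).
have ss_cvg : expected_loss P L Gss N @[N --> \oo] --> (ell (rollout H G1))%:E.
  rewrite /expected_loss LE; apply: loss_form_cvg; apply: rollout_null.
  exact: (single_step_consistent A_stable Dv_posdef Sigma_lyapunov wv_noise Gy_random Gy_argmin).
have BmsE : irreducible_error P L Gms = (ell Gs)%:E by apply: cvg_lim.
have BssE : irreducible_error P L Gss = (ell (rollout H G1))%:E by apply: cvg_lim.
split.
- move=> G; apply/cvg_ex; exists (ell G)%:E.
  exact: (mean_loss_cvg (C := C) (Dv := Dv) A_stable wv'_noise Sigma_lyapunov).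
- by apply/cvg_ex; exists (ell Gs)%:E.
- by split; [apply/cvg_ex; eexists; exact: ss_cvg|rewrite BssE].
- exists (gain_stack H A C K - Gs); last by rewrite BmsE JE.
  (* The map from G to K^ - G is a bijection, so minimising J over M is minimising [ell] over G. *)
  move=> M; have -> : M = gain_stack H A C K - (gain_stack H A C K - M) by rewrite opprB addrC subrK.
  rewrite -(lerD2r (sqnorm (Gamma_e H A C K De))) !JE.
  exact: (loss_form_min C A_stable Dv_posdef Sigma_lyapunov).
(* The limit of the rolled-out predictor is one competitor in the minimum attained by [Gs]. *)
by rewrite BmsE BssE lee_fin; exact: (loss_form_min C A_stable Dv_posdef Sigma_lyapunov).
Qed.
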